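(* Let $(t,y,z)\in[0,T)\times\mathbf R^n\times\mathbf R^{n\times d}$ and $\varepsilon\in[0,T-t]$. Then for $g\in\widehat{\mathcal G}_n$ and $h(s)\in l^2_{n\times d}(0,t+\varepsilon)$ such that $\int_0^{t+\varepsilon}|g(s,0,h(s))|ds<\infty$, the mean-field BSDE $$Y^{t+\varepsilon}_s=y+\int_0^{t+\varepsilon}h(r)dB_r+\int_s^{t+\varepsilon}g(r,E[Y^{t+\varepsilon}_r],Z^{t+\varepsilon}_r)dr-\int_s^{t+\varepsilon}Z^{t+\varepsilon}_rdB_r,\quad s\in[0,t+\varepsilon],$$ has an adapted solution $$(Y^{t+\varepsilon}_s,Z^{t+\varepsilon}_s)=\Big(\varphi^{t+\varepsilon}(s)+\int_0^sh(r)dB_r,\ h(s)\Big),\quad s\in[0,t+\varepsilon],$$ where $\varphi^{t+\varepsilon}(s)\in l^2_{n\times1}(0,t+\varepsilon)$ is a solution to the backward ODE $$\varphi^{t+\varepsilon}(s)=y+\int_s^{t+\varepsilon}g(r,\varphi^{t+\varepsilon}(r),h(r))dr,\quad s\in[0,t+\varepsilon].$$ Moreover, if $h(s)=z1_{[t,t+\varepsilon]}(s)$, $s\in[0,t+\varepsilon]$, and $Y^{t+\varepsilon}_s=\varphi^{t+\varepsilon}(s)+\int_0^sh(r)dB_r$, $s\in[0,t+\varepsilon]$, where $\varphi^{t+\varepsilon}$ solves the backward ODE $\varphi^{t+\varepsilon}(s)=y+\int_s^{t+\varepsilon}g(r,\varphi^{t+\varepsilon}(r),h(r))dr$, then for almost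 each $t\in[0,T)$, $$g(t,y,z)=\lim_{\varepsilon\to0}\frac1\varepsilon\big(Y^{t+\varepsilon}_t-y\big).$$
   Context: Let $(B_t)_{t\ge0}$ be a $d$-dimensional standard Brownian motion on a complete probability space $(\Omega,\mathcal F,P)$, with natural filtration $(\mathcal F_t)_{t\ge0}$ augmented by the $P$-null sets. $T,\mu>0$ are given constants. $\widehat{\mathcal G}_n$: deterministic measurable functions $g(t,y,z):[0,T]\times\mathbf R^n\times\mathbf R^{n\times d}\to\mathbf R^n$ such that for all $y_1,y_2\in\mathbf R^n$ (and all $z$), $|g(t,y_1,z)-g(t,y_2,z)|\le\mu|y_1-y_2|$ for a.e. $t$, and for all $z\in\mathbf R^{n\times d}$, $\int_0^T|g(t,0,z)|dt<\infty$. $l^2_{n\times m}(0,r)$: deterministic measurable functions $\psi:[0,r]\to\mathbf R^{n\times m}$ with $\int_0^r|\psi(s)|^2ds<\infty$.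
   Formalization: The Lipschitz bound is assumed for almost every t simultaneously for all y1, y2, z; if the null set may depend on them the claim fails, e.g. for g(t,y,z)=y^2 1_{z=t}, h(s)=s, y=2, t+ε=1, where the backward ODE blows up. *)

(* Defs.v *)
From HB Require Import structures.
From mathcomp Require Import all_boot all_order all_algebra.
From mathcomp Require Import all_classical all_reals all_analysis.
Set Implicit Arguments.
Unset Strict Implicit.
Unset Printing Implicit Defensive.
Import Order.TTheory GRing.Theory Num.Theory.
Import numFieldNormedType.Exports.
Local Open Scope classical_set_scope.
Local Open Scope ring_scope.

(** ** Euclidean matrices *)

Definition enorm (R : realType) (m n : nat) (A : 'M[R]_(m, n)) : R :=
  Num.sqrt (\sum_i \sum_j A i j ^+ 2).

Definition mx_cylinders (R : realType) (m n : nat) : set (set 'M[R]_(m, n)) :=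
  [set A | exists (i : 'I_m) (j : 'I_n) (C : set R),
     measurable C /\ A = (fun X : 'M[R]_(m, n) => X i j) @^-1` C].

(* The cylinders generate the Borel sigma-algebra of R^(m x n). *)
Definition borel_mx (R : realType) (m n : nat) :=
  g_sigma_algebraType (@mx_cylinders R m n).
HB.instance Definition _ (R : realType) (m n : nat) :=
  Measurable.on (borel_mx R m n).

Definition vec_int (R : realType) (n : nat) (a b : R) (f : R -> 'cV[R]_n)
  : 'cV[R]_n :=
  \col_i (\int[lebesgue_measure]_(s in `[a, b]) f s i 0).

(** ** Deterministic coefficients *)

Definition l2 (R : realType) (m n : nat) (r : R) (psi : R -> 'M[R]_(m, n))
  : Prop :=
  measurable_fun `[0, r] (psi : R -> borel_mx R m n) /\
  (\int[lebesgue_measure]_(s in `[0%R, r]) (enorm (psi s) ^+ 2)%:E < +oo)%E.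

(* The Lebesgue-null set of times off which the Lipschitz bound holds does not
   depend on the space variables. *)
Definition Ghat (R : realType) (n d : nat) (T mu : R)
    (g : R -> 'cV[R]_n -> 'M[R]_(n, d) -> 'cV[R]_n) : Prop :=
  [/\ measurable_fun (`[0, T] `*` setT `*` setT)
        (fun p : R * borel_mx R n 1 * borel_mx R n d =>
           g p.1.1 p.1.2 p.2 : borel_mx R n 1),
      {ae (@lebesgue_measure R), forall t, 0 <= t <= T ->
         forall y1 y2 z, enorm (g t y1 z - g t y2 z) <= mu * enorm (y1 - y2)} &
      forall z, (\int[lebesgue_measure]_(t in `[0%R, T])
                   (enorm (g t 0%R z))%:E < +oo)%E].

Definition backward_ode_solution (R : realType) (n d : nat)
    (g : R -> 'cV[R]_n -> 'M[R]_(n, d) -> 'cV[R]_n) (y : 'cV[R]_n)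
    (h : R -> 'M[R]_(n, d)) (r : R) (phi : R -> 'cV[R]_n) : Prop :=
  [/\ l2 r phi,
      (\int[lebesgue_measure]_(s in `[0%R, r])
         (enorm (g s (phi s) (h s)))%:E < +oo)%E &
      forall s, 0 <= s <= r ->
        phi s = y + vec_int s r (fun u => g u (phi u) (h u))].

(** ** Brownian motion and its augmented filtration *)

Definition past_events (R : realType) (dd : measure_display)
    (Omega : measurableType dd) (d : nat) (B : R -> Omega -> 'cV[R]_d) (s : R)
  : set (set Omega) :=
  [set A | exists (u : R) (C : set (borel_mx R d 1)),
     [/\ 0 <= u <= s, measurable C & A = B u @^-1` C]].

Definition brownian_motion (R : realType) (dd : measure_display)
    (Omega : measurableType dd) (P : probability Omega R) (d : nat)
    (B : R -> Omega -> 'cV[R]_d) : Prop :=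
  [/\ forall t, 0 <= t -> measurable_fun setT (B t : Omega -> borel_mx R d 1),
      {ae P, forall w, B 0 w = 0},
      {ae P, forall w, {within `[0, +oo[, continuous (fun t => B t w)}},
      (* B t - B s follows N(0, (t - s) I_d); [normal_prob] takes the standard
         deviation as its second parameter. *)
      forall s t, 0 <= s < t -> forall C : 'I_d -> set R,
        (forall i, measurable (C i)) ->
        P [set w | forall i, C i ((B t w - B s w) i 0)] =
        (\prod_(i < d) normal_prob 0 (Num.sqrt (t - s)) (C i))%E &
      forall s t, 0 <= s < t ->
        forall (A : set Omega) (C : set (borel_mx R d 1)),
        <<s past_events B s >> A -> measurable C ->
        P (A `&` [set w | C (B t w - B s w)%R]) =
        (P A * P [set w | C (B t w - B s w)%R])%E].

(* [augmented_past P B s] is Omega carrying the sigma-algebra F_s. *)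
Definition augmented_past (R : realType) (dd : measure_display)
    (Omega : measurableType dd) (P : probability Omega R) (d : nat)
    (B : R -> Omega -> 'cV[R]_d) (s : R) :=
  g_sigma_algebraType (past_events B s `|` P.-negligible).
HB.instance Definition _ (R : realType) (dd : measure_display)
    (Omega : measurableType dd) (P : probability Omega R) (d : nat)
    (B : R -> Omega -> 'cV[R]_d) (s : R) :=
  Measurable.on (augmented_past P B s).

Definition adapted (R : realType) (dd : measure_display)
    (Omega : measurableType dd) (P : probability Omega R) (d : nat)
    (B : R -> Omega -> 'cV[R]_d) (m n : nat) (r : R)
    (X : R -> Omega -> 'M[R]_(m, n)) : Prop :=
  forall s, 0 <= s <= r ->
    measurable_fun setT (X s : augmented_past P B s -> borel_mx R m n).

Definition progressive (R : realType) (dd : measure_display)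
    (Omega : measurableType dd) (P : probability Omega R) (d : nat)
    (B : R -> Omega -> 'cV[R]_d) (m n : nat) (r : R)
    (X : R -> Omega -> 'M[R]_(m, n)) : Prop :=
  forall s, 0 <= s <= r ->
    measurable_fun (`[0, s] `*` setT)
      (fun p : R * augmented_past P B s => X p.1 p.2 : borel_mx R m n).

Definition as_continuous (R : realType) (dd : measure_display)
    (Omega : measurableType dd) (P : probability Omega R) (m n : nat) (r : R)
    (X : R -> Omega -> 'M[R]_(m, n)) : Prop :=
  {ae P, forall w, {within `[0, r], continuous (fun s => X s w)}}.

(** ** Ito integral *)

Definition square_integrable (R : realType) (dd : measure_display)
    (Omega : measurableType dd) (P : probability Omega R) (m n : nat) (r : R)
    (Z : R -> Omega -> 'M[R]_(m, n)) : Prop :=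
  (\int[P]_w \int[lebesgue_measure]_(s in `[0%R, r])
     (enorm (Z s w) ^+ 2)%:E < +oo)%E.

Record simple_process (R : realType) (dd : measure_display)
    (Omega : measurableType dd) (P : probability Omega R) (d : nat)
    (B : R -> Omega -> 'cV[R]_d) (n : nat) := SimpleProcess {
  sp_size : nat ;
  sp_time : nat -> R ;
  sp_coef : nat -> Omega -> 'M[R]_(n, d) ;
  sp_time_mono : forall k, 0 <= sp_time k <= sp_time k.+1 ;
  sp_coef_adapted : forall k, measurable_fun setT
    (sp_coef k : augmented_past P B (sp_time k) -> borel_mx R n d) ;
  sp_coef_bounded : exists K, forall k w, enorm (sp_coef k w) <= K }.

Definition sp_eval (R : realType) (dd : measure_display)
    (Omega : measurableType dd) (P : probability Omega R) (d : nat)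
    (B : R -> Omega -> 'cV[R]_d) (n : nat) (S : simple_process P B n)
    (s : R) (w : Omega) : 'M[R]_(n, d) :=
  \sum_(k < sp_size S)
    (\1_(`]sp_time S k, sp_time S k.+1]) s : R) *: sp_coef S k w.

Definition sp_integral (R : realType) (dd : measure_display)
    (Omega : measurableType dd) (P : probability Omega R) (d : nat)
    (B : R -> Omega -> 'cV[R]_d) (n : nat) (S : simple_process P B n)
    (s : R) (w : Omega) : 'cV[R]_n :=
  \sum_(k < sp_size S) sp_coef S k w *m
    (B (Num.min (sp_time S k.+1) s) w - B (Num.min (sp_time S k) s) w).

(* I is (a continuous version of) the process s |-> \int_0^s Z dB on [0, r]. *)
Definition ito_integral (R : realType) (dd : measure_display)
    (Omega : measurableType dd) (P : probability Omega R) (d : nat)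
    (B : R -> Omega -> 'cV[R]_d) (n : nat) (r : R)
    (Z : R -> Omega -> 'M[R]_(n, d)) (I : R -> Omega -> 'cV[R]_n) : Prop :=
  [/\ progressive P B r Z, square_integrable P r Z,
      adapted P B r I, as_continuous P r I &
      exists S : nat -> simple_process P B n,
        (\int[P]_w \int[lebesgue_measure]_(s in `[0%R, r])
           (enorm (sp_eval (S k) s w - Z s w) ^+ 2)%:E)%E @[k --> \oo]
          --> 0%E /\
        forall s, 0 <= s <= r ->
          (\int[P]_w (enorm (sp_integral (S k) s w - I s w) ^+ 2)%:E)%E
            @[k --> \oo] --> 0%E].

(** ** Mean-field BSDE *)

Definition vec_expectation (R : realType) (dd : measure_display)
    (Omega : measurableType dd) (P : probability Omega R) (n : nat)
    (X : Omega -> 'cV[R]_n) : 'cV[R]_n :=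
  \col_i fine (expectation P (fun w => X w i 0)).

(* Adapted solution (Y, Z) on [0, r] of
   Y_s = xi + \int_s^r g(u, E[Y_u], Z_u) du - \int_s^r Z_u dB_u. *)
Definition mfbsde_solution (R : realType) (dd : measure_display)
    (Omega : measurableType dd) (P : probability Omega R) (d : nat)
    (B : R -> Omega -> 'cV[R]_d) (n : nat)
    (g : R -> 'cV[R]_n -> 'M[R]_(n, d) -> 'cV[R]_n) (r : R)
    (xi : Omega -> 'cV[R]_n)
    (Y : R -> Omega -> 'cV[R]_n) (Z : R -> Omega -> 'M[R]_(n, d)) : Prop :=
  [/\ adapted P B r Y /\ as_continuous P r Y,
      forall s, 0 <= s <= r -> (\int[P]_w (enorm (Y s w) ^+ 2)%:E < +oo)%E,
      progressive P B r Z /\ square_integrable P r Z,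
      {ae P, forall w, (\int[lebesgue_measure]_(u in `[0%R, r])
         (enorm (g u (vec_expectation P (Y u)) (Z u w)))%:E < +oo)%E} &
      exists I, ito_integral P B r Z I /\
        {ae P, forall w, forall s, 0 <= s <= r ->
           Y s w = xi w
             + vec_int s r (fun u => g u (vec_expectation P (Y u)) (Z u w))
             - (I r w - I s w)}].

(* Main.v *)
(** The integrand h and the solution phi of the backward equation are deterministic,
    and a stochastic integral has mean zero, so phi + int h dB has expectation phi
    and the mean-field equation for it is the ordinary equation for phi, which is
    solved by Picard iteration.  The integral of h is the limit of the integrals of
    deterministic step functions: it converges in square mean by the isometry, and
    uniformly on [0, r] almost surely by Kolmogorov's maximal inequality and the
    Borel-Cantelli lemma, which gives adapted continuous paths.

    When h vanishes before t, the integral of h over [0, t] is almost surely 0, so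
    Y^{t+eps}_t is the constant phi(t) and (Y^{t+eps}_t - y) / eps is an average of
    g(., phi, z) over [t, t+eps].  By the Lipschitz condition it differs from the
    average of g(., y, z) by O(int_t^{t+eps} |g(u, y, z)| du), and the averages of
    g(., y, z) converge to g(t, y, z) at every Lebesgue point t. *)

Require Import Defs.
From HB Require Import structures.
From mathcomp Require Import all_boot all_order all_algebra.
From mathcomp Require Import all_classical all_reals all_analysis.
From mathcomp Require Import measurable_realfun zify ring lra.
Set Implicit Arguments.
Unset Strict Implicit.
Unset Printing Implicit Defensive.
Import Order.TTheory GRing.Theory Num.Theory.
Import numFieldNormedType.Exports.
Local Open Scope classical_set_scope.
Local Open Scope ring_scope.

(** * Square-integrable variables *)

(** Three obstacles shape the development. The integral in the hypotheses is any process [hB]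
    satisfying [ito_integral], whose approximating simple processes are unknown and possibly random.
    Its mean and its vanishing are therefore proved for arbitrary simple processes and passed to the
    limit in mean square, while deterministic grid processes serve for existence. Next, the
    independence axiom concerns the raw past of [B], whereas adaptedness refers to the augmented
    filtration, so independence is first carried over null sets; in return, the augmentation allows
    a limit to be redefined off a null event without losing adaptedness. Finally, the null set of
    times must be fixed before [Y] is given, and the solution [phi] varies with [eps]; hence the
    error of the difference quotient is bounded by a function of [eps] alone, the same for every
    [phi]. The null events in [Omega] still depend on [eps], which ranges over a continuum, so the
    limit is taken in mean square, and almost surely along each sequence. *)

Section SquareIntegrable.
Context {d : measure_display} {T : measurableType d} {R : realType}.
Variable P : probability T R.
Implicit Types X Y Z : T -> R.

Definition sqint X :=
  measurable_fun setT X /\ P.-integrable setT (EFin \o (fun w => X w ^+ 2)).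

Definition ip X Y : R := \int[P]_w (X w * Y w).

Lemma sqint_ge0P X : measurable_fun setT X ->
  (\int[P]_w ((X w) ^+ 2)%:E < +oo)%E -> sqint X.
Proof.
move=> mX iX; split => //; apply/integrableP; split.
  by apply/measurable_EFinP; exact: measurable_funX.
rewrite (eq_integral (fun w => ((X w) ^+ 2)%:E)) // => w _ /=.
by rewrite ger0_norm // sqr_ge0.
Qed.

Lemma integrable_dom (X : T -> R) (Y : T -> R) : measurable_fun setT X ->
  P.-integrable setT (EFin \o Y) -> (forall w, `|X w| <= Y w) ->
  P.-integrable setT (EFin \o X).
Proof.
move=> mX iY XY; apply: (le_integrable measurableT _ _ iY).
  exact/measurable_EFinP.
by move=> w _ /=; rewrite lee_fin (le_trans (XY w)) // ler_norm.
Qed.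

Lemma sqint_mul X Y : sqint X -> sqint Y ->
  P.-integrable setT (EFin \o (fun w => X w * Y w)).
Proof.
move=> [mX iX] [mY iY].
apply: (@integrable_dom _ (fun w => X w ^+ 2 + Y w ^+ 2)).
- exact: measurable_funM.
- by have := integrableD measurableT iX iY; apply: eq_integrable.
move=> w; rewrite normrM.
have := sqr_ge0 (`|X w| - `|Y w|); rewrite -(real_normK (num_real (X w))).
rewrite -(real_normK (num_real (Y w))); nra.
Qed.

Lemma sqint_cst (c : R) : sqint (fun=> c).
Proof.
split; first exact: measurable_cst.
exact: finite_measure_integrable_cst.
Qed.

Lemma sqint_integrable X : sqint X -> P.-integrable setT (EFin \o X).
Proof.
move=> sX; have := sqint_mul sX (sqint_cst 1).
by apply: eq_integrable => // w _ /=; rewrite mulr1.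
Qed.

Lemma sqintZ (c : R) X : sqint X -> sqint (fun w => c * X w).
Proof.
move=> [mX iX]; split; first exact: measurable_funM.
have := integrableZl measurableT (c ^+ 2) iX.
by apply: eq_integrable => // w _ /=; rewrite exprMn EFinM.
Qed.

Lemma sqintN X : sqint X -> sqint (fun w => - X w).
Proof. by move=> /(sqintZ (-1)); under eq_fun do rewrite mulN1r. Qed.

Lemma sqintD X Y : sqint X -> sqint Y -> sqint (fun w => X w + Y w).
Proof.
move=> sX sY; have [mX iX] := sX; have [mY iY] := sY.
split; first exact: measurable_funD.
have i1 := integrableD measurableT iX iY.
have i2 := integrableZl measurableT 2 (sqint_mul sX sY).
have := integrableD measurableT i1 i2.
by apply: eq_integrable => // w _ /=; congr EFin; ring.
Qed.

Lemma sqintB X Y : sqint X -> sqint Y -> sqint (fun w => X w - Y w).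
Proof. by move=> sX sY; apply: sqintD => //; exact: sqintN. Qed.

Lemma sqint_sum (I : Type) (r : seq I) (Q : pred I) (F : I -> T -> R) :
  (forall i, Q i -> sqint (F i)) -> sqint (fun w => \sum_(i <- r | Q i) F i w).
Proof.
move=> sF; elim: r => [|i r IH].
  by under eq_fun do rewrite big_nil; exact: sqint_cst.
under eq_fun do rewrite big_cons.
by case: (boolP (Q i)) => // Qi; apply: sqintD => //; exact: sF.
Qed.

Lemma sqint_bM X Y (K : R) : measurable_fun setT X -> (forall w, `|X w| <= K) ->
  sqint Y -> sqint (fun w => X w * Y w).
Proof.
move=> mX XK sY; have [mY iY] := sY; split; first exact: measurable_funM.
apply: (@integrable_dom _ (fun w => K ^+ 2 * Y w ^+ 2)).
- by apply: measurable_funX; exact: measurable_funM.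
- by have := integrableZl measurableT (K ^+ 2) iY; exact: eq_integrable.
move=> w; rewrite ger0_norm ?sqr_ge0 // exprMn ler_wpM2r ?sqr_ge0 //.
by rewrite -(real_normK (num_real (X w))) lerXn2r ?nnegrE // (le_trans _ (XK w)).
Qed.

Lemma ipC X Y : ip X Y = ip Y X.
Proof. by rewrite /ip; under eq_Rintegral do rewrite mulrC. Qed.

Lemma ipDl X Y Z : sqint X -> sqint Y -> sqint Z ->
  ip (fun w => X w + Y w) Z = ip X Z + ip Y Z.
Proof.
move=> sX sY sZ; rewrite /ip; under eq_Rintegral do rewrite mulrDl.
by rewrite RintegralD //; exact: sqint_mul.
Qed.

Lemma ipZl (c : R) X Y : sqint X -> sqint Y ->
  ip (fun w => c * X w) Y = c * ip X Y.
Proof.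
move=> sX sY; rewrite /ip; under eq_Rintegral do rewrite -mulrA.
by rewrite RintegralZl //; exact: sqint_mul.
Qed.

Lemma ipBl X Y Z : sqint X -> sqint Y -> sqint Z ->
  ip (fun w => X w - Y w) Z = ip X Z - ip Y Z.
Proof.
move=> sX sY sZ; rewrite ipDl //; last exact: sqintN.
congr (_ + _); rewrite -mulN1r -ipZl //; rewrite /ip.
by apply: eq_Rintegral => w _; rewrite mulN1r.
Qed.

Lemma ip_suml (I : Type) (r : seq I) (Q : pred I) (F : I -> T -> R) Z :
  (forall i, Q i -> sqint (F i)) -> sqint Z ->
  ip (fun w => \sum_(i <- r | Q i) F i w) Z = \sum_(i <- r | Q i) ip (F i) Z.
Proof.
move=> sF sZ; elim: r => [|i r IH].
  rewrite big_nil /ip; under eq_Rintegral do rewrite big_nil mul0r.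
  by rewrite Rintegral_cst // mul0r.
under eq_fun do rewrite big_cons.
rewrite big_cons; case: (boolP (Q i)) => // Qi.
by rewrite ipDl ?IH //; [exact: sF | exact: sqint_sum].
Qed.

Lemma ip_sumr (I : Type) (r : seq I) (Q : pred I) (F : I -> T -> R) Z :
  (forall i, Q i -> sqint (F i)) -> sqint Z ->
  ip Z (fun w => \sum_(i <- r | Q i) F i w) = \sum_(i <- r | Q i) ip Z (F i).
Proof.
move=> sF sZ; rewrite ipC ip_suml //.
by apply: eq_bigr => i _; rewrite ipC.
Qed.

Lemma ipDr X Y Z : sqint X -> sqint Y -> sqint Z ->
  ip Z (fun w => X w + Y w) = ip Z X + ip Z Y.
Proof. by move=> *; rewrite ipC ipDl // ipC (ipC Y). Qed.

Lemma ipBr X Y Z : sqint X -> sqint Y -> sqint Z ->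
  ip Z (fun w => X w - Y w) = ip Z X - ip Z Y.
Proof. by move=> *; rewrite ipC ipBl // ipC (ipC Y). Qed.

Lemma ipZr (c : R) X Y : sqint X -> sqint Y ->
  ip Y (fun w => c * X w) = c * ip Y X.
Proof. by move=> *; rewrite ipC ipZl // ipC. Qed.

Lemma ip_ge0 X : 0 <= ip X X.
Proof. by apply: Rintegral_ge0 => w _; rewrite -expr2 sqr_ge0. Qed.

Lemma integral_sqint X : sqint X -> (\int[P]_w ((X w) ^+ 2)%:E)%E = (ip X X)%:E.
Proof.
move=> sX; rewrite /ip /Rintegral fineK; last first.
  by apply: integrable_fin_num => //; exact: sqint_mul.
by apply: eq_integral => w _; rewrite expr2.
Qed.

(** Variances are nonnegative: expand the mean square of [X - a], where [a] is the mean of [X]. *)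
Lemma ip1_le X : sqint X -> (ip X (fun=> 1)) ^+ 2 <= ip X X.
Proof.
move=> sX; have s1 := sqint_cst 1; set a := ip X _.
have := ip_ge0 (fun w => X w - a * 1).
have sa : sqint (fun=> a * 1) by exact: sqint_cst.
have sB := sqintB sX sa.
rewrite (ipBl sX sa sB) (ipZl a s1 sB) !(ipBr sX sa) // !(ipZr a s1) //.
rewrite (ipC _ X) -/a.
have -> : ip (fun=> 1) (fun=> 1) = 1 :> R.
  rewrite /ip /Rintegral integral_cst // mulr1 mul1e.
  by have := probability_setT P => /= ->.
by rewrite expr2; nra.
Qed.

(* The joint law of independent variables is the product of the marginal laws,
   so the expectation of the product factorises by Fubini. *)
Lemma indep_ip X Y : measurable_fun setT X -> measurable_fun setT Y ->
  (forall A C : set R, measurable A -> measurable C ->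
     P (X @^-1` A `&` Y @^-1` C) = (P (X @^-1` A) * P (Y @^-1` C))%E) ->
  P.-integrable setT (EFin \o X) -> P.-integrable setT (EFin \o Y) ->
  P.-integrable setT (EFin \o (fun w => X w * Y w)) /\
  ip X Y = (\int[P]_w X w) * (\int[P]_w Y w).
Proof.
move=> mX mY XY iX iY.
pose X' : {mfun T >-> R} := mfun_Sub (mem_set mX).
pose Y' : {mfun T >-> R} := mfun_Sub (mem_set mY).
have mXY : measurable_fun setT (fun w => (X w, Y w)) by exact: measurable_fun_pair.
pose XY' : {mfun T >-> (R * R)%type} := mfun_Sub (mem_set mXY).
pose m1 : probability _ R := distribution P X'.
pose m2 : probability _ R := distribution P Y'.
pose m : probability _ R := distribution P XY'.
have mE (A : set (R * R)) : measurable A -> (m1 \x m2)%E A = m A.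
  by move=> mA; exact: product_measure_unique.
have mM : measurable_fun setT (fun p : R * R => p.1 * p.2).
  by apply: measurable_funM; [exact: measurable_fst|exact: measurable_snd].
have mME : measurable_fun setT (fun p : R * R => (p.1 * p.2)%:E).
  exact/measurable_EFinP.
have i12 : (m1 \x m2)%E.-integrable setT (fun p : R * R => (p.1 * p.2)%:E).
  apply/integrable12ltyP => //=.
  have mn : measurable_fun setT (fun x : R => `|x|%:E).
    by apply/measurable_EFinP; exact: normr_measurable.
  have fX : (\int[m1]_x `|x|%:E < +oo)%E.
    rewrite ge0_integral_distribution //.
    by have /integrableP[_] := iX.
  have fY : (\int[m2]_x `|x|%:E < +oo)%E.
    rewrite ge0_integral_distribution //.
    by have /integrableP[_] := iY.
  rewrite (@eq_integral _ _ _ m1 _ (fun x : R => `|x|%:E * \int[m2]_y `|y|%:E)%E); last first.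
    move=> x _; rewrite -ge0_integralZl_EFin //.
    by apply: eq_integral => y _; rewrite normrM EFinM.
  rewrite ge0_integralZr //; last exact: integral_ge0.
  by rewrite lte_mul_pinfty // ?integral_ge0 // ge0_fin_numE // integral_ge0.
have im : m.-integrable setT (fun p : R * R => (p.1 * p.2)%:E).
  have /integrableP[_ i1] := i12; apply/integrableP; split => //.
  rewrite (@eq_measure_integral _ _ _ _ (m1 \x m2)%E) //.
  by move=> A mA _; apply/esym; exact: mE.
have iXY : P.-integrable setT (EFin \o (fun w => X w * Y w)).
  have /integrableP[_] := im; rewrite ge0_integral_distribution //; last first.
    exact: measurableT_comp.
  move=> fin; apply/integrableP; split => //.
  by apply/measurable_EFinP; exact: measurable_funM.
split => //; rewrite /ip /Rintegral.
have -> : (\int[P]_w (X w * Y w)%:E)%E = (\int[m]_p (p.1 * p.2)%:E)%E.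
  by rewrite integral_distribution.
rewrite (@eq_measure_integral _ _ _ _ (m1 \x m2)%E); last first.
  by move=> A mA _; apply/esym; exact: mE.
rewrite -integral12_prod_meas1 //=.
have iX1 : m1.-integrable setT (EFin : R -> _).
  by apply: integrable_pushforward => //; rewrite preimage_setT.
have iY1 : m2.-integrable setT (EFin : R -> _).
  by apply: integrable_pushforward => //; rewrite preimage_setT.
rewrite /fubini_F.
rewrite (@eq_integral _ _ _ m1 _ (fun x : R => x%:E * \int[m2]_y y%:E)%E); last first.
  move=> x _; rewrite -integralZl //.
have -> : (\int[m2]_x x%:E)%E = (\int[P]_w (Y w)%:E)%E.
  by rewrite integral_distribution.
have fY : (\int[P]_w (Y w)%:E)%E \is a fin_num by exact: integrable_fin_num.
have fX : (\int[P]_w (X w)%:E)%E \is a fin_num by exact: integrable_fin_num.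
rewrite -{1}(fineK fY) integralZr //.
have -> : (\int[m1]_x x%:E)%E = (\int[P]_w (X w)%:E)%E.
  by rewrite integral_distribution.
by rewrite fineM.
Qed.

End SquareIntegrable.

(** * Moments of the normal law *)

Section Density.
Context {d : measure_display} {T : measurableType d} {R : realType}.
Variables (mu nu : {measure set T -> \bar R}) (p : T -> R).
Hypothesis mp : measurable_fun setT p.
Hypothesis p0 : forall x, 0 <= p x.
Hypothesis nuE : forall A, measurable A -> nu A = (\int[mu]_(x in A) (p x)%:E)%E.

Import HBNNSimple.

(** Both sides are limits of integrals of the same increasing simple functions, and on an indicator
    the identity is [nuE]. This turns [normal_prob], known on sets, into a rule for integrals. *)
Lemma ge0_integral_density (f : T -> \bar R) : measurable_fun setT f ->
  (forall x, 0 <= f x)%E ->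
  (\int[nu]_x f x = \int[mu]_x (f x * (p x)%:E))%E.
Proof.
move=> mf f0.
pose f_ := nnsfun_approx measurableT mf.
have mpE : measurable_fun setT (EFin \o p) by exact/measurable_EFinP.
transitivity (lim (\int[nu]_x (f_ n x)%:E @[n --> \oo])%E).
  rewrite -monotone_convergence//=.
  - apply: eq_integral => ? /[!inE] xD; apply/esym/cvg_lim => //=.
    exact: cvg_nnsfun_approx.
  - by move=> n; exact/measurable_EFinP/measurable_funTS.
  - by move=> n ? _; rewrite lee_fin.
  - by move=> ? _ ? ? mn; rewrite lee_fin; exact/lefP/nd_nnsfun_approx.
transitivity (lim (\int[mu]_x ((f_ n x)%:E * (p x)%:E) @[n --> \oo])%E); last first.
  rewrite -monotone_convergence//=.
  - apply: eq_integral => x _; apply/cvg_lim => //.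
    apply: cvgeZr => //; exact: cvg_nnsfun_approx.
  - by move=> n; apply: emeasurable_funM => //; exact/measurable_EFinP.
  - by move=> n x _; rewrite mule_ge0 ?lee_fin.
  - move=> x _ m n mn; rewrite lee_wpmul2r ?lee_fin //.
    exact/lefP/nd_nnsfun_approx.
congr (lim (_ @ \oo)); apply/funext => n.
rewrite /f_; move: (nnsfun_approx measurableT mf n) => g.
under eq_integral do rewrite fimfunE -fsumEFin//.
rewrite ge0_integral_fsum//; last 2 first.
  - by move=> r; exact/measurable_EFinP/measurableT_comp.
  - by move=> r x _; rewrite EFinM nnfun_muleindic_ge0.
under [RHS]eq_integral.
  move=> x xD; rewrite fimfunE -fsumEFin// ge0_mule_fsuml; last first.
    by move=> r; rewrite EFinM nnfun_muleindic_ge0.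
  over.
rewrite [RHS]ge0_integral_fsum//; last 2 first.
  - move=> r; apply: emeasurable_funM => //.
    exact/measurable_EFinP/measurableT_comp.
  - move=> r x _; rewrite EFinM mule_ge0 ?lee_fin //.
    by rewrite -lee_fin EFinM nnfun_muleindic_ge0.
apply: eq_fsbigr => r _.
rewrite integralZl_indic_nnsfun// integral_indic// setIT nuE //.
(* Pulling [r] out of an integral asks for [0 <= r]; a negative [r] is not a value of [g], so both
   sides are then 0. *)
case: (ltP r 0) => r0.
  have g0 : g @^-1` [set r] = set0.
    by apply/preimage10P => -[x _ gx]; move: r0; rewrite -gx ltNge fun_ge0.
  rewrite g0 integral_set0 mule0 integral0_eq // => x _.
  by rewrite indic0 mulr0 mul0e.
rewrite -ge0_integralZl //; last 2 first.
- exact: measurable_funTS.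
- by move=> x _; rewrite lee_fin.
rewrite integral_mkcond /=; apply: eq_integral => x _; rewrite /patch indicE.
by case: (_ \in _); rewrite ?mulr1 ?mulr0 ?mul0e ?mule0.
Qed.

End Density.

Lemma ge0_integral_law d d' (T : measurableType d) (T' : measurableType d')
  (R : realType) (P : probability T R) (mu : {measure set T' -> \bar R})
  (p : T' -> R) (X : T -> T') (f : T' -> \bar R) :
  measurable_fun setT p -> (forall x, 0 <= p x) -> measurable_fun setT X ->
  (forall C, measurable C -> P (X @^-1` C) = (\int[mu]_(x in C) (p x)%:E)%E) ->
  measurable_fun setT f -> (forall x, 0 <= f x)%E ->
  (\int[P]_w f (X w) = \int[mu]_x (f x * (p x)%:E))%E.
Proof.
move=> mp p0 mX XP mf f0; pose X' : {mfun T >-> T'} := mfun_Sub (mem_set mX).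
rewrite -[LHS](ge0_integral_distribution X' mf f0).
by apply: ge0_integral_density => // A mA; rewrite -XP.
Qed.

Section NormalMoments.
Context {R : realType}.
Notation mu := (@lebesgue_measure R).

(** The fundamental theorem of calculus on [-n, n], then dominated convergence. Each moment of the
    normal law below is obtained by exhibiting a primitive whose boundary term vanishes. *)
Lemma integralT_derive_eq0 (F f : R -> R) : continuous f ->
  (forall x : R, is_derive x (1:R) F (f x)) ->
  mu.-integrable setT (EFin \o f) ->
  (F n%:R - F (- n%:R)) @[n --> \oo] --> (0 : R) ->
  (\int[mu]_x (f x)%:E = 0)%E.
Proof.
move=> cf dF intf F0.
have cF : continuous F.
  move=> x; apply: differentiable_continuous; apply/derivable1_diffP.
  exact: (@ex_derive _ _ _ _ _ _ _ (dF x)).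
pose f_ n x := ((f x)%:E * (\1_(`[(- n%:R : R), n%:R]) x)%:E)%E.
have mf : measurable_fun setT f by exact: continuous_measurable_fun.
have [] := @dominated_convergence _ _ _ mu setT measurableT f_ (EFin \o f)
  (fun x => `|(f x)%:E|%E).
- move=> n; apply/measurable_EFinP; exact: measurable_funM.
- exact/measurable_EFinP.
- apply: aeW => x _; apply: cvg_near_cst.
  exists (Num.bound `|x|) => // n /= bn; rewrite /f_ indicE mem_set ?mule1 //=.
  rewrite in_itv /= -ler_norml; apply: (le_trans (ltW (archi_boundP _))) => //.
  by rewrite ler_nat.
- exact: integrable_abse.
- apply: aeW => x n _; rewrite /f_ -EFinM /= lee_fin normrM ler_piMr //.
  by rewrite indicE; case: (_ \in _); rewrite /= ?normr1 ?normr0.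
move=> _ _ /= lim; apply: (@cvg_unique _ (@ereal_hausdorff R) _ _ _ _ lim).
have : (F n%:R - F (- n%:R))%:E @[n --> \oo] --> (0 : R)%:E.
  by apply: cvg_EFin => //; exact: nearW.
apply: cvg_trans; apply: near_eq_cvg; exists 1%N => // n /= n0.
have n1 : - n%:R < n%:R :> R.
  have : 0 < n%:R :> R by rewrite ltr0n.
  lra.
rewrite EFinB -(@continuous_FTC2 _ f F) //.
- rewrite [in LHS]integral_mkcond /=; apply: eq_integral => x _.
  rewrite /f_ /patch /= indicE; case: (_ \in _); by rewrite ?mule1 ?mule0.
- exact: continuous_subspaceT.
- split.
  + by move=> x _; exact: (@ex_derive _ _ _ _ _ _ _ (dF x)).
  + exact/cvg_at_right_filter/cF.
  + exact/cvg_at_left_filter/cF.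
- by move=> x _; rewrite derive1E; exact: (@derive_val _ _ _ _ _ _ _ (dF x)).
Qed.

(** This is [1 + u <= expR u] at u = x^2 / c. *)
Lemma expRN_sqr_le (c x : R) : 0 < c ->
  x ^+ 2 * expR (- (x ^+ 2 / c)) <= c.
Proof.
move=> c0; have := expR_ge1Dx (x ^+ 2 / c); set u := x ^+ 2 / c => h.
have -> : x ^+ 2 = c * u by rewrite /u mulrCA divff ?mulr1 // gt_eqF.
rewrite -mulrA -[leRHS]mulr1 ler_wpM2l // ?(ltW c0) //.
rewrite expRN -ler_pdivlMr ?invr_gt0 ?expR_gt0 // invrK mul1r.
by apply: le_trans h; rewrite lerDr.
Qed.

Variable s : R.
Hypothesis s0 : 0 < s.
Let p := normal_pdf (0 : R) s.
Let c := s ^+ 2 *+ 2.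
Let c0 : 0 < c. Proof. by rewrite /c pmulrn_lgt0 // exprn_gt0. Qed.

Let pE x : p x = normal_peak s * expR (- (x ^+ 2 / c)).
Proof. by rewrite /p normal_pdfE ?gt_eqF // /normal_fun subr0 mulNr. Qed.

Let derive_p x : is_derive x (1:R) p (- (x / s ^+ 2) * p x).
Proof.
have -> : p = fun x => normal_peak s * expR (- (x ^+ 2 / c)).
  by apply/funext => y; exact: pE.
apply: is_derive_eq => /=.
rewrite /GRing.scale /= /c; field; rewrite ?mulr_natr.
by rewrite gt_eqF.
Qed.

Let cp : continuous p.
Proof. by apply: continuous_normal_pdf; rewrite gt_eqF. Qed.

Let mp : measurable_fun setT p.
Proof. exact: measurable_normal_pdf. Qed.

Let ip_p : mu.-integrable setT (EFin \o p).
Proof. by apply: integrable_normal_pdf; rewrite gt_eqF. Qed.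

Let ixxp : mu.-integrable setT (EFin \o (fun x => x ^+ 2 * p x)).
Proof.
(* The exponential is split into two equal factors: one absorbs x^2 at the cost of the constant 2c,
   and the other is, up to the peaks, the normal density of standard deviation [s']. *)
pose s' := Num.sqrt 2 * s.
have s'0 : 0 < s' by rewrite mulr_gt0 // sqrtr_gt0.
pose K := 2 * c * normal_peak s / normal_peak s'.
have pk0 : 0 < normal_peak s' by rewrite normal_peak_gt0 // gt_eqF.
have iK : mu.-integrable setT (EFin \o (fun x => K * normal_pdf 0 s' x)).
  have := integrableZl measurableT K (integrable_normal_pdf 0 s').
  by apply: eq_integrable.
apply: (le_integrable measurableT _ _ iK) => //.
  by apply/measurable_EFinP; apply: measurable_funM.
move=> x0 _ /=; move: (x0 : R) => {x0} x; rewrite lee_fin !ger0_norm; last 2 first.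
- by rewrite !mulr_ge0 ?sqr_ge0 ?invr_ge0 ?normal_peak_ge0 ?normal_pdf_ge0 // ltW.
- by rewrite mulr_ge0 ?sqr_ge0 ?normal_pdf_ge0.
rewrite pE (normal_pdfE _ (lt0r_neq0 s'0)) /normal_fun subr0.
have -> : s' ^+ 2 *+ 2 = 2 * c.
  by rewrite /s' exprMn sqr_sqrtr // /c; ring.
rewrite /K; have -> : 2 * c * normal_peak s / normal_peak s' *
  (normal_peak s' * expR (- x ^+ 2 / (2 * c))) =
  normal_peak s * (2 * c * expR (- (x ^+ 2 / (2 * c)))).
  by rewrite mulNr; field; rewrite gt_eqF.
rewrite mulrCA ler_wpM2l ?normal_peak_ge0 //.
have -> : - (x ^+ 2 / c) = - (x ^+ 2 / (2 * c)) + - (x ^+ 2 / (2 * c)).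
  rewrite invfM mulrCA [2^-1 * _]mulrC; set u := x ^+ 2 / c; lra.
rewrite expRD mulrA ler_wpM2r ?expR_ge0 //.
by apply: expRN_sqr_le; rewrite mulr_gt0.
Qed.

Let ixp : mu.-integrable setT (EFin \o (fun x => x * p x)).
Proof.
have i2 := integrableD measurableT ip_p ixxp.
apply: (le_integrable measurableT _ _ i2) => //.
  by apply/measurable_EFinP; apply: measurable_funM.
move=> x _ /=; rewrite lee_fin normrM.
have p0 : 0 <= p x by exact: normal_pdf_ge0.
rewrite [X in _ * X]ger0_norm // [leRHS]ger0_norm; last first.
  by rewrite addr_ge0 // mulr_ge0 // sqr_ge0.
rewrite -[X in _ <= X + _]mul1r -mulrDl ler_wpM2r //.
rewrite -(real_normK (num_real x)); have := sqr_ge0 (`|x| - 1); nra.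
Qed.

Let natp_cvg0 : n%:R * p n%:R @[n --> \oo] --> (0 : R).
Proof.
apply: (@squeeze_cvgr _ _ _ _ (fun=> 0) (fun n => (c * normal_peak s) * n.+1%:R^-1 * 2)).
- exists 1%N => // n /= n0; have p0 : 0 <= p n%:R by exact: normal_pdf_ge0.
  rewrite mulr_ge0 //=.
  have n0' : 0 < n%:R :> R by rewrite ltr0n.
  have h := expRN_sqr_le n%:R c0.
  rewrite pE; rewrite -(ler_pM2l n0') mulrA -expr2 mulrCA.
  apply: (@le_trans _ _ (normal_peak s * c)).
    by rewrite ler_wpM2l // normal_peak_ge0.
  rewrite mulrC -[leLHS]mulr1.
  rewrite [leRHS](_ : _ = c * normal_peak s * (n%:R * 2 / n.+1%:R)); last first.
    by ring.
  rewrite ler_wpM2l ?mulr_ge0 ?normal_peak_ge0 ?(ltW c0) //.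
  rewrite ler_pdivlMr ?ltr0n // mul1r -natr1.
  have : 1 <= n%:R :> R by rewrite ler1n.
  lra.
- exact: cvg_cst.
- have : (c * normal_peak s) * n.+1%:R^-1 * 2 @[n --> \oo] --> c * normal_peak s * (0 : R) * 2.
    apply: cvgMl; apply: cvgMr; exact: cvg_harmonic.
  by rewrite mulr0 mul0r.
Qed.

Let integral_xp : (\int[mu]_x (x * p x)%:E = 0)%E.
Proof.
apply: (@integralT_derive_eq0 (fun x => - s ^+ 2 * p x)) => //.
- by move=> x; apply: cvgM => //; exact: cp.
- move=> x; have dp := derive_p x; apply: is_derive_eq; rewrite /GRing.scale /=.
  by field; rewrite gt_eqF.
- have pN (x : R) : p (- x) = p x by rewrite !pE sqrrN.
  by under eq_fun do rewrite pN subrr; exact: cvg_cst.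
Qed.

Let integral_xxp : (\int[mu]_x (x ^+ 2 * p x)%:E = (s ^+ 2)%:E)%E.
Proof.
have isp : mu.-integrable setT (EFin \o (fun x => s ^+ 2 * p x)).
  by have := integrableZl measurableT (s ^+ 2) ip_p; exact: eq_integrable.
(* Since p' = - (x / s^2) p, a primitive of (x^2 - s^2) p is - s^2 x p, which tends to 0 at infinity
   by [natp_cvg0]. *)
have : (\int[mu]_x (x ^+ 2 * p x - s ^+ 2 * p x)%:E = 0)%E.
  apply: (@integralT_derive_eq0 (fun x => - s ^+ 2 * (x * p x))) => //.
  - move=> x; apply: cvgB; apply: cvgM; try exact: cp; last exact: cvg_cst.
    exact: exprn_continuous.
  - move=> x; have dp := derive_p x; apply: is_derive_eq; rewrite /GRing.scale /=.
    by field; rewrite gt_eqF.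
  - by have := integrableB measurableT ixxp isp; exact: eq_integrable.
  - have pN (x : R) : p (- x) = p x by rewrite !pE sqrrN.
    have -> : (fun n => - s ^+ 2 * (n%:R * p n%:R) - - s ^+ 2 * (- n%:R * p (- n%:R))) =
              (fun n => (- s ^+ 2 *+ 2) * (n%:R * p n%:R)).
      by apply/funext => n; rewrite pN; ring.
    rewrite -[X in _ --> X](mulr0 (- s ^+ 2 *+ 2)).
    exact: cvgMr.
under eq_integral do rewrite EFinB.
rewrite (integralB_EFin measurableT ixxp isp).
under [X in (_ - X)%E]eq_integral do rewrite EFinM.
rewrite integralZl // integral_normal_pdf ?gt_eqF // mule1.
move=> /eqP; rewrite sube_eq ?add0e; [by move/eqP| |by []].
exact: (integrable_fin_num measurableT ixxp).
Qed.

Lemma normal_law_moments (d : measure_display) (T : measurableType d)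
  (P : probability T R) (X : T -> R) : measurable_fun setT X ->
  (forall C : set R, measurable C -> P (X @^-1` C) = normal_prob 0 s C) ->
  [/\ sqint P X, \int[P]_w X w = 0 & ip P X X = s ^+ 2].
Proof.
move=> mX XP.
have npE (f : R -> \bar R) : measurable_fun setT f -> (forall x, 0 <= f x)%E ->
    (\int[P]_w f (X w) = \int[mu]_x (f x * (p x)%:E))%E.
  move=> mf f0; apply: ge0_integral_law => //.
  by move=> x; exact: normal_pdf_ge0.
have msq : measurable_fun setT (fun x : R => (x ^+ 2)%:E).
  by apply/measurable_EFinP; exact: exprn_measurable.
have E2 : (\int[P]_w ((X w) ^+ 2)%:E = (s ^+ 2)%:E)%E.
  rewrite (npE (fun x => (x ^+ 2)%:E)) //; last by move=> x; rewrite lee_fin sqr_ge0.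
have sX : sqint P X by apply: sqint_ge0P => //; rewrite E2 ltry.
split => //; last by apply: EFin_inj; rewrite -integral_sqint.
rewrite /Rintegral -[RHS]/(fine 0%E); congr fine.
(* The transfer [npE] is for nonnegative functions only, so the mean is split into positive and
   negative parts. *)
pose fp (x : R) := (Num.max x 0)%:E; pose fn (x : R) := (Num.max (- x) 0)%:E.
have mfp : measurable_fun setT fp.
  by apply/measurable_EFinP; apply: measurable_maxr.
have mfn : measurable_fun setT fn.
  apply/measurable_EFinP; apply: measurable_maxr => //; exact: oppr_measurable.
rewrite integralE.
have -> : (\int[P]_x (fun x => (X x)%:E)^\+ x = \int[P]_x fp (X x))%E.
  by apply: eq_integral => x _; rewrite /fp funeposE EFin_max.
have -> : (\int[P]_x (fun x => (X x)%:E)^\- x = \int[P]_x fn (X x))%E.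
  by apply: eq_integral => x _; rewrite /fn funenegE EFin_max.
rewrite !npE //; try by move=> x; rewrite lee_fin le_max lexx orbT.
rewrite -integral_xp [in RHS]integralE; congr (_ - _)%E; apply: eq_integral => x _.
  rewrite /fp funeposE -EFinM maxr_pMl ?normal_pdf_ge0 // mul0r.
  by rewrite EFin_max.
rewrite /fn funenegE -EFinM maxr_pMl ?normal_pdf_ge0 // mul0r mulNr.
by rewrite EFin_max.
Qed.

End NormalMoments.

(** * Increments of Brownian motion and martingales *)

Section BorelMx.
Context {R : realType} {m n : nat}.

Lemma measurable_mx_entry (i : 'I_m) (j : 'I_n) :
  measurable_fun setT (fun A : borel_mx R m n => A i j).
Proof.
move=> _ C mC; rewrite setTI; apply: sub_sigma_algebra.
by exists i, j, C.
Qed.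

Lemma measurable_mxP (d : measure_display) (T : measurableType d) (D : set T)
    (f : T -> borel_mx R m n) : measurable D ->
  measurable_fun D f <-> forall i j, measurable_fun D (fun x => f x i j).
Proof.
move=> mD; split => [mf i j|mf].
  exact: (measurableT_comp (measurable_mx_entry i j)).
apply: (@measurability _ _ _ _ D f (@mx_cylinders R m n)) => //.
by move=> _ [_ [i [j [C [mC ->]]]] <-]; exact: mf.
Qed.

End BorelMx.

Section Brownian.
Context {R : realType} {dd : measure_display} {Omega : measurableType dd}.
Variables (P : probability Omega R) (d : nat) (B : R -> Omega -> 'cV[R]_d).
Hypothesis P_complete : measure_is_complete P.
Hypothesis BM : brownian_motion P B.

Definition Fmeas (s : R) (X : Omega -> R) :=
  measurable_fun setT (X : augmented_past P B s -> R).

Let mB t : 0 <= t -> measurable_fun setT (B t : Omega -> borel_mx R d 1).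
Proof. by case: BM => h _ _ _ _; exact: h. Qed.

(** Completeness enters here: the null sets added to the filtration are themselves events. *)
Lemma aug_measurable s (A : set Omega) :
  measurable (A : set (augmented_past P B s)) -> measurable A.
Proof.
apply: smallest_sub; first exact: sigma_algebra_measurable.
move=> X [[u [C [/andP[u0 _] mC ->]]]|]; last exact: P_complete.
by rewrite -[X in measurable X]setTI; exact: mB.
Qed.

Lemma aug_le s t (A : set Omega) : s <= t ->
  measurable (A : set (augmented_past P B s)) ->
  measurable (A : set (augmented_past P B t)).
Proof.
move=> st; apply: sub_sigma_algebra2 => X [[u [C [/andP[u0 us] mC ->]]]|nX].
  by left; exists u, C; rewrite u0 (le_trans us st).
by right.
Qed.

Lemma aug_negligible s (A : set Omega) : P.-negligible A ->
  measurable (A : set (augmented_past P B s)).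
Proof. by move=> nA; apply: sub_sigma_algebra; right. Qed.

Lemma Fmeas_measurable s X : Fmeas s X -> measurable_fun setT X.
Proof.
move=> mX _ C mC; rewrite setTI; apply: (@aug_measurable s).
by rewrite -[X in measurable X]setTI; exact: mX.
Qed.

Lemma Fmeas_le s t X : s <= t -> Fmeas s X -> Fmeas t X.
Proof.
move=> st mX _ C mC; rewrite setTI; apply: (aug_le st).
by rewrite -[X in measurable X]setTI; exact: mX.
Qed.

Let eqmod0 (A A' : set Omega) := P.-negligible ((A `\` A') `|` (A' `\` A)).

(** The sets that agree with a raw past event up to a null set form a sigma-algebra containing all
    raw past events and all null sets, hence all of F_s. *)
Lemma aug_past_event s (A : set Omega) : 0 <= s ->
  measurable (A : set (augmented_past P B s)) ->
  exists A', <<s past_events B s >> A' /\ eqmod0 A A'.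
Proof.
move=> s0; apply: (@smallest_sub _ _ _
  [set A | exists A', <<s past_events B s >> A' /\ eqmod0 A A']).
  split.
  - exists set0; split; first exact: sigma_algebra0.
    by rewrite /eqmod0 setD0 setU0; exact: negligible_set0.
  - move=> X [X' [sX' nX]]; exists (~` X'); split.
      by rewrite -setTD; exact: sigma_algebraCD.
    apply: negligibleS nX => w; rewrite setTD => -[[h1 h2]|[h1 h2]].
      by right; split => //; exact: contrapT.
    by left; split => //; exact: contrapT.
  - move=> F hF; have [F' hF'] := choice hF.
    exists (\bigcup_n F' n); split.
      by apply: sigma_algebra_bigcup => n; exact: (hF' n).1.
    have : P.-negligible (\bigcup_n ((F n `\` F' n) `|` (F' n `\` F n))).
      by apply: negligible_bigcup => n; exact: (hF' n).2.
    apply: negligibleS => w [[[k _ Fk] nF]|[[k _ Fk] nF]]; exists k => //.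
      by left; split => // ?; apply: nF; exists k.
    by right; split => // ?; apply: nF; exists k.
move=> X [pX|nX].
  exists X; split; first exact: sub_sigma_algebra.
  by rewrite /eqmod0 setDv setU0; exact: negligible_set0.
exists set0; split; first exact: sigma_algebra0.
by rewrite /eqmod0 setD0 set0D setU0.
Qed.

Let eqmod0_measure (A A' : set Omega) : measurable A -> measurable A' ->
  eqmod0 A A' -> P A = P A'.
Proof.
move=> mA mA' nA.
have h (X Y : set Omega) : measurable X -> measurable Y ->
    P.-negligible ((X `\` Y) `|` (Y `\` X)) -> (P X <= P Y)%E.
  move=> mX mY nXY.
  have XY : P.-negligible (X `\` Y) by apply: negligibleS nXY; left.
  have mXY : measurable (X `\` Y) by exact: measurableD.
  have XY0 : P (X `\` Y) = 0%E by exact/negligibleP.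
  rewrite (measureDI P mX mY) [X in (X + _ <= _)%E]XY0 add0e.
  by apply: le_measure; rewrite ?inE //; exact: measurableI.
apply/eqP; rewrite eq_le h //= h //.
by rewrite setUC.
Qed.

(** Replacing [A] by an equivalent raw past event changes neither side of the product formula. *)
Lemma BM_indep s t (A : set Omega) (C : set (borel_mx R d 1)) : 0 <= s < t ->
  measurable (A : set (augmented_past P B s)) -> measurable C ->
  P (A `&` [set w | C (B t w - B s w)]) =
  (P A * P [set w | C (B t w - B s w)%R])%E.
Proof.
move=> st mA mC; have /andP[s0 s_t] := st; have t0 := le_trans s0 (ltW s_t).
have [A' [sA' nA]] := aug_past_event s0 mA.
have mA' : measurable A'.
  move: sA'; apply: smallest_sub; first exact: sigma_algebra_measurable.
  move=> X [u [D [/andP[u0 _] mD ->]]].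
  by rewrite -[X in measurable X]setTI; exact: mB.
have mD : measurable [set w | C (B t w - B s w)].
  rewrite -[X in measurable X]setTI.
  have : measurable_fun setT ((fun w => B t w - B s w) : Omega -> borel_mx R d 1).
    apply/measurable_mxP => // i j; under eq_fun do rewrite !mxE.
    have ms := (measurable_mxP _ measurableT).1 (mB s0) i j.
    have mt := (measurable_mxP _ measurableT).1 (mB t0) i j.
    exact: measurable_funB.
  by apply.
case: BM => _ _ _ _ ind.
rewrite (eqmod0_measure (aug_measurable mA) mA' nA) -ind //.
apply: eqmod0_measure.
- by apply: measurableI => //; exact: (aug_measurable mA).
- exact: measurableI.
- by apply: negligibleS nA => w [[[h1 h2] h3]|[[h1 h2] h3]]; [left|right]; split => // ?; apply: h3.
Qed.

Definition incr (s t : R) (i : 'I_d) (w : Omega) : R := (B t w - B s w) i 0.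

Lemma incr_Fmeas s t u i : 0 <= s <= u -> 0 <= t <= u -> Fmeas u (incr s t i).
Proof.
have h v : 0 <= v <= u -> Fmeas u (fun w => B v w i 0).
  move=> vu _ C mC; rewrite setTI; apply: sub_sigma_algebra; left.
  exists v, ((fun A : borel_mx R d 1 => A i 0) @^-1` C); split => //.
  by rewrite -[X in measurable X]setTI; exact: measurable_mx_entry.
move=> su tu; rewrite /Fmeas /incr; under eq_fun do rewrite !mxE.
by apply: measurable_funB; exact: h.
Qed.

Lemma incr_measurable s t i : 0 <= s -> 0 <= t -> measurable_fun setT (incr s t i).
Proof.
move=> s0 t0; apply: (@Fmeas_measurable (Num.max s t)).
by apply: incr_Fmeas; rewrite ?s0 ?t0 /= le_max lexx ?orbT.
Qed.

Lemma indep_incr s t (Z : Omega -> R) (f : borel_mx R d 1 -> R) : 0 <= s < t ->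
  Fmeas s Z -> P.-integrable setT (EFin \o Z) -> measurable_fun setT f ->
  P.-integrable setT (EFin \o (fun w => f (B t w - B s w))) ->
  P.-integrable setT (EFin \o (fun w => Z w * f (B t w - B s w))) /\
  ip P Z (fun w => f (B t w - B s w)) =
  (\int[P]_w Z w) * (\int[P]_w f (B t w - B s w)).
Proof.
move=> st mZ iZ mf ifB; apply: indep_ip => //.
- exact: (Fmeas_measurable mZ).
- by have /integrableP[/measurable_EFinP] := ifB.
move=> A C mA mC; have := @BM_indep s t (Z @^-1` A) (f @^-1` C) st; apply.
  by rewrite -[X in measurable X]setTI; exact: mZ.
by rewrite -[X in measurable X]setTI; exact: mf.
Qed.

Lemma incr_law s t i (C : set R) : 0 <= s < t -> measurable C ->
  P (incr s t i @^-1` C) = normal_prob 0 (Num.sqrt (t - s)) C.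
Proof.
move=> st mC; case: BM => _ _ _ law _.
have := law s t st (fun k => if k == i then C else setT).
rewrite (bigD1 i) //= eqxx big1 ?mule1; last first.
  by move=> j /negbTE ->; exact: probability_setT.
move=> <-; last by move=> k; case: ifP.
congr (P _); apply/seteqP; split => w /=.
  by move=> h k; case: ifPn => // /eqP ->.
by move=> /(_ i); rewrite eqxx.
Qed.

Lemma incr_law2 s t i j (A C : set R) : 0 <= s < t -> i != j ->
  measurable A -> measurable C ->
  P (incr s t i @^-1` A `&` incr s t j @^-1` C) =
  (P (incr s t i @^-1` A) * P (incr s t j @^-1` C))%E.
Proof.
move=> st ij mA mC; rewrite !incr_law //; case: BM => _ _ _ law _.
have := law s t st (fun k => if k == i then A else if k == j then C else setT).
rewrite (bigD1 i) //= eqxx (bigD1 j) /=; last by rewrite eq_sym.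
rewrite eq_sym (negbTE ij) eqxx big1 ?mule1; last first.
  by move=> k /andP[/negbTE -> /negbTE ->]; exact: probability_setT.
move=> <-; last by move=> k; case: ifP => // _; case: ifP.
congr (P _); apply/seteqP; split => w /=.
  by move=> [h1 h2] k; case: ifPn => [/eqP -> //|_]; case: ifPn => // /eqP ->.
by move=> h; split; [have := h i|have := h j]; rewrite eqxx // eq_sym (negbTE ij).
Qed.

Lemma incr_moments s t i : 0 <= s <= t ->
  [/\ sqint P (incr s t i), \int[P]_w incr s t i w = 0 &
      ip P (incr s t i) (incr s t i) = t - s].
Proof.
move=> /andP[s0]; rewrite le_eqVlt => /predU1P[<-|st].
  have -> : incr s s i = fun=> 0.
    by apply/funext => w; rewrite /incr subrr mxE.
  split; first exact: sqint_cst.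
    by rewrite Rintegral_cst // mul0r.
  by rewrite /ip Rintegral_cst // subrr !mul0r.
have ts : 0 < t - s by rewrite subr_gt0.
have [] := @normal_law_moments R (Num.sqrt (t - s)) _ _ _ P (incr s t i).
- by rewrite sqrtr_gt0.
- by apply: incr_measurable => //; exact: le_trans (ltW st).
- by move=> C mC; apply: incr_law => //; rewrite s0.
by move=> h1 h2 h3; split => //; rewrite h3 sqr_sqrtr // ltW.
Qed.

Lemma sqint_incr s t i : 0 <= s <= t -> sqint P (incr s t i).
Proof. by move=> /(incr_moments i)[]. Qed.

Lemma ip_incr_neq s t i j : 0 <= s <= t -> i != j ->
  ip P (incr s t i) (incr s t j) = 0.
Proof.
move=> st ij; have /andP[s0] := st; rewrite le_eqVlt => /predU1P[<-|s_t].
  rewrite /ip; under eq_Rintegral do rewrite {1}/incr subrr mxE mul0r.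
  by rewrite Rintegral_cst // mul0r.
have [si Ei _] := incr_moments i st; have [sj Ej _] := incr_moments j st.
have [||A C mA mC|||_ ->] := @indep_ip _ _ _ P (incr s t i) (incr s t j).
- by case: si.
- by case: sj.
- by apply: incr_law2 => //; rewrite s0.
- exact: sqint_integrable.
- exact: sqint_integrable.
- by rewrite Ei mul0r.
Qed.

Lemma ip_incr s t i j : 0 <= s <= t ->
  ip P (incr s t i) (incr s t j) = (i == j)%:R * (t - s).
Proof.
move=> st; case: eqVneq => [->|ij]; last by rewrite ip_incr_neq // mul0r.
by have [_ _ ->] := incr_moments j st; rewrite mul1r.
Qed.

Lemma ip_past_incr s t i Z : 0 <= s <= t -> Fmeas s Z -> sqint P Z ->
  ip P Z (incr s t i) = 0.
Proof.
move=> st mZ sZ; have [si Ei _] := incr_moments i st.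
have /andP[s0] := st; rewrite le_eqVlt => /predU1P[e|s_t].
  have -> : incr s t i = fun=> 0.
    by apply/funext => w; rewrite /incr e subrr mxE.
  by rewrite ipC /ip; under eq_Rintegral do rewrite mul0r; rewrite Rintegral_cst // mul0r.
have [|||||_ ->] := @indep_incr s t Z (fun A => A i 0); rewrite ?s0 //.
- exact: sqint_integrable.
- exact: measurable_mx_entry.
- exact: sqint_integrable.
- by rewrite [X in _ * X]Ei mulr0.
Qed.

(** Square-integrable martingales, with E[X_t - X_s | F_s] = 0 stated as orthogonality of the
    increment to every square-integrable variable of the past; no conditional expectation is
    needed. *)
Definition mart (X : R -> Omega -> R) :=
  (forall s, 0 <= s -> Fmeas s (X s) /\ sqint P (X s)) /\
  (forall s t Z, 0 <= s <= t -> Fmeas s Z -> sqint P Z ->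
     ip P Z (fun w => X t w - X s w) = 0).

(** Brownian motion stopped at the fixed time [a]. The integral of a deterministic step function is
    a linear combination of such processes. *)
Lemma mart_incr a i : 0 <= a -> mart (fun s => incr 0 (Num.min a s) i).
Proof.
move=> a0; split=> [s s0|s t Z /andP[s0 st] mZ sZ].
  have h : 0 <= Num.min a s <= s by rewrite le_min a0 s0 ge_min lexx orbT.
  split; first by apply: incr_Fmeas => //; rewrite lexx s0.
  by apply: sqint_incr; rewrite lexx /=; case/andP: h.
have [sa|sa] := leP a s.
  have -> : (fun w => incr 0 (Num.min a t) i w - incr 0 a i w) = fun=> 0.
    apply/funext => w; rewrite (min_idPl (le_trans sa st)) ?subrr //.
  by rewrite ipC /ip; under eq_Rintegral do rewrite mul0r; rewrite Rintegral_cst // mul0r.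
rewrite -(ip_past_incr i _ mZ sZ (t := Num.min a t)); last first.
  by rewrite s0 le_min (ltW sa) st.
by congr ip; apply/funext => w; rewrite /incr !mxE; ring.
Qed.

Lemma mart0 : mart (fun _ _ => 0).
Proof.
split=> [s s0|s t Z st mZ sZ]; first by split; [exact: measurable_cst|exact: sqint_cst].
rewrite subrr ipC /ip; under eq_Rintegral do rewrite mul0r.
by rewrite Rintegral_cst // mul0r.
Qed.

Lemma martD X Y : mart X -> mart Y -> mart (fun s w => X s w + Y s w).
Proof.
move=> [X1 X2] [Y1 Y2]; split=> [s s0|s t Z st mZ sZ].
  have [a b] := X1 s s0; have [a' b'] := Y1 s s0.
  by split; [exact: measurable_funD|exact: sqintD].
have /andP[s0 s_t] := st; have t0 := le_trans s0 s_t.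
have [_ b1] := X1 s s0; have [_ b2] := X1 t t0.
have [_ b3] := Y1 s s0; have [_ b4] := Y1 t t0.
have -> : (fun w => X t w + Y t w - (X s w + Y s w)) =
   (fun w => (X t w - X s w) + (Y t w - Y s w)) by apply/funext => w; ring.
rewrite ipDr ?X2 ?Y2 ?addr0 //; exact: sqintB.
Qed.

Lemma martZ c X : mart X -> mart (fun s w => c * X s w).
Proof.
move=> [X1 X2]; split=> [s s0|s t Z st mZ sZ].
  have [a b] := X1 s s0.
  by split; [exact: measurable_funM|exact: sqintZ].
have /andP[s0 s_t] := st; have t0 := le_trans s0 s_t.
have [_ b1] := X1 s s0; have [_ b2] := X1 t t0.
under [X in ip _ _ X]eq_fun do rewrite -mulrBr.
rewrite ipZr ?X2 ?mulr0 //; exact: sqintB.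
Qed.

Lemma mart_sum (I : Type) (r : seq I) (X : I -> R -> Omega -> R) :
  (forall i, mart (X i)) -> mart (fun s w => \sum_(i <- r) X i s w).
Proof.
move=> mX; elim: r => [|i r IH].
  by under eq_fun do under eq_fun do rewrite big_nil; exact: mart0.
by under eq_fun do under eq_fun do rewrite big_cons; exact: martD.
Qed.

(** Write X_t = X_s + D. The variable 1_A X_s belongs to the past, so the cross terms vanish, and
    1_A D^2 is nonnegative. *)
Lemma mart_sq_le X s t (A : set Omega) : mart X -> 0 <= s <= t ->
  measurable (A : set (augmented_past P B s)) ->
  ip P (fun w => \1_A w * X s w) (X s) <= ip P (fun w => \1_A w * X t w) (X t).
Proof.
move=> [X1 X2] st mA; have /andP[s0 s_t] := st; have t0 := le_trans s0 s_t.
have [as_ bs] := X1 s s0; have [_ bt] := X1 t t0.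
have mI : Fmeas s (\1_A : _ -> R) by exact: measurable_indic.
have mI' : measurable_fun setT (\1_A : Omega -> R) by exact: (Fmeas_measurable mI).
have I1 w : `|\1_A w : R| <= 1 by rewrite indicE; case: (_ \in _); rewrite ?normr1 ?normr0.
have sM Y : sqint P Y -> sqint P (fun w => \1_A w * Y w) by exact: sqint_bM.
pose D w := X t w - X s w; have sD : sqint P D by exact: sqintB.
have e : X t = (fun w => X s w + D w) by apply/funext => w; rewrite /D; ring.
have eI : (fun w => \1_A w * X t w) = (fun w => \1_A w * X s w + \1_A w * D w).
  by apply/funext => w; rewrite /D; ring.
rewrite eI [X in _ <= ip P _ X]e (ipDl (sM _ bs) (sM _ sD) (sqintD bs sD)).
rewrite (ipDr bs sD (sM _ bs)) (ipDr bs sD (sM _ sD)).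
have -> : ip P (fun w => \1_A w * X s w) D = 0.
  apply: X2 => //; last exact: sM.
  by apply: measurable_funM => //.
have -> : ip P (fun w => \1_A w * D w) (X s) = 0.
  transitivity (ip P (fun w => \1_A w * X s w) D).
    by apply: eq_Rintegral => w _; ring.
  apply: X2 => //; last exact: sM.
  by apply: measurable_funM => //.
rewrite addr0 add0r lerDl; apply: Rintegral_ge0 => w _.
by rewrite -mulrA -expr2 mulr_ge0 ?sqr_ge0 // indicE.
Qed.

(** Induction on the number of times, with a stronger invariant [key]: only the part of the mean
    square that lives on [A k], the event that level [l] has been reached, is used. Passing to the
    next time increases the mean square on [A k] by [mart_sq_le], and the first passages [E] at the
    new time contribute at least l^2 P(E). *)
Lemma maximal_ineq X (s : nat -> R) (l : R) N : mart X -> 0 < l ->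
  0 <= s 0%N -> (forall k, s k <= s k.+1) ->
  l ^+ 2 * fine (P (\bigcup_(k in [set k | (k <= N)%N]) [set w | l <= `|X (s k) w|]))
  <= ip P (X (s N)) (X (s N)).
Proof.
move=> mX l0 s0 ms.
have sN k : 0 <= s k by elim: k => // k /le_trans; apply.
have [X1 _] := mX.
have mE k : measurable ([set w | l <= `|X (s k) w|] : set (augmented_past P B (s k))).
  have [m _] := X1 _ (sN k).
  have : measurable_fun setT ((fun w => `|X (s k) w|) : augmented_past P B (s k) -> R).
    exact: measurableT_comp.
  move=> /(_ measurableT `[l, +oo[%classic).
  rewrite setTI; have -> : (fun w : augmented_past P B (s k) => `|X (s k) w|) @^-1` `[l, +oo[%classic =
    [set w | l <= `|X (s k) w|].
    by apply/seteqP; split => w /=; rewrite in_itv /= andbT.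
  by apply; exact: measurable_itv.
pose A N := \bigcup_(k in [set k | (k <= N)%N]) [set w | l <= `|X (s k) w|].
have smono j k : (j <= k)%N -> s j <= s k.
  by move: j k; apply/nondecreasing_seqP.
have mA k : measurable (A k : set (augmented_past P B (s k))).
  apply: bigcup_measurable => j /= jk; apply: (@aug_le (s j)); first exact: smono.
  exact: mE.
have ind1 (C : set Omega) w : `|\1_C w : R| <= 1.
  by rewrite indicE; case: (_ \in _); rewrite ?normr1 ?normr0.
have mi k (C : set Omega) : measurable (C : set (augmented_past P B (s k))) ->
    measurable_fun setT (\1_C : Omega -> R).
  by move=> mC; apply: measurable_indic; exact: (aug_measurable mC).
have sX k : sqint P (X (s k)) by have [] := X1 _ (sN k).
have key k : l ^+ 2 * fine (P (A k)) <= ip P (fun w => \1_(A k) w * X (s k) w) (X (s k)).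
  have low j (C : set Omega) : measurable (C : set (augmented_past P B (s j))) ->
      (forall w, C w -> l <= `|X (s j) w|) ->
      l ^+ 2 * fine (P C) <= ip P (fun w => \1_C w * X (s j) w) (X (s j)).
    move=> mC hC; have mC' := aug_measurable mC.
    have -> : fine (P C) = ip P (\1_C) (fun=> 1).
      rewrite /ip; under eq_Rintegral do rewrite mulr1.
      by rewrite /Rintegral integral_indic // setIT.
    have s1 : sqint P (\1_C : Omega -> R).
      have := sqint_bM (mi _ _ mC) (ind1 C) (sqint_cst P 1).
      by under eq_fun do rewrite mulr1.
    rewrite -ipZl //; last exact: sqint_cst.
    apply: le_Rintegral => //.
    - by apply: sqint_mul; [exact: sqintZ|exact: sqint_cst].
    - by apply: sqint_mul => //; apply: sqint_bM (ind1 C) _ => //; exact: (mi _ _ mC).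
    - move=> w _; rewrite mulr1 indicE.
      case: (boolP (w \in C)) => [/set_mem Cw|_]; last by rewrite mulr0 !mul0r.
      rewrite mulr1 mul1r -expr2 -(real_normK (num_real (X _ _))).
      by rewrite lerXn2r ?nnegrE ?(ltW l0) // hC.
  elim: k => [|k IH].
    by apply: low => // w [k /=]; rewrite leqn0 => /eqP ->.
  pose E := [set w | l <= `|X (s k.+1) w|] `\` A k.
  have mAk : measurable (A k : set (augmented_past P B (s k.+1))).
    exact: (aug_le (ms k)).
  have mE' : measurable (E : set (augmented_past P B (s k.+1))).
    by apply: measurableD => //; exact: mE.
  have AE : A k.+1 = A k `|` E.
    apply/seteqP; split => w.
      move=> [j /= jk h]; case: (pselect (A k w)) => hA; [by left|right; split => //].
      have [jk'|] := leqP j k; first by exfalso; apply: hA; exists j.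
      by move=> kj; have <- : j = k.+1 by apply/eqP; rewrite eqn_leq jk.
    move=> [[j /= jk h]|[h _]]; last by exists k.+1 => /=.
    by exists j => //=; exact: leq_trans jk _.
  have dAE : A k `&` E = set0 by apply/seteqP; split => // w [h1 [_]].
  have -> : P (A k.+1) = (P (A k) + P E)%E.
    rewrite AE measureU //; [exact: (aug_measurable mAk)|exact: (aug_measurable mE')].
  rewrite fineD ?fin_num_measure //; try exact: (aug_measurable mAk); try exact: (aug_measurable mE').
  have -> : (fun w => \1_(A k.+1) w * X (s k.+1) w) =
            (fun w => \1_(A k) w * X (s k.+1) w + \1_E w * X (s k.+1) w).
    apply/funext => w; rewrite -mulrDl; congr (_ * _); rewrite AE !indicE in_setU.
    case: (boolP (w \in A k)) => [/set_mem h|_]; last by rewrite add0r.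
    case: (boolP (w \in E)) => [/set_mem h'|_]; last by rewrite addr0.
    by have : set0 w by rewrite -dAE.
  have sA := sqint_bM (mi _ _ mAk) (ind1 _) (sX k.+1).
  have sE := sqint_bM (mi _ _ mE') (ind1 _) (sX k.+1).
  rewrite (ipDl sA sE (sX k.+1)).
  rewrite mulrDr lerD //; last by apply: low => // w [].
  by apply: le_trans IH _; apply: mart_sq_le; rewrite ?sN ?ms.
apply: le_trans (key N) _; apply: le_Rintegral => //; try exact: sqint_mul.
  by apply: sqint_mul => //; apply: sqint_bM (ind1 _) _ => //; exact: mi.
move=> w _; rewrite -mulrA ler_piMl -?expr2 ?sqr_ge0 // indicE.
Qed.

End Brownian.

(** * Integral comparison without measurability, and the Euclidean norm *)

Section MonotoneIntegral.
Context {d : measure_display} {T : measurableType d} {R : realType}.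
Variable mu : {measure set T -> \bar R}.

(** The integral of a nonnegative function is a supremum over the simple functions below it, so
    monotonicity requires no measurability. Iterated integrals such as the one in [ito_integral] can
    thus be compared without examining the measurability of the inner integral in w. *)
Lemma ge0_le_integral_sup (D : set T) (f1 f2 : T -> \bar R) :
  (forall x, D x -> 0 <= f1 x)%E -> (forall x, D x -> f1 x <= f2 x)%E ->
  (\int[mu]_(x in D) f1 x <= \int[mu]_(x in D) f2 x)%E.
Proof.
move=> f10 f12; rewrite [leLHS]integral_mkcond [leRHS]integral_mkcond.
have h1 x : (0 <= (f1 \_ D) x)%E.
  by rewrite /patch; case: ifPn => // /set_mem; exact: f10.
have h12 x : ((f1 \_ D) x <= (f2 \_ D) x)%E.
  by rewrite /patch; case: ifPn => // /set_mem; exact: f12.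
rewrite !ge0_integralTE //; last by move=> x; exact: le_trans (h12 x).
apply: le_ereal_sup => _ [h hf1 <-]; exists h => // x.
exact: le_trans (h12 x).
Qed.

End MonotoneIntegral.

Lemma within_continuous_seq {R : realType} (A : set R) (U : topologicalType)
  (f : R -> U) (x : R) (u : nat -> R) : {within A, continuous f} -> A x ->
  (forall n, A (u n)) -> u n @[n --> \oo] --> x -> f (u n) @[n --> \oo] --> f x.
Proof.
move=> /subspace_continuousP cf Ax Au ux W /(cf x Ax) h.
have h2 : nbhs x [set y | A y -> W (f y)] by exact: h.
have h3 : \forall n \near \oo, A (u n) -> W (f (u n)) := ux _ h2.
by apply: (filterS _ h3) => n; apply; exact: Au.
Qed.

Section EuclideanNorm.
Context {R : realType} {m n : nat}.
Implicit Types A C : 'M[R]_(m, n).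

Lemma enorm_ge0 A : 0 <= enorm A.
Proof. exact: sqrtr_ge0. Qed.

Lemma enorm_sqr A : enorm A ^+ 2 = \sum_i \sum_j A i j ^+ 2.
Proof.
by rewrite sqr_sqrtr //; apply: sumr_ge0 => i _; apply: sumr_ge0 => j _; exact: sqr_ge0.
Qed.

Lemma enorm0 : enorm (0 : 'M[R]_(m, n)) = 0.
Proof.
rewrite /enorm big1 ?sqrtr0 // => i _; rewrite big1 // => j _.
by rewrite mxE expr0n.
Qed.

Lemma le_entry_enorm A i j : `|A i j| <= enorm A.
Proof.
rewrite -(@ler_pXn2r _ 2) ?nnegrE ?enorm_ge0 // enorm_sqr real_normK ?num_real //.
rewrite (bigD1 i) //= (bigD1 j) //= -addrA lerDl.
apply: addr_ge0; first by apply: sumr_ge0 => k _; exact: sqr_ge0.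
by apply: sumr_ge0 => k _; apply: sumr_ge0 => l _; exact: sqr_ge0.
Qed.

Lemma enorm_le_sum A : enorm A <= \sum_i \sum_j `|A i j|.
Proof.
have h0 : 0 <= \sum_i \sum_j `|A i j|.
  by apply: sumr_ge0 => i _; exact: sumr_ge0.
have sq (I : finType) (F : I -> R) : (forall i, 0 <= F i) ->
    \sum_i F i ^+ 2 <= (\sum_i F i) ^+ 2.
  move=> F0; elim: (index_enum I) => [|i r IH]; first by rewrite !big_nil expr0n.
  rewrite !big_cons; have S0 : 0 <= \sum_(i <- r) F i by exact: sumr_ge0.
  by have := mulr_ge0 (F0 i) S0; nra.
rewrite -(@ler_pXn2r _ 2) ?nnegrE ?enorm_ge0 // enorm_sqr.
apply: le_trans (sq _ _ _); last by move=> i; exact: sumr_ge0.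
apply: ler_sum => i _; apply: le_trans (sq _ _ _) => //.
by apply: ler_sum => j _; rewrite real_normK ?num_real.
Qed.

Lemma enormN A : enorm (- A) = enorm A.
Proof.
by congr Num.sqrt; apply: eq_bigr => i _; apply: eq_bigr => j _; rewrite mxE sqrrN.
Qed.

Lemma enormD_sqr A C : enorm (A + C) ^+ 2 <= 2 * enorm A ^+ 2 + 2 * enorm C ^+ 2.
Proof.
rewrite !enorm_sqr !mulr_sumr -big_split /=; apply: ler_sum => i _.
rewrite !mulr_sumr -big_split /=; apply: ler_sum => j _; rewrite mxE.
have := sqr_ge0 (A i j - C i j); nra.
Qed.

Lemma measurable_enorm (d : measure_display) (T : measurableType d) (D : set T)
    (f : T -> borel_mx R m n) : measurable D -> measurable_fun D f ->
  measurable_fun D (fun x => enorm (f x)).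
Proof.
move=> mD /(measurable_mxP _ mD) mf; rewrite /enorm.
have ms : measurable_fun setT (@Num.sqrt R).
  by apply: continuous_measurable_fun; exact: sqrt_continuous.
apply: (measurableT_comp ms).
by do 2 apply: measurable_sum => ?; exact: measurable_funX.
Qed.

End EuclideanNorm.

(** * The maximal inequality for continuous paths *)

Section SupIneq.
Context {R : realType} {dd : measure_display} {Omega : measurableType dd}.
Variables (P : probability Omega R) (d : nat) (B : R -> Omega -> 'cV[R]_d).
Hypothesis P_complete : measure_is_complete P.
Hypothesis BM : brownian_motion P B.

(** The events [A m] of reaching [l] on the dyadic grid of mesh r / 2^m increase with m, since point
    k of one grid is point 2k of the next; the uniform bound therefore passes to their union. Off
    the union, path continuity extends the bound from dyadic times to all times. *)
Lemma sup_ineq X (r l : R) : mart P B X -> 0 < l -> 0 <= r ->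
  {ae P, forall w, {within `[0, r], continuous (fun s => X s w)}} ->
  exists N : set Omega, [/\ measurable N,
    (P N <= (ip P (X r) (X r) / l ^+ 2)%:E)%E &
    {ae P, forall w, ~ N w -> forall s, 0 <= s <= r -> `|X s w| <= l}].
Proof.
move=> mX l0 r0 cX.
(* Capping the index keeps every time in [0, r], so [g m] is monotone on all of nat, as
   [maximal_ineq] demands. *)
pose g m k : R := r * ((minn k (2 ^ m))%:R / 2 ^+ m).
have p2 m : 0 < 2 ^+ m :> R by rewrite exprn_gt0.
have g01 m k : 0 <= g m k <= r.
  apply/andP; split; first by rewrite /g mulr_ge0 // divr_ge0 // ltW.
  by rewrite ler_piMr // ler_pdivrMr // mul1r -natrX ler_nat geq_minr.
have gm m k : g m k <= g m k.+1.
  by rewrite ler_wpM2l // ler_wpM2r ?invr_ge0 ?(ltW (p2 m)) // ler_nat; lia.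
have gN m : g m (2 ^ m)%N = r.
  by rewrite /g minnn natrX divff ?mulr1 // gt_eqF.
pose A m := \bigcup_(k in [set k | (k <= 2 ^ m)%N]) [set w | l <= `|X (g m k) w|].
have mA m : measurable (A m).
  apply: bigcup_measurable => k _.
  have g0 : 0 <= g m k by have /andP[] := g01 m k.
  have [mXg _] := mX.1 _ g0.
  have : measurable_fun setT (fun w => `|X (g m k) w|).
    by apply: measurableT_comp => //; exact: (Fmeas_measurable P_complete BM mXg).
  move=> /(_ measurableT `[l, +oo[%classic (measurable_itv _)).
  rewrite setTI; congr (measurable _).
  by apply/seteqP; split => w /=; rewrite in_itv /= andbT.
have bA m : (P (A m) <= (ip P (X r) (X r) / l ^+ 2)%:E)%E.
  have := @maximal_ineq _ _ _ P _ B P_complete BM X (g m) l (2 ^ m)%N mX l0.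
  rewrite gN => /(_ _ (gm m)); rewrite -/(A m) => h.
  rewrite -[leLHS]fineK ?fin_num_measure // lee_fin ler_pdivlMr ?exprn_gt0 //.
  by rewrite mulrC h //; have /andP[] := g01 m 0%N.
exists (\bigcup_m A m); split.
- exact: bigcup_measurable.
- have ndA : nondecreasing_seq A.
    apply/nondecreasing_seqP => m; apply/subsetPset => w [k /= km h].
    exists (2 * k)%N; first by rewrite /= expnS leq_mul2l.
    suff -> : g m.+1 (2 * k)%N = g m k by [].
    rewrite /g !(minn_idPl _) //; last by rewrite expnS leq_mul2l.
    by rewrite exprS natrM; field; rewrite gt_eqF.
  have h := @nondecreasing_cvg_mu _ _ _ P A mA (bigcup_measurable (fun k _ => mA k)) ndA.
  rewrite -(cvg_lim _ h) //; apply: lime_le; first by apply/cvg_ex; eexists; exact: h.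
  by apply: nearW => m; exact: bA.
- apply: filterS cX => w cw nN s /andP[s0 sr].
  (* The grid point just below [s]. For r = 0 the quotient has the default value 0, which is
     harmless because then s = 0. *)
  pose u m := g m (Num.truncn (s / r * 2 ^+ m)).
  have us m : `|s - u m| <= r / 2 ^+ m.
    have [r0'|rn0] := eqVneq r 0.
      have s0' : s = 0 by apply/eqP; rewrite eq_le s0 -{1}r0' sr.
      by rewrite /u /g s0' r0' !mul0r subrr normr0.
    have rp : 0 < r by rewrite lt_neqAle eq_sym rn0.
    have sr0 : 0 <= s / r by rewrite divr_ge0.
    have h0 : 0 <= s / r * 2 ^+ m by rewrite mulr_ge0 // ltW.
    have /andP[t1 t2] := truncn_itv h0; set t := Num.truncn _ in t1 t2 *.
    have tm : (t <= 2 ^ m)%N.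
      rewrite -(ler_nat R) natrX (le_trans t1) // ler_piMl ?(ltW (p2 m)) //.
      by rewrite ler_pdivrMr // mul1r.
    have es : s = r * (s / r * 2 ^+ m / 2 ^+ m) by field; rewrite rn0 gt_eqF.
    rewrite /u /g -/t (minn_idPl tm) {1}es -mulrBr -mulrBl normrM (ger0_norm r0).
    rewrite ler_wpM2l // normrM [X in _ * X]ger0_norm ?invr_ge0 ?(ltW (p2 m)) //.
    rewrite ler_piMl ?invr_ge0 ?(ltW (p2 m)) // ger0_norm ?subr_ge0 //.
    by rewrite lerBlDl natr1 ltW.
  have cu : u m @[m --> \oo] --> s.
    apply/cvgrPdist_le => e e0.
    have : r / 2 ^+ m @[m --> \oo] --> (0 : R).
      rewrite -[X in _ --> X](mulr0 r); apply: cvgMr.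
      under eq_fun do rewrite -exprVn.
      by apply: cvg_expr; rewrite ger0_norm ?invr_ge0 // invf_lt1 // ltr1n.
    move=> /cvgrPdist_le /(_ e e0); apply: filterS => m; rewrite sub0r normrN.
    by move=> h; apply: le_trans (us m) _; apply: le_trans (ler_norm _) h.
  have cXu : `|X (u m) w| @[m --> \oo] --> `|X s w|.
    have sA : `[0, r]%classic s by rewrite /= in_itv /= s0.
    have uA m : `[0, r]%classic (u m) by rewrite /= in_itv /= g01.
    exact: cvg_norm (within_continuous_seq cw sA uA cu).
  rewrite -(cvg_lim _ cXu) //; apply: limr_le; first by apply/cvg_ex; eexists; exact: cXu.
  apply: nearW => m; rewrite leNgt; apply/negP => hl; apply: nN; exists m => //.
  rewrite /u in hl; set t := Num.truncn _ in hl.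
  exists (minn t (2 ^ m)); first by rewrite /= geq_minr.
  have -> : g m (minn t (2 ^ m)) = g m t by rewrite /g -minnA minnn.
  exact: ltW.
Qed.

End SupIneq.

(** * Stochastic integrals of simple processes *)

Section Cauchy.
Context {d : measure_display} {T : measurableType d} {R : realType}.
Variable P : probability T R.

Lemma integral_enorm_sqr (m n : nat) (X : T -> 'M[R]_(m, n)) :
  (forall i j, sqint P (fun w => X w i j)) ->
  (\int[P]_w (enorm (X w) ^+ 2)%:E =
   (\sum_i \sum_j ip P (fun w => X w i j) (fun w => X w i j))%:E)%E.
Proof.
move=> sX; under eq_integral do rewrite enorm_sqr -sumEFin.
rewrite ge0_integral_sum //; last 2 first.
- move=> i; apply/measurable_EFinP; apply: measurable_sum => j.
  by apply: measurable_funX; have [] := sX i j.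
- by move=> i w _; rewrite lee_fin; apply: sumr_ge0 => j _; exact: sqr_ge0.
rewrite -sumEFin; apply: eq_bigr => i _.
under eq_integral do rewrite -sumEFin.
rewrite ge0_integral_sum //; last 2 first.
- by move=> j; apply/measurable_EFinP; apply: measurable_funX; have [] := sX i j.
- by move=> j w _; rewrite lee_fin sqr_ge0.
by rewrite -sumEFin; apply: eq_bigr => j _; rewrite integral_sqint.
Qed.

End Cauchy.

Section SimpleProcess.
Context {R : realType} {dd : measure_display} {Omega : measurableType dd}.
Variables (P : probability Omega R) (d n : nat) (B : R -> Omega -> 'cV[R]_d).
Hypothesis P_complete : measure_is_complete P.
Hypothesis BM : brownian_motion P B.
Variable S : simple_process P B n.
Variable s : R.
Hypothesis s0 : 0 <= s.

Let t := sp_time S.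
Let a k := Num.min (t k) s.
Let N := sp_size S.

Let t0 k : 0 <= t k. Proof. by have /andP[] := sp_time_mono S k. Qed.
Let tS k : t k <= t k.+1. Proof. by have /andP[] := sp_time_mono S k. Qed.
Let tmono j k : (j <= k)%N -> t j <= t k.
Proof. by move: j k; apply/nondecreasing_seqP. Qed.
Let a0 k : 0 <= a k. Proof. by rewrite le_min t0 s0. Qed.
Let amono j k : (j <= k)%N -> a j <= a k.
Proof. by move=> jk; rewrite le_min !ge_min lexx orbT (tmono jk). Qed.
Let aS k : 0 <= a k <= a k.+1. Proof. by rewrite a0 amono. Qed.

(* The coefficient of the k-th step, switched off when that step starts after
   time [s]; it is thus measurable at time [min (t k) s]. *)
Let eta k (i : 'I_n) (j : 'I_d) w : R :=
  if t k <= s then sp_coef S k w i j else 0.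

Let eta_Fmeas k i j : Fmeas P B (a k) (eta k i j).
Proof.
rewrite /eta /a; case: (leP (t k) s) => ts; last exact: measurable_cst.
have := @sp_coef_adapted _ _ _ _ _ _ _ S k => /(measurable_mxP _ measurableT) /(_ i j).
by [].
Qed.

Let eta_bound : exists K, forall k i j w, `|eta k i j w| <= K.
Proof.
have [K hK] := sp_coef_bounded S; exists K => k i j w; rewrite /eta.
case: ifP => _; first exact: le_trans (le_entry_enorm _ _ _) (hK k w).
by rewrite normr0; exact: le_trans (enorm_ge0 _) (hK k w).
Qed.

Let eta_measurable k i j : measurable_fun setT (eta k i j).
Proof. exact: (Fmeas_measurable P_complete BM (@eta_Fmeas k i j)). Qed.

Let sqint_etaM k i j X : sqint P X -> sqint P (fun w => eta k i j w * X w).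
Proof.
have [K hK] := eta_bound => sX; apply: sqint_bM sX; first exact: eta_measurable.
by move=> w; exact: hK. Qed.

Let sqint_eta k i j : sqint P (eta k i j).
Proof.
by have := sqint_etaM k i j (sqint_cst P 1); under eq_fun do rewrite mulr1.
Qed.

Let step k (i : 'I_n) (j : 'I_d) w : R := eta k i j w * incr B (a k) (a k.+1) j w.

Let sqint_step k i j : sqint P (step k i j).
Proof. by apply: sqint_etaM; apply: sqint_incr. Qed.

Let sp_integralE i w :
  sp_integral S s w i 0 = \sum_(k < N) \sum_j step k i j w.
Proof.
rewrite /sp_integral summxE; apply: eq_bigr => k _; rewrite mxE.
apply: eq_bigr => j _; rewrite /step /eta /incr -/t -/(a k) -/(a k.+1).
case: (leP (t k) s) => // ts; rewrite mul0r.
have -> : a k.+1 = a k.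
  by rewrite /a (min_idPr (ltW ts)) (min_idPr _) // (le_trans (ltW ts)).
by rewrite subrr mxE mulr0.
Qed.

Lemma sqint_sp_integral i : sqint P (fun w => sp_integral S s w i 0).
Proof.
under eq_fun do rewrite sp_integralE.
by do 2 apply: sqint_sum => ? _; exact: sqint_step.
Qed.

Lemma mean_sp_integral i : ip P (fun w => sp_integral S s w i 0) (fun=> 1) = 0.
Proof.
under [X in ip _ X _]eq_fun do rewrite sp_integralE.
have s1 := sqint_cst P (1:R).
rewrite ip_suml //; last by move=> k _; apply: sqint_sum => j _; exact: sqint_step.
rewrite big1 // => k _; rewrite ip_suml // big1 // => j _.
have := ip_past_incr P_complete BM j (aS k) (@eta_Fmeas k i j) (sqint_eta k i j).
by move=> <-; apply: eq_Rintegral => w _; rewrite mulr1.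
Qed.

(** Everything except the increment of the later step is known when that step starts, and stays
    square integrable because the coefficients are bounded. *)
Let step_orth k l i j j' : (k < l)%N -> ip P (step k i j) (step l i j') = 0.
Proof.
move=> kl; have kl' : a k.+1 <= a l by exact: amono.
have FX : Fmeas P B (a l) (fun w => eta l i j' w * step k i j w).
  apply: measurable_funM; first exact: eta_Fmeas.
  apply: (Fmeas_le kl'); apply: measurable_funM.
    exact: (Fmeas_le (amono (leqnSn k)) (@eta_Fmeas k i j)).
  by apply: incr_Fmeas; rewrite ?a0 ?lexx ?amono.
have := ip_past_incr P_complete BM j' (aS l) FX (sqint_etaM _ _ _ (sqint_step _ _ _)).
by move=> <-; apply: eq_Rintegral => w _; rewrite /step; ring.
Qed.

(** The product of the two coefficients is known at time [a k], hence independent of the product of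
    the two coordinate increments. *)
Let step_same k i j j' : ip P (step k i j) (step k i j') =
  (j == j')%:R * ((a k.+1 - a k) * ip P (eta k i j) (eta k i j')).
Proof.
have /andP[ak] := aS k; rewrite le_eqVlt => /predU1P[e|lt].
  rewrite -e subrr mul0r mulr0 /ip /step -e.
  under eq_Rintegral do rewrite {1}/incr subrr mxE mulr0 mul0r.
  by rewrite Rintegral_cst // mul0r.
have st : 0 <= a k < a k.+1 by rewrite ak.
have FZ : Fmeas P B (a k) (fun w => eta k i j w * eta k i j' w).
  by apply: measurable_funM; exact: eta_Fmeas.
have mf : measurable_fun setT (fun A : borel_mx R d 1 => A j 0 * A j' 0).
  by apply: measurable_funM; exact: measurable_mx_entry.
have [] := indep_incr P_complete BM st FZ _ mf _.
- by apply: sqint_mul; exact: sqint_eta.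
- by apply: sqint_mul; exact: sqint_incr.
move=> _ h.
have -> : ip P (step k i j) (step k i j') = ip P (fun w => eta k i j w * eta k i j' w)
    (fun w => (B (a k.+1) w - B (a k) w) j 0 * (B (a k.+1) w - B (a k) w) j' 0).
  by apply: eq_Rintegral => w _; rewrite /step /incr; ring.
rewrite h -[X in _ * X]/(ip P (incr B (a k) (a k.+1) j) (incr B (a k) (a k.+1) j')).
by rewrite (ip_incr P_complete BM) // /ip; ring.
Qed.

Lemma ip_sp_integral i :
  ip P (fun w => sp_integral S s w i 0) (fun w => sp_integral S s w i 0) =
  \sum_(k < N) \sum_j (a k.+1 - a k) * ip P (eta k i j) (eta k i j).
Proof.
have -> : (fun w => sp_integral S s w i 0) = (fun w => \sum_(k < N) \sum_j step k i j w).
  by apply/funext => w; rewrite sp_integralE.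
have sk k : sqint P (fun w => \sum_j step k i j w).
  by apply: sqint_sum => j _; exact: sqint_step.
rewrite ip_suml //; last by apply: sqint_sum.
apply: eq_bigr => k _; rewrite ip_sumr //.
have zero k' l' : (k' < l')%N -> ip P (fun w => \sum_j step k' i j w) (fun w => \sum_j step l' i j w) = 0.
  move=> kl; rewrite ip_suml // big1 // => j _; rewrite ip_sumr // big1 // => j' _.
  exact: step_orth.
rewrite (bigD1 k) //= big1 ?addr0; last first.
  move=> l lk; have [kl|lk'|e] := ltngtP l k.
  - by rewrite ipC zero.
  - by rewrite zero.
  - by move/val_inj: e lk => ->; rewrite eqxx.
rewrite ip_suml //; apply: eq_bigr => j _; rewrite ip_sumr //.
rewrite (bigD1 j) //= big1 ?addr0; last first.
  by move=> l lj; rewrite step_same eq_sym (negbTE lj) mul0r.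
by rewrite step_same eqxx mul1r.
Qed.

(** The steps are disjoint, and for u <= s clipping them at [s] does not change which one contains
    [u]. So both sums have at most one nonzero term, and it carries the same index. *)
Let sp_eval_ge u w : u <= s ->
  \sum_(k < N) (\1_(`]a k, a k.+1]) u : R) * (\sum_i \sum_j eta k i j w ^+ 2)
  <= enorm (sp_eval S u w) ^+ 2.
Proof.
move=> us.
case: (pselect (exists k : 'I_N, a k < u <= a k.+1)) => [[k /andP[ku uk]]|no]; last first.
  rewrite big1 ?sqr_ge0 // => k _; rewrite indicE memNset ?mul0r //=.
  by rewrite in_itv /= => h; apply: no; exists k.
have one l : (u \in `]a l, a l.+1]%classic) = (l == k :> nat).
  apply/idP/eqP => [|->]; last by rewrite inE /= in_itv /= ku.
  rewrite inE /= in_itv /= => /andP[lu ul].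
  have [lk|kl|//] := ltngtP l k.
    by have := le_lt_trans (le_trans ul (amono lk)) ku; rewrite ltxx.
  by have := le_lt_trans (le_trans uk (amono kl)) lu; rewrite ltxx.
have tk : t k < u.
  by move: ku; rewrite gt_min => /orP[//|su]; have := le_lt_trans us su; rewrite ltxx.
have onet l : (u \in `]t l, t l.+1]%classic) = (l == k :> nat).
  apply/idP/eqP => [|->]; last first.
    by rewrite inE /= in_itv /= tk; move: uk; rewrite le_min => /andP[].
  rewrite inE /= in_itv /= => /andP[lu ul].
  have utk : u <= t k.+1 by move: uk; rewrite le_min => /andP[].
  have [lk|kl|//] := ltngtP l k.
    by have := le_lt_trans (le_trans ul (tmono lk)) tk; rewrite ltxx.
  by have := le_lt_trans (le_trans utk (tmono kl)) lu; rewrite ltxx.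
rewrite (bigD1 k) //= [X in _ + X <= _]big1 ?addr0; last first.
  move=> l lk; rewrite indicE one (_ : (l == k :> nat) = false) ?mul0r //.
  exact: negbTE lk.
have -> : sp_eval S u w = sp_coef S k w.
  rewrite /sp_eval (bigD1 k) //= big1 ?addr0; last first.
    move=> l lk; rewrite indicE (onet l) (_ : (l == k :> nat) = false) ?scale0r //.
    exact: negbTE lk.
  by rewrite indicE (onet k) eqxx scale1r.
rewrite indicE one eqxx mul1r enorm_sqr.
apply: ler_sum => i _; apply: ler_sum => j _.
by rewrite /eta (le_trans (ltW tk) us).
Qed.

(* Half of the Ito isometry, which is all that the argument needs. *)
Lemma sp_integral_le :
  (\int[P]_w (enorm (sp_integral S s w) ^+ 2)%:E <=
   \int[P]_w \int[lebesgue_measure]_(u in `[0%R, s]) (enorm (sp_eval S u w) ^+ 2)%:E)%E.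
Proof.
pose c k w : R := \sum_i \sum_j eta k i j w ^+ 2.
have c0 k w : 0 <= c k w.
  by apply: sumr_ge0 => i _; apply: sumr_ge0 => j _; exact: sqr_ge0.
have mc k : measurable_fun setT (c k).
  do 2 (apply: measurable_sum => ?); apply: measurable_funX.
  exact: eta_measurable.
apply: (@le_trans _ _ (\int[P]_w (\sum_(k < N) (a k.+1 - a k) * c k w)%:E)%E); last first.
  apply: ge0_le_integral_sup => w _.
    rewrite lee_fin; apply: sumr_ge0 => k _.
    by rewrite mulr_ge0 ?c0 // subr_ge0; have /andP[] := aS k.
  apply: (@le_trans _ _ (\int[lebesgue_measure]_(u in `[0%R, s])
      (\sum_(k < N) (\1_(`]a k, a k.+1]) u : R) * c k w)%:E)%E); last first.
    apply: ge0_le_integral_sup => u /=; rewrite in_itv /= => /andP[u0 us].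
      by rewrite lee_fin; apply: sumr_ge0 => k _; rewrite mulr_ge0 ?c0.
    by rewrite lee_fin; exact: sp_eval_ge.
  under eq_integral do rewrite -sumEFin.
  rewrite ge0_integral_sum //; last 2 first.
  - move=> k; apply/measurable_EFinP; apply: measurable_funM => //.
  - by move=> k u _; rewrite lee_fin mulr_ge0 ?c0.
  rewrite -sumEFin; apply: lee_sum => k _.
  under eq_integral do rewrite mulrC EFinM.
  rewrite ge0_integralZl_EFin //; last exact/measurable_EFinP.
  rewrite integral_indic //= setIidl; last first.
    move=> u /=; rewrite !in_itv /= => /andP[h1 h2].
    rewrite (le_trans (a0 k) (ltW h1)) (le_trans h2) //.
    by rewrite /a ge_min lexx orbT.
  rewrite lebesgue_measure_itv /= lte_fin.
  have /andP[_] := aS k; rewrite le_eqVlt => /predU1P[<-|->].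
    by rewrite ltxx mule0 subrr mul0r.
  by rewrite -EFinB -EFinM mulrC.
rewrite integral_enorm_sqr; last first.
  by move=> i j; rewrite (ord1 j); exact: sqint_sp_integral.
under eq_integral do rewrite -sumEFin.
rewrite ge0_integral_sum //; last 2 first.
- by move=> k; apply/measurable_EFinP; apply: measurable_funM.
- by move=> k w _; rewrite lee_fin mulr_ge0 ?c0 // subr_ge0; have /andP[] := aS k.
have -> : \sum_i \sum_j ip P (fun w => sp_integral S s w i j) (fun w => sp_integral S s w i j) =
   \sum_(k < N) (a k.+1 - a k) * \sum_i \sum_j ip P (eta k i j) (eta k i j).
  under eq_bigr do rewrite big_ord1 ip_sp_integral.
  rewrite exchange_big /=; apply: eq_bigr => k _; rewrite mulr_sumr.
  by apply: eq_bigr => i _; rewrite mulr_sumr.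
rewrite -sumEFin; apply: lee_sum => k _.
have cE w : c k w = enorm (\matrix_(i, j) eta k i j w) ^+ 2.
  rewrite enorm_sqr; apply: eq_bigr => i _; apply: eq_bigr => j _.
  by rewrite mxE.
under eq_integral do rewrite EFinM.
rewrite ge0_integralZl_EFin //; last 3 first.
- by move=> w _; rewrite lee_fin.
- exact/measurable_EFinP.
- by rewrite subr_ge0; have /andP[] := aS k.
under eq_integral do rewrite cE.
rewrite integral_enorm_sqr; last by move=> i j; under eq_fun do rewrite mxE.
rewrite -EFinM lee_fin le_eqVlt; apply/orP; left; apply/eqP; congr (_ * _).
apply: eq_bigr => i _; apply: eq_bigr => j _.
by congr ip; apply/funext => w; rewrite mxE.
Qed.

End SimpleProcess.

Lemma cvg0_squeeze {R : realType} (x : \bar R) (a : nat -> \bar R) :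
  (0 <= x)%E -> (forall k, x <= a k)%E -> a k @[k --> \oo] --> 0%E -> x = 0%E.
Proof.
move=> x0 xa a0; apply/eqP; rewrite eq_le x0 andbT.
rewrite -(cvg_lim _ a0) //; apply: lime_ge; first by apply/cvg_ex; eexists; exact: a0.
exact: nearW.
Qed.

(** * Mean and vanishing of a stochastic integral *)

Section ItoDeterministic.
Context {R : realType} {dd : measure_display} {Omega : measurableType dd}.
Variables (P : probability Omega R) (d n : nat) (B : R -> Omega -> 'cV[R]_d).
Hypothesis P_complete : measure_is_complete P.
Hypothesis BM : brownian_motion P B.
Variables (r : R) (Z : R -> Omega -> 'M[R]_(n, d)) (I : R -> Omega -> 'cV[R]_n).
Hypothesis ZI : ito_integral P B r Z I.
Variable s : R.
Hypothesis sr : 0 <= s <= r.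

Lemma ito_Fmeas i : Fmeas P B s (fun w => I s w i 0).
Proof.
have [_ _ aI _ _] := ZI.
have := aI s sr => /(measurable_mxP _ measurableT) h; exact: h.
Qed.

Let mI i : measurable_fun setT (fun w => I s w i 0).
Proof. exact: (Fmeas_measurable P_complete BM (@ito_Fmeas i)). Qed.

Let s0 : 0 <= s. Proof. by have /andP[] := sr. Qed.

Let sqint_entry (X : Omega -> 'cV[R]_n) i : measurable_fun setT (fun w => X w i 0) ->
  (\int[P]_w (enorm (X w) ^+ 2)%:E < +oo)%E -> sqint P (fun w => X w i 0).
Proof.
move=> mX fX; apply: sqint_ge0P => //; apply: le_lt_trans fX.
apply: ge0_le_integral_sup => w _; rewrite lee_fin ?sqr_ge0 //.
rewrite -(real_normK (num_real (X w i 0))) lerXn2r ?nnegrE ?enorm_ge0 //.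
exact: le_entry_enorm.
Qed.

(** Convergence to 0 in the extended reals makes the distances finite only eventually; dropping the
    first terms makes all of them finite. *)
Let approx : exists S : nat -> simple_process P B n,
  (\int[P]_w \int[lebesgue_measure]_(u in `[0%R, r])
     (enorm (sp_eval (S k) u w - Z u w) ^+ 2)%:E)%E @[k --> \oo] --> 0%E /\
  ((\int[P]_w (enorm (sp_integral (S k) s w - I s w) ^+ 2)%:E)%E @[k --> \oo] --> 0%E /\
   forall k, (\int[P]_w (enorm (sp_integral (S k) s w - I s w) ^+ 2)%:E < +oo)%E).
Proof.
have [_ _ _ _ [S [S1 S2]]] := ZI.
have [N _ hN] : \forall k \near \oo,
    (\int[P]_w (enorm (sp_integral (S k) s w - I s w) ^+ 2)%:E < +oo)%E.
  have := S2 s sr => /fine_cvgP[+ _]; apply: filterS => k.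
  by rewrite ge0_fin_numE // integral_ge0 // => w _; rewrite lee_fin sqr_ge0.
have shift (F : nat -> \bar R) : F k @[k --> \oo] --> 0%E ->
    F (k + N)%N @[k --> \oo] --> 0%E by rewrite cvg_shiftn.
exists (fun k => S (k + N)%N); split; [|split].
- exact: shift S1.
- exact: shift (S2 s sr).
- by move=> k; apply: hN; rewrite /= leq_addl.
Qed.

Let sqint_diff (S : simple_process P B n) i :
  (\int[P]_w (enorm (sp_integral S s w - I s w) ^+ 2)%:E < +oo)%E ->
  sqint P (fun w => sp_integral S s w i 0 - I s w i 0).
Proof.
move=> h; have := @sqint_entry (fun w => sp_integral S s w - I s w) i.
under eq_fun do rewrite mxE [in X in _ + X]mxE.
have [mS _] := sqint_sp_integral P_complete BM S s0 i.
by apply => //; exact: measurable_funB.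
Qed.

Lemma sqint_ito i : sqint P (fun w => I s w i 0).
Proof.
have [S [_ [_ /(_ 0%N) h]]] := approx.
have := sqintB (sqint_sp_integral P_complete BM (S 0%N) s0 i) (sqint_diff i h).
by under eq_fun do rewrite subKr.
Qed.

(** A simple integral has mean zero, so up to sign the mean of I is that of its error of
    approximation, whose square is at most the mean square error by [ip1_le]. *)
Lemma mean_ito i : ip P (fun w => I s w i 0) (fun=> 1) = 0.
Proof.
have [S [_ [h2 h3]]] := approx.
set m := ip _ _ _; have : (m ^+ 2)%:E = 0%E.
  apply: cvg0_squeeze h2; first by rewrite lee_fin sqr_ge0.
  move=> k; have sD := sqint_diff i (h3 k).
  have -> : m ^+ 2 = ip P (fun w => sp_integral (S k) s w i 0 - I s w i 0) (fun=> 1) ^+ 2.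
    rewrite (ipBl (sqint_sp_integral P_complete BM _ s0 i) (sqint_ito i) (sqint_cst P 1)).
    by rewrite (mean_sp_integral P_complete BM) // sub0r sqrrN.
  apply: (@le_trans _ _ (\int[P]_w ((sp_integral (S k) s w i 0 - I s w i 0) ^+ 2)%:E)%E).
    by rewrite integral_sqint // lee_fin ip1_le.
  apply: ge0_le_integral_sup => w _; rewrite lee_fin ?sqr_ge0 //.
  have -> : sp_integral (S k) s w i 0 - I s w i 0 = (sp_integral (S k) s w - I s w) i 0.
    by rewrite !mxE.
  rewrite -(real_normK (num_real (_ i 0))) lerXn2r ?nnegrE ?enorm_ge0 //.
  exact: le_entry_enorm.
by move=> [] /eqP; rewrite sqrf_eq0 => /eqP.
Qed.

(** The mean square of I_s is at most twice the mean square error plus twice the mean square of the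
    simple integral. The latter is at most the integral over [0, s] of the squared simple process,
    which coincides there with its squared distance to Z; both terms tend to 0. *)
Lemma ito_eq0 : (forall u w, 0 <= u < s -> Z u w = 0) -> {ae P, forall w, I s w = 0}.
Proof.
move=> Z0; have [S [h1 [h2 h3]]] := approx.
have mn : measurable_fun setT (fun w => (enorm (I s w) ^+ 2)%:E).
  apply/measurable_EFinP; apply: measurable_funX; apply: measurable_enorm => //.
  by apply/measurable_mxP => // i j; rewrite (ord1 j).
have I0 : (\int[P]_w (enorm (I s w) ^+ 2)%:E = 0)%E.
  pose e k : \bar R := (2%:E * \int[P]_w (enorm (sp_integral (S k) s w - I s w) ^+ 2)%:E +
    2%:E * \int[P]_w \int[lebesgue_measure]_(u in `[0%R, r])
     (enorm (sp_eval (S k) u w - Z u w) ^+ 2)%:E)%E.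
  apply: (@cvg0_squeeze _ _ e); last first.
  - rewrite -[X in _ --> X](_ : 2%:E * 0 + 2%:E * 0 = 0 :> \bar R)%E; last by rewrite !mule0 adde0.
    by apply: cvgeD; [rewrite !mule0|apply: cvgeZl|apply: cvgeZl].
  - move=> k.
    have mD i : measurable_fun setT (fun w => (sp_integral (S k) s w - I s w) i 0).
      under eq_fun do rewrite mxE [in X in _ + X]mxE.
      have [mS _] := sqint_sp_integral P_complete BM (S k) s0 i.
      exact: measurable_funB.
    have mS i : measurable_fun setT (fun w => sp_integral (S k) s w i 0).
      by have [] := sqint_sp_integral P_complete BM (S k) s0 i.
    have men (X : Omega -> 'cV[R]_n) : (forall i, measurable_fun setT (fun w => X w i 0)) ->
        measurable_fun setT (fun w => (enorm (X w) ^+ 2)%:E).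
      move=> mX; apply/measurable_EFinP; apply: measurable_funX.
      by apply: measurable_enorm => //; apply/measurable_mxP => // i j; rewrite (ord1 j).
    have le1 : (\int[P]_w (enorm (I s w) ^+ 2)%:E <=
        2%:E * \int[P]_w (enorm (sp_integral (S k) s w - I s w) ^+ 2)%:E +
        2%:E * \int[P]_w (enorm (sp_integral (S k) s w) ^+ 2)%:E)%E.
      rewrite -!ge0_integralZl_EFin //; try exact: men;
        try by move=> w _; rewrite lee_fin sqr_ge0.
      rewrite -ge0_integralD //; try by move=> w _; rewrite mule_ge0 ?lee_fin ?sqr_ge0.
      + apply: ge0_le_integral_sup => w _; first by rewrite lee_fin sqr_ge0.
        rewrite -!EFinM -EFinD lee_fin -(enormN (I s w)).
        rewrite [X in enorm X](_ : _ = (sp_integral (S k) s w - I s w) - sp_integral (S k) s w).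
          by apply: le_trans (enormD_sqr _ _) _; rewrite enormN.
        by rewrite addrAC subrr sub0r.
      + by apply: emeasurable_funM => //; exact: men.
      + by apply: emeasurable_funM => //; exact: men.
    apply: le_trans le1 _; rewrite /e leeD2l // lee_wpmul2l //.
    apply: le_trans (sp_integral_le P_complete BM (S k) s0) _.
    apply: ge0_le_integral_sup => w _; first by apply: integral_ge0 => u _; rewrite lee_fin sqr_ge0.
    (* Z is known to vanish only strictly before [s], so the endpoint, a null set, is removed from
       the domain. *)
    have mev : measurable_fun `[0, s[ (fun u => (enorm (sp_eval (S k) u w) ^+ 2)%:E).
      apply/measurable_EFinP; apply: measurable_funX; apply: measurable_enorm => //.
      apply/measurable_mxP => // i j.
      have -> : (fun u => sp_eval (S k) u w i j) = (fun u => \sum_(l < sp_size (S k))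
          (\1_(`]sp_time (S k) l, sp_time (S k) l.+1]) u : R) * sp_coef (S k) l w i j).
        by apply/funext => u; rewrite summxE; apply: eq_bigr => l _; rewrite mxE.
      by apply: measurable_sum => l; apply: measurable_funM.
    rewrite -integral_itv_bndo_bndc // integral_mkcond [leRHS]integral_mkcond.
    apply: ge0_le_integral_sup => u _.
      by rewrite /patch; case: ifP => // _; rewrite lee_fin sqr_ge0.
    rewrite /patch; case: ifPn => [/set_mem /=|_].
      rewrite in_itv /= => /andP[u0 us]; rewrite ifT.
        by rewrite Z0 ?subr0 // u0.
      rewrite inE /= in_itv /= u0 (le_trans (ltW us)) //; by have /andP[] := sr.
    by case: ifP => // _; rewrite lee_fin sqr_ge0.
  - by apply: integral_ge0 => w _; rewrite lee_fin sqr_ge0.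
have := (ae_eq_integral_abs P measurableT mn).1.
have -> : (\int[P]_x `|(enorm (I s x) ^+ 2)%:E| = 0)%E.
  by rewrite -{}I0; apply: eq_integral => w _; rewrite gee0_abs // lee_fin sqr_ge0.
move=> /(_ erefl); apply: filterS => w /(_ Logic.I) [] /eqP; rewrite sqrf_eq0 => /eqP h.
apply/matrixP => i j; rewrite mxE (ord1 j); apply/eqP; rewrite -normr_le0 -h.
exact: le_entry_enorm.
Qed.

End ItoDeterministic.

(** * The backward equation *)

Lemma measurable_fun_pair_on d d1 d2 (T : measurableType d) (T1 : measurableType d1)
  (T2 : measurableType d2) (D : set T) (f : T -> T1) (g : T -> T2) :
  measurable D -> measurable_fun D f -> measurable_fun D g ->
  measurable_fun D (fun x => (f x, g x)).
Proof.
move=> mD mf mg; apply: (@measurability _ _ _ _ _ _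
  [set A `*` C | A in @measurable _ T1 & C in @measurable _ T2]).
  exact: measurable_prod_measurableType.
move=> _ [_ [A mA [C mC <-]] <-].
have -> : D `&` (fun x => (f x, g x)) @^-1` (A `*` C) =
    (D `&` f @^-1` A) `&` (D `&` g @^-1` C).
  by apply/seteqP; split => [x [Dx [fA gC]]|x [[Dx fA] [_ gC]]].
by apply: measurableI; [exact: mf|exact: mg].
Qed.

Section Calculus.
Context {R : realType}.

(** A crude form of the triangle inequality, used only where some finite bound is wanted. *)
Lemma enormD (m n : nat) (A C : 'M[R]_(m, n)) : enorm (A + C) <= 2 * (enorm A + enorm C).
Proof.
have h := enormD_sqr A C; have := enorm_ge0 A; have := enorm_ge0 C => c0 a0.
rewrite -(@ler_pXn2r _ 2) ?nnegrE ?enorm_ge0 ?mulr_ge0 ?addr_ge0 //.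
by apply: le_trans h _; nra.
Qed.

Lemma enorm_cV_le (n : nat) (A : 'cV[R]_n) C :
  (forall i, `|A i 0| <= C) -> enorm A <= n%:R * C.
Proof.
move=> AC; apply: le_trans (enorm_le_sum _) _.
have -> : n%:R * C = \sum_(i < n) C by rewrite sumr_const card_ord mulr_natl.
by apply: ler_sum => i _; rewrite big_ord1.
Qed.

Lemma geometric_cvg (u : nat -> R) (C : R) :
  (forall k, `|u k.+1 - u k| <= C / 2 ^+ k) ->
  cvgn u /\ forall k, `|limn u - u k| <= 2 * C / 2 ^+ k.
Proof.
move=> hu.
have p2 k : 0 < 2 ^+ k :> R by rewrite exprn_gt0.
have C0 : 0 <= C by have := hu 0%N; rewrite expr0 divr1; exact: le_trans.
have tail k l : (k <= l)%N -> `|u l - u k| <= 2 * C / 2 ^+ k - 2 * C / 2 ^+ l.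
  elim: l => [|l IH]; first by rewrite leqn0 => /eqP ->; rewrite !subrr normr0.
  rewrite leq_eqVlt => /predU1P[->|kl]; first by rewrite !subrr normr0.
  have -> : u l.+1 - u k = (u l.+1 - u l) + (u l - u k) by ring.
  apply: le_trans (ler_normD _ _) _.
  apply: le_trans (lerD (hu l) (IH kl)) _.
  rewrite exprS le_eqVlt; apply/orP; left; apply/eqP; field.
  by rewrite !gt_eqF.
have half0 : 2 * C / 2 ^+ k @[k --> \oo] --> (0 : R).
  rewrite -[X in _ --> X](mulr0 (2 * C)); apply: cvgMr.
  under eq_fun do rewrite -exprVn.
  by apply: cvg_expr; rewrite ger0_norm ?invr_ge0 // invf_lt1 // ltr1n.
have tl k l : (k <= l)%N -> `|u l - u k| <= 2 * C / 2 ^+ k.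
  move=> kl; apply: le_trans (tail _ _ kl) _.
  by rewrite gerBl divr_ge0 ?mulr_ge0 // ltW.
have cu : cvgn u.
  (* The subtracted term is the sum of all remaining bounds C / 2^l for l >= k; it turns [u] into a
     nondecreasing bounded sequence. *)
  have ca : cvgn (fun k => u k - 2 * C / 2 ^+ k).
    apply: nondecreasing_is_cvgn.
      apply/nondecreasing_seqP => k; have := hu k; rewrite ler_norml => /andP[+ _].
      have -> : 2 * C / 2 ^+ k.+1 = C / 2 ^+ k by rewrite exprS; field; rewrite gt_eqF.
      by rewrite -[X in _ -> _ <= _ - X]divr1; lra.
    exists (u 0%N + 2 * C) => _ [k _ <-].
    have := tl 0%N k (leq0n k); rewrite expr0 divr1 ler_norml => /andP[_ h1].
    have : 0 <= 2 * C / 2 ^+ k by rewrite divr_ge0 ?mulr_ge0 // ltW.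
    lra.
  have -> : u = (fun k => (u k - 2 * C / 2 ^+ k) + 2 * C / 2 ^+ k).
    by apply/funext => k; rewrite subrK.
  by apply: is_cvgD => //; apply/cvg_ex; exists 0.
split => // k.
have cn : `|u l - u k| @[l --> \oo] --> `|limn u - u k|.
  by apply: cvg_norm; apply: cvgB => //; exact: cvg_cst.
rewrite -(cvg_lim _ cn) //; apply: limr_le; first by apply/cvg_ex; eexists; exact: cn.
by exists k => // l /= kl; exact: tl.
Qed.

Notation leb := (@lebesgue_measure R).

Lemma Rintegral_itv_bounds (f : R -> R) (a b c : R) : a <= b -> b <= c ->
  leb.-integrable `[a, c] (EFin \o f) ->
  \int[leb]_(u in `[b, c]) f u =
  \int[leb]_(u in `[a, c]) f u - \int[leb]_(u in `[a, b]) f u.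
Proof.
move=> ab bc intf.
rewrite (@Rintegral_itvB R f (BLeft a) (BRight c) b) ?bnd_simp //.
rewrite Rintegral_itv_obnd_cbnd //; apply: integrableS intf => //.
by apply: subset_itvr; rewrite bnd_simp.
Qed.

Lemma backward_integral_continuous (f : R -> R) (r : R) : 0 <= r ->
  leb.-integrable `[0, r] (EFin \o f) ->
  {within `[0, r], continuous (fun s => \int[leb]_(u in `[s, r]) f u)}.
Proof.
move=> r0 intf; have := parameterized_integral_continuous r0 intf => c.
have c2 : {within `[0, r], continuous (fun s : R =>
    \int[leb]_(u in `[0, r]) f u - \int[leb]_(u in `[0, s]) f u)}.
  by move=> x; apply: cvgB; [exact: cvg_cst|exact: c].
move: c2; apply: subspace_eq_continuous.
move=> s; rewrite inE /= in_itv /= => /andP[s0 sr].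
by apply/esym; exact: Rintegral_itv_bounds.
Qed.

Lemma integral_exp_le (b s r : R) : 0 < b -> s <= r ->
  \int[leb]_(u in `[s, r]) expR (b * (r - u)) <= expR (b * (r - s)) / b.
Proof.
move=> b0; rewrite le_eqVlt => /predU1P[<-|sr].
  by rewrite set_itv1 Rintegral_set1 divr_ge0 ?expR_ge0 // ltW.
pose F (u : R) := - expR (b * (r - u)) / b.
have dF (x : R) : is_derive x (1:R) F (expR (b * (r - x))).
  rewrite /F; apply: is_derive_eq; rewrite /GRing.scale /=.
  by field; rewrite gt_eqF.
have cF : continuous F.
  move=> x; apply: differentiable_continuous; apply/derivable1_diffP.
  exact: (@ex_derive _ _ _ _ _ _ _ (dF x)).
rewrite /Rintegral (@continuous_FTC2 _ _ F) //=.
- rewrite /F subrr mulr0 expR0 mulN1r mulNr opprK addrC lerBlDr lerDl.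
  by rewrite invr_ge0 ltW.
- apply: continuous_subspaceT => x; apply: continuous_comp; last exact: continuous_expR.
  by apply: cvgM; [exact: cvg_cst|apply: cvgB; [exact: cvg_cst|exact: cvg_id]].
- split.
  + by move=> x _; exact: (@ex_derive _ _ _ _ _ _ _ (dF x)).
  + exact/cvg_at_right_filter/cF.
  + exact/cvg_at_left_filter/cF.
- by move=> x _; rewrite derive1E; exact: (@derive_val _ _ _ _ _ _ _ (dF x)).
Qed.

Lemma cvg_mx (S : Type) (F : set_system S) (m n : nat) (f : S -> 'M[R]_(m, n))
  (M : 'M[R]_(m, n)) : Filter F ->
  (forall i j, f x i j @[x --> F] --> M i j) -> f x @[x --> F] --> M.
Proof.
move=> FF cf A [Q QM QA].
have : \forall x \near F, forall i j, Q i j (f x i j).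
  apply: filter_forall => i; apply: filter_forall => j; exact: cf i j _ (QM i j).
by apply: filterS => x Qx; exact: QA.
Qed.

Lemma within_continuous_mx (m n : nat) (A : set R) (f : R -> 'M[R]_(m, n)) :
  (forall i j, {within A, continuous (fun s => f s i j)}) -> {within A, continuous f}.
Proof. by move=> cf x; apply: cvg_mx => i j; exact: cf. Qed.

Lemma within_continuous_entry (m n : nat) (A : set R) (f : R -> 'M[R]_(m, n)) i j :
  {within A, continuous f} -> {within A, continuous (fun s => f s i j)}.
Proof.
move=> cf x; apply: (@continuous_comp _ _ _ (f : subspace A -> 'M[R]_(m, n)) (fun M => M i j)).
  exact: cf.
exact: coord_continuous.
Qed.

End Calculus.

(** * Existence for the backward equation *)

Section ODE.
Context {R : realType} {n d : nat}.
Variables (T mu : R) (g : R -> 'cV[R]_n -> 'M[R]_(n, d) -> 'cV[R]_n).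
Hypothesis mu_gt0 : 0 < mu.
Hypothesis gG : Ghat T mu g.
Variables (h : R -> 'M[R]_(n, d)) (r : R).
Hypothesis r0 : 0 <= r.
Hypothesis rT : r <= T.
Hypothesis mh : measurable_fun `[0, r] (h : R -> borel_mx R n d).
Notation leb := (@lebesgue_measure R).

Let mitv (a b : R) : (measurable : set (set (measurableTypeR R))) `[a, b]%classic.
Proof. exact: measurable_itv. Qed.

Let G (f : R -> 'cV[R]_n) (u : R) := g u (f u) (h u).

Lemma driver_measurable f : measurable_fun `[0, r] (f : R -> borel_mx R n 1) ->
  measurable_fun `[0, r] (G f : R -> borel_mx R n 1).
Proof.
move=> mf; have [mg _ _] := gG.
have mfh : measurable_fun `[0, r]
    ((fun u => (u, f u, h u)) : R -> (R * borel_mx R n 1 * borel_mx R n d)%type).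
  have mI : measurable (`[0, r]%classic : set R) by exact: measurable_itv.
  have mu1 : measurable_fun `[0, r] (fun u : R => u) by exact: measurable_id.
  exact: (measurable_fun_pair_on mI (measurable_fun_pair_on mI mu1 mf) mh).
apply: (@measurable_comp _ _ _ _ _ _ (`[0, T] `*` setT `*` setT)
  (fun p : R * borel_mx R n 1 * borel_mx R n d => g p.1.1 p.1.2 p.2 : borel_mx R n 1)
  _ ((fun u => (u, f u, h u)) : R -> (R * borel_mx R n 1 * borel_mx R n d)%type)) => //.
- by apply: measurableX => //; apply: measurableX.
- move=> _ [u /= ur <-] /=; split => //; split => //=.
  by move: ur; rewrite !in_itv /= => /andP[-> /le_trans]; apply.
Qed.

Lemma entry_integrable (F : R -> 'cV[R]_n) i (a b : R) : 0 <= a -> b <= r ->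
  measurable_fun `[0, r] (F : R -> borel_mx R n 1) ->
  (\int[leb]_(s in `[0%R, r]) (enorm (F s))%:E < +oo)%E ->
  leb.-integrable `[a, b] (EFin \o (fun u => F u i 0)).
Proof.
move=> a0 br mF fF.
have : leb.-integrable `[0, r] (EFin \o (fun u => F u i 0)).
  apply/integrableP; split.
    by apply/measurable_EFinP; have /measurable_mxP := mF; apply.
  apply: le_lt_trans fF; apply: ge0_le_integral_sup => u _ //=.
  by rewrite lee_fin le_entry_enorm.
apply: integrableS => //; move=> u /=; rewrite !in_itv /= => /andP[h1 h2].
by rewrite (le_trans a0 h1) (le_trans h2 br).
Qed.

(** For almost every s the Lipschitz bound gives |g(s, f, h)| <= 2 |g(s, 0, h)| + 2 mu K. *)
Lemma driver_integral_lty f K :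
  (\int[leb]_(s in `[0%R, r]) (enorm (g s 0 (h s)))%:E < +oo)%E ->
  measurable_fun `[0, r] (f : R -> borel_mx R n 1) ->
  (forall u, 0 <= u <= r -> enorm (f u) <= K) ->
  (\int[leb]_(s in `[0%R, r]) (enorm (G f s))%:E < +oo)%E.
Proof.
move=> g0 mf fK; have [_ lip _] := gG.
have K0 : 0 <= K by apply: le_trans (fK 0 _); rewrite ?enorm_ge0 ?lexx.
have m0 : measurable_fun `[0, r] ((fun=> 0) : R -> borel_mx R n 1) by exact: measurable_cst.
have mG0 : measurable_fun `[0, r] (fun u => (enorm (g u 0 (h u)))%:E).
  by apply/measurable_EFinP; apply: measurable_enorm => //; exact: (driver_measurable m0).
have mGf : measurable_fun `[0, r] (fun u => (enorm (G f u))%:E).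
  by apply/measurable_EFinP; apply: measurable_enorm => //; exact: driver_measurable.
apply: (@le_lt_trans _ _ (\int[leb]_(s in `[0%R, r])
   (2%:E * (enorm (g s 0 (h s)))%:E + (2 * (mu * K))%:E))%E).
  apply: ae_ge0_le_integral => //.
  - by move=> u _; rewrite lee_fin enorm_ge0.
  - by move=> u _; rewrite adde_ge0 ?mule_ge0 ?lee_fin ?enorm_ge0 ?mulr_ge0 // ltW.
  - by apply: emeasurable_funD => //; apply: emeasurable_funM.
  - move: lip; apply: filterS; first exact: (ae_filter_ringOfSetsType leb).
    move=> u lip; rewrite /= in_itv /= => /andP[u0 ur].
    rewrite -EFinM -EFinD lee_fin /G.
    have -> : g u (f u) (h u) = g u 0 (h u) + (g u (f u) (h u) - g u 0 (h u)).
      by rewrite addrC subrK.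
    apply: le_trans (enormD _ _) _; rewrite mulrDr lerD2l ler_wpM2l //.
    apply: le_trans (lip _ _ _ _) _; first by rewrite u0 (le_trans ur).
    by rewrite ler_wpM2l ?(ltW mu_gt0) // subr0 fK // u0.
rewrite ge0_integralD //.
- rewrite ge0_integralZl_EFin //.
    rewrite lte_add_pinfty ?lte_mul_pinfty // integral_cst //=.
    by rewrite lebesgue_measure_itv /=; case: ifP => _; rewrite ?mule0 // -?EFinB -EFinM ltry.
  by move=> u _; rewrite lee_fin enorm_ge0.
- by move=> u _; rewrite mule_ge0 // lee_fin enorm_ge0.
- exact: emeasurable_funM.
- by move=> u _; rewrite lee_fin ?mulr_ge0 // ltW.
Qed.

(** The majorant [e] is left free: an exponential weight in the contraction estimate, a constant in
    the passage to the limit and over a short horizon. *)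
Lemma driver_lipschitz f1 f2 (e : R -> R) s i : 0 <= s <= r ->
  measurable_fun `[0, r] (f1 : R -> borel_mx R n 1) ->
  measurable_fun `[0, r] (f2 : R -> borel_mx R n 1) ->
  (\int[leb]_(s in `[0%R, r]) (enorm (G f1 s))%:E < +oo)%E ->
  (\int[leb]_(s in `[0%R, r]) (enorm (G f2 s))%:E < +oo)%E ->
  leb.-integrable `[s, r] (EFin \o e) ->
  (forall u, s <= u <= r -> enorm (f1 u - f2 u) <= e u) ->
  `|\int[leb]_(u in `[s, r]) G f1 u i 0 - \int[leb]_(u in `[s, r]) G f2 u i 0|
   <= mu * \int[leb]_(u in `[s, r]) e u.
Proof.
move=> /andP[s0 sr] m1 m2 i1 i2 ie hf; have [_ lip _] := gG.
have I1 := entry_integrable i s0 (lexx r) (driver_measurable m1) i1.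
have I2 := entry_integrable i s0 (lexx r) (driver_measurable m2) i2.
rewrite -RintegralB // -RintegralZl //.
have I12 : leb.-integrable `[s, r] (EFin \o (fun u => G f1 u i 0 - G f2 u i 0)).
  by have := integrableB (mitv _ _) I1 I2; exact: eq_integrable.
apply: le_trans (le_normr_Rintegral _ I12) _ => //.
have Ie : leb.-integrable `[s, r] (EFin \o (fun u => mu * e u)).
  by have := integrableZl (mitv _ _) mu ie; exact: eq_integrable.
rewrite -lee_fin /Rintegral !fineK; last 2 first.
- exact: (integrable_fin_num (mitv _ _) Ie).
- exact: (integrable_fin_num (mitv _ _) (integrable_norm I12)).
apply: ae_ge0_le_integral => //.
- have /integrableP[mI12 _] := I12; apply/measurable_EFinP.
  by apply: measurableT_comp => //; exact/measurable_EFinP.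
- move=> u; rewrite /= in_itv /= => us; rewrite lee_fin mulr_ge0 ?(ltW mu_gt0) //.
  by apply: le_trans (hf u us); exact: enorm_ge0.
- by have /integrableP[] := Ie.
move: lip; apply: filterS; first exact: (ae_filter_ringOfSetsType leb).
move=> u lip; rewrite /= in_itv /= => us; rewrite lee_fin.
have -> : G f1 u i 0 - G f2 u i 0 = (G f1 u - G f2 u) i 0 by rewrite !mxE.
apply: le_trans (le_entry_enorm _ _ _) _; apply: le_trans (lip _ _ _ _) _.
  by have /andP[su ur] := us; rewrite (le_trans s0 su) (le_trans ur rT).
by rewrite ler_wpM2l ?(ltW mu_gt0) // hf.
Qed.


Hypothesis n_gt0 : (0 < n)%N.
Hypothesis g0_lty : (\int[leb]_(s in `[0%R, r]) (enorm (g s 0 (h s)))%:E < +oo)%E.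
Variable y : 'cV[R]_n.

Let phi (k : nat) : R -> 'cV[R]_n :=
  iter k (fun f s => y + vec_int s r (G f)) (fun=> y).

Let bdd (f : R -> 'cV[R]_n) := measurable_fun `[0, r] (f : R -> borel_mx R n 1) /\
  exists K, forall u, 0 <= u <= r -> enorm (f u) <= K.

Let bdd_lty f : bdd f -> (\int[leb]_(s in `[0%R, r]) (enorm (G f s))%:E < +oo)%E.
Proof. by move=> [mf [K fK]]; exact: driver_integral_lty mf fK. Qed.

(** Only the integrability of the driver along [f] is asked, not boundedness of [f]. Besides keeping
    the Picard iterates bounded, this upgrades any solution from [l2] to continuous and bounded. *)
Lemma integral_curve_regular f : measurable_fun `[0, r] (f : R -> borel_mx R n 1) ->
  (\int[leb]_(s in `[0%R, r]) (enorm (G f s))%:E < +oo)%E ->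
  (forall i, {within `[0, r], continuous (fun s => (y + vec_int s r (G f)) i 0)}) /\
  bdd (fun s => y + vec_int s r (G f)).
Proof.
move=> mf fG; have mG := driver_measurable mf.
have I i := entry_integrable i (lexx 0) (lexx r) mG fG.
have e i s : (y + vec_int s r (G f)) i 0 = y i 0 + \int[leb]_(u in `[s, r]) G f u i 0.
  by rewrite !mxE.
have c i : {within `[0, r], continuous (fun s => (y + vec_int s r (G f)) i 0)}.
  have -> : (fun s => (y + vec_int s r (G f)) i 0) =
      (fun s => y i 0 + \int[leb]_(u in `[s, r]) G f u i 0).
    by apply/funext => s; exact: e.
  have := backward_integral_continuous r0 (I i) => c x.
  by apply: cvgD; [exact: cvg_cst|exact: c].
split => //; split.
  apply/measurable_mxP => // i j; rewrite (ord1 j).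
  by apply: subspace_continuous_measurable_fun; [exact: measurable_itv|exact: c].
exists (\sum_i \sum_(j < 1) (`|y i 0| + \int[leb]_(u in `[0, r]) `|G f u i 0|)).
move=> s /andP[s0 sr]; apply: le_trans (enorm_le_sum _) _.
apply: ler_sum => i _; apply: ler_sum => j _; rewrite (ord1 j) e.
apply: le_trans (ler_normD _ _) _; rewrite lerD2l.
have Is := entry_integrable i s0 (lexx r) mG fG.
apply: le_trans (le_normr_Rintegral _ Is) _ => //.
rewrite -lee_fin /Rintegral !fineK; last 2 first.
- exact: (integrable_fin_num (mitv _ _) (integrable_norm (I i))).
- exact: (integrable_fin_num (mitv _ _) (integrable_norm Is)).
apply: ge0_subset_integral => //.
- have /integrableP[mI _] := I i; apply/measurable_EFinP.
  by apply: measurableT_comp => //; exact/measurable_EFinP.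
- by apply: subset_itvr; rewrite bnd_simp.
Qed.

Let phi_bdd k : bdd (phi k).
Proof.
elim: k => [|k IH]; first by split; [exact: measurable_cst|exists (enorm y)].
by have [] := integral_curve_regular IH.1 (bdd_lty IH).
Qed.

(* The Picard map halves the distance weighted by exp(- b (r - u)), so that no
   smallness of r is needed. *)
Let b := 2 * n%:R * mu.
Let b0 : 0 < b. Proof. by rewrite !mulr_gt0 // ltr0n. Qed.

Let contraction f1 f2 C : bdd f1 -> bdd f2 ->
  (forall u, 0 <= u <= r -> enorm (f1 u - f2 u) <= C * expR (b * (r - u))) ->
  forall s, 0 <= s <= r ->
  enorm ((y + vec_int s r (G f1)) - (y + vec_int s r (G f2))) <=
  C / 2 * expR (b * (r - s)).
Proof.
move=> b1 b2 hC s sr; have /andP[s0 s_r] := sr.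
have C0 : 0 <= C.
  have := hC s sr; have := enorm_ge0 (f1 s - f2 s); move=> /le_trans h1 /h1.
  by rewrite pmulr_lge0 // expR_gt0.
have ce : continuous (fun u : R => expR (b * (r - u))).
  move=> x; apply: continuous_comp; last exact: continuous_expR.
  by apply: cvgM; [exact: cvg_cst|apply: cvgB; [exact: cvg_cst|exact: cvg_id]].
have ie0 : leb.-integrable `[s, r] (EFin \o (fun u : R => expR (b * (r - u)))).
  apply: continuous_compact_integrable; first exact: segment_compact.
  exact: continuous_subspaceT.
have ie : leb.-integrable `[s, r] (EFin \o (fun u : R => C * expR (b * (r - u)))).
  by have := integrableZl (mitv _ _) C ie0; exact: eq_integrable.
have hi i : `|((y + vec_int s r (G f1)) - (y + vec_int s r (G f2))) i 0| <=
    mu * (C * (expR (b * (r - s)) / b)).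
  have -> : ((y + vec_int s r (G f1)) - (y + vec_int s r (G f2))) i 0 =
    \int[leb]_(u in `[s, r]) G f1 u i 0 - \int[leb]_(u in `[s, r]) G f2 u i 0.
    by rewrite !mxE; ring.
  apply: le_trans (driver_lipschitz i sr b1.1 b2.1 (bdd_lty b1) (bdd_lty b2) ie _) _.
    move=> u /andP[su ur]; apply: hC; by rewrite (le_trans s0 su).
  rewrite ler_wpM2l ?(ltW mu_gt0) // RintegralZl // ler_wpM2l //.
  exact: integral_exp_le.
(* Passing from entries to the norm costs a factor n, and b = 2 n mu makes n mu / b equal to 1/2. *)
apply: le_trans (enorm_cV_le hi) _.
rewrite /b le_eqVlt; apply/orP; left; apply/eqP.
by field; rewrite pnatr_eq0 -lt0n n_gt0 gt_eqF.
Qed.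

Lemma backward_ode_exists : exists f, backward_ode_solution g y h r f.
Proof.
have [C hC] : exists C, forall u, 0 <= u <= r -> enorm (phi 1 u - phi 0 u) <= C.
  have [_ [K1 h1]] := phi_bdd 1; have [_ [K0 h0]] := phi_bdd 0.
  exists (2 * (K1 + K0)) => u ur; apply: le_trans (enormD _ _) _.
  by rewrite ler_wpM2l // lerD ?h1 // enormN h0.
have C0 : 0 <= C by apply: le_trans (hC 0 _); rewrite ?enorm_ge0 ?lexx.
have e1 s : 0 <= s <= r -> 1 <= expR (b * (r - s)).
  move=> /andP[_ sr]; rewrite -[leLHS]expR0 ler_expR mulr_ge0 ?(ltW b0) //.
  by rewrite subr_ge0.
have step k s : 0 <= s <= r ->
    enorm (phi k.+1 s - phi k s) <= C / 2 ^+ k * expR (b * (r - s)).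
  elim: k s => [|k IH] s sr.
    rewrite expr0 divr1; apply: le_trans (hC s sr) _.
    by rewrite ler_peMr // e1.
  have -> : C / 2 ^+ k.+1 = C / 2 ^+ k / 2.
    by rewrite exprS; field; rewrite gt_eqF // exprn_gt0.
  exact: contraction (phi_bdd k.+1) (phi_bdd k) IH s sr.
(* Bounding the weight by its value at time 0 turns the weighted contraction into a geometric rate
   uniform in s. *)
pose C' := C * expR (b * r).
have C'0 : 0 <= C' by rewrite mulr_ge0 // expR_ge0.
have step' k s i : 0 <= s <= r -> `|phi k.+1 s i 0 - phi k s i 0| <= C' / 2 ^+ k.
  move=> sr; have -> : phi k.+1 s i 0 - phi k s i 0 = (phi k.+1 s - phi k s) i 0.
    by rewrite !mxE.
  apply: le_trans (le_entry_enorm _ _ _) _; apply: le_trans (step k s sr) _.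
  rewrite /C' mulrAC ler_wpM2r ?invr_ge0 ?exprn_ge0 // ler_wpM2l // ler_expR.
  by rewrite ler_pM2l // lerBlDr lerDl; case/andP: sr.
pose f s : 'cV[R]_n := \col_i limn (fun k => phi k s i 0).
have fi s i : f s i 0 = limn (fun k => phi k s i 0) by rewrite mxE.
have cf s i : 0 <= s <= r -> phi k s i 0 @[k --> \oo] --> f s i 0.
  by move=> sr; rewrite fi; have [] := geometric_cvg (fun k => step' k s i sr).
have ef s k : 0 <= s <= r -> enorm (f s - phi k s) <= n%:R * (2 * C' / 2 ^+ k).
  move=> sr; apply: enorm_cV_le => i; rewrite !mxE.
  by have [_ /(_ k)] := geometric_cvg (fun k => step' k s i sr).
have bf : bdd f.
  split.
    apply/measurable_mxP => // i j; rewrite (ord1 j).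
    apply: (measurable_fun_cvg (h := fun k s => phi k s i 0)).
      by move=> k; have /measurable_mxP := (phi_bdd k).1; apply.
    by move=> s /=; rewrite in_itv /= => sr; exact: cf.
  have [_ [K0 h0]] := phi_bdd 0.
  exists (2 * (n%:R * (2 * C' / 2 ^+ 0) + K0)) => u ur.
  rewrite -(subrK (phi 0 u) (f u)); apply: le_trans (enormD _ _) _.
  by rewrite ler_wpM2l // lerD ?h0 // ef.
exists f; split.
- split; first exact: bf.1.
  have [mf [K hK]] := bf.
  apply: (@le_lt_trans _ _ (\int[leb]_(s in `[0%R, r]) (K ^+ 2)%:E)%E).
    apply: ge0_le_integral_sup => u /=; first by rewrite lee_fin sqr_ge0.
    rewrite in_itv /= => ur; rewrite lee_fin lerXn2r ?nnegrE ?enorm_ge0 ?hK //.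
    by apply: le_trans (hK u ur); exact: enorm_ge0.
  rewrite integral_cst //= lebesgue_measure_itv /=.
  by case: ifP => _; rewrite ?mule0 // -?EFinB -EFinM ltry.
- exact: bdd_lty.
- move=> s sr; have /andP[s0 s_r] := sr; apply/matrixP => i j; rewrite (ord1 j).
  apply: (cvg_unique _ (cf s i sr)) => //.
  (* The shifted iterates are the images of the iterates under the integral map; they converge to
     the image of f, and also to f itself. *)
  suff : phi k.+1 s i 0 @[k --> \oo] -->
      (y + vec_int s r (fun u => g u (f u) (h u))) i 0.
    by rewrite (cvg_shiftS (fun k => phi k s i 0)).
  apply/cvgrPdist_le => e ep.
  have lim0 : mu * (n%:R * (2 * C') * r) / 2 ^+ k @[k --> \oo] --> (0 : R).
    rewrite -[X in _ --> X](mulr0 (mu * (n%:R * (2 * C') * r))); apply: cvgMr.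
    under eq_fun do rewrite -exprVn.
    by apply: cvg_expr; rewrite ger0_norm ?invr_ge0 // invf_lt1 // ltr1n.
  have /cvgrPdist_le /(_ e ep) := lim0; apply: filterS => k.
  rewrite sub0r normrN => /(le_trans (ler_norm _)); apply: le_trans.
  have -> : (y + vec_int s r (fun u => g u (f u) (h u))) i 0 - (y + vec_int s r (G (phi k))) i 0 =
     \int[leb]_(u in `[s, r]) G f u i 0 - \int[leb]_(u in `[s, r]) G (phi k) u i 0.
    by rewrite !mxE /G; ring.
  have ic : leb.-integrable `[s, r] (EFin \o (fun u : R => n%:R * (2 * C' / 2 ^+ k))).
    apply: continuous_compact_integrable; first exact: segment_compact.
    by apply: continuous_subspaceT => x; exact: cvg_cst.
  apply: le_trans (driver_lipschitz i sr bf.1 (phi_bdd k).1 (bdd_lty bf) (bdd_lty (phi_bdd k)) ic _) _.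
    by move=> u /andP[su ur]; apply: ef; rewrite (le_trans s0 su).
  rewrite -[leRHS]mulrA ler_wpM2l ?(ltW mu_gt0) // Rintegral_cst //.
  have -> : fine (leb `[s, r]) = r - s.
    rewrite lebesgue_measure_itv /= lte_fin; case: ltgtP s_r => [h1 _|//|->].
      by rewrite -EFinB.
    by rewrite subrr.
  have k0 : 0 <= n%:R * (2 * C' / 2 ^+ k).
    by rewrite mulr_ge0 // divr_ge0 ?mulr_ge0 ?exprn_ge0.
  apply: (@le_trans _ _ (n%:R * (2 * C' / 2 ^+ k) * r)).
    by rewrite ler_wpM2l // lerBlDr lerDl.
  by rewrite le_eqVlt; apply/orP; left; apply/eqP; ring.
Qed.

End ODE.

(** * Approximation by step functions *)

Lemma measurable_mxB {R : realType} (m n : nat) (d : measure_display)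
  (T : measurableType d) (D : set T) (f g : T -> borel_mx R m n) : measurable D ->
  measurable_fun D f -> measurable_fun D g ->
  measurable_fun D ((fun x => (f x : 'M[R]_(m, n)) - g x) : T -> borel_mx R m n).
Proof.
move=> mD /(measurable_mxP _ mD) mf /(measurable_mxP _ mD) mg.
apply/(measurable_mxP _ mD) => i j.
have -> : (fun x => ((f x : 'M[R]_(m, n)) - g x) i j) = (fun x => f x i j - g x i j).
  by apply/funext => x; rewrite !mxE.
exact: measurable_funB.
Qed.

Section StepApproximation.
Context {R : realType}.
Notation leb := (@lebesgue_measure R).
Implicit Types (f : R -> R) (r M x u : R).

Let tr M x := Num.max (- M) (Num.min x M).

Let tr_bound M x : 0 <= M -> `|tr M x| <= M.
Proof.
move=> M0; rewrite /tr ler_norml.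
by case: (leP x M) => ?; [case: (leP (- M) x)|case: (leP (- M) M)] => ?;
  apply/andP; split; lra.
Qed.

Let tr_lip M x u : 0 <= M -> `|tr M x - tr M u| <= `|x - u|.
Proof.
move=> M0; have h1 := ler_norm (x - u); have h2 := ler_norm (- (x - u)).
rewrite normrN in h2; rewrite /tr ler_norml.
by case: (leP x M) => ?; case: (leP u M) => ?; do ?[case: (leP (- M) _) => ?];
  apply/andP; split; lra.
Qed.

Let tr_id M x : `|x| <= M -> tr M x = x.
Proof.
rewrite ler_norml => /andP[h1 h2]; rewrite /tr (min_idPl h2).
by apply/max_idPr.
Qed.

Let tr_sub M x : 0 <= M -> `|x - tr M x| <= `|x|.
Proof.
move=> M0; have h1 := ler_norm x; have h2 := ler_norm (- x).
rewrite normrN in h2; rewrite /tr ler_norml.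
by case: (leP x M) => ?; case: (leP (- M) _) => ?; apply/andP; split; lra.
Qed.

Let mitv (a b : R) : (measurable : set (set (measurableTypeR R))) `[a, b]%classic.
Proof. exact: measurable_itv. Qed.

Let mtr f r M : measurable_fun `[0, r] f -> measurable_fun `[0, r] (fun x => tr M (f x)).
Proof.
move=> mf; apply: measurable_maxr; first exact: measurable_cst.
by apply: measurable_minr => //; exact: measurable_cst.
Qed.

Let leb_lty r : (leb `[0%R, r] < +oo)%E.
Proof. by rewrite lebesgue_measure_itv /=; case: ifP => _; rewrite -?EFinB ltry. Qed.

Lemma L2_truncation f r e : measurable_fun `[0, r] f ->
  (\int[leb]_(x in `[0%R, r]) ((f x) ^+ 2)%:E < +oo)%E -> 0 < e ->
  exists2 M, 0 < M & (\int[leb]_(x in `[0%R, r]) ((f x - tr M (f x)) ^+ 2)%:E <= e%:E)%E.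
Proof.
move=> mf f2 e0.
have mf2 : measurable_fun `[0, r] (fun x => ((f x) ^+ 2)%:E).
  by apply/measurable_EFinP; exact: measurable_funX.
have i2 : leb.-integrable `[0, r] (fun x => ((f x) ^+ 2)%:E).
  apply/integrableP; split => //.
  apply: le_lt_trans f2; apply: ge0_le_integral_sup => x _ //.
  by rewrite gee0_abs // lee_fin sqr_ge0.
have [] := @dominated_convergence _ _ _ leb `[0, r]%classic (mitv 0 r)
  (fun n x => ((f x - tr n%:R (f x)) ^+ 2)%:E) (cst 0%E) (fun x => ((f x) ^+ 2)%:E).
- move=> n; apply/measurable_EFinP; apply: measurable_funX; apply: measurable_funB => //.
  exact: mtr.
- exact: measurable_cst.
- apply: aeW => x _; apply: cvg_near_cst; exists (Num.bound `|f x|) => // n /= bn.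
  rewrite tr_id ?subrr ?expr0n //.
  by apply: le_trans (ltW (archi_boundP _)) _ => //; rewrite ler_nat.
- exact: i2.
- apply: aeW => x n _; rewrite /= lee_fin ger0_norm ?sqr_ge0 //.
  rewrite -(real_normK (num_real (_ - _))) -(real_normK (num_real (f x))).
  by rewrite lerXn2r ?nnegrE // tr_sub.
move=> _ _; rewrite integral0 => /= c0.
have : \forall n \near \oo,
  (\int[leb]_(x in `[0%R, r]) ((f x - tr n%:R (f x)) ^+ 2)%:E < e%:E)%E.
  have /fine_cvgP[fin /cvgrPdist_lt /(_ e e0) c] := c0.
  near=> n.
  have fn : (\int[leb]_(x in `[0%R, r]) ((f x - tr n%:R (f x)) ^+ 2)%:E)%E \is a fin_num.
    by near: n; exact: fin.
  rewrite -(fineK fn) lte_fin; apply: le_lt_trans (ler_norm _) _.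
  by rewrite -normrN -[- _]sub0r; near: n; exact: c.
(* The successor makes the truncation level strictly positive. *)
move=> [N _ hN]; exists N.+1%:R => //.
by apply: ltW; apply: hN => /=.
Unshelve. all: by end_near. Qed.

(** Density of continuous functions in L^1 is upgraded to L^2 by truncation at M: two functions
    bounded by M differ by at most 2M, so the square of their difference is at most 2M times its
    absolute value. Truncation is 1-Lipschitz, so truncating the continuous approximation as well
    keeps it continuous and does not increase the distance. *)
Lemma L2_continuous_approx f r e : measurable_fun `[0, r] f ->
  (\int[leb]_(x in `[0%R, r]) ((f x) ^+ 2)%:E < +oo)%E -> 0 < e ->
  exists (g : R -> R) (M : R), [/\ continuous g, forall x, `|g x| <= M &
    (\int[leb]_(x in `[0%R, r]) ((f x - g x) ^+ 2)%:E <= e%:E)%E].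
Proof.
move=> mf f2 e0.
have e4 : 0 < e / 4 by rewrite divr_gt0.
have [M M0 hM] := L2_truncation mf f2 e4.
have mfM := mtr M mf.
have iM : leb.-integrable `[0, r] (EFin \o (fun x => tr M (f x))).
  apply: measurable_bounded_integrable => //; first exact: leb_lty.
  exists M; split; first exact: num_real.
  by move=> K MK x _ /=; apply: le_trans (tr_bound _ (ltW M0)) (ltW MK).
have [g_ [cg ig lim]] := approximation_continuous_integrable (mitv 0 r) (leb_lty r) iM.
(* Chosen so that 4M times this is e / 2, the other half being twice the truncation error e / 4. *)
have dM : 0 < e / (8 * M) by rewrite divr_gt0 // mulr_gt0.
have [n hn] : exists n,
    (\int[leb]_(x in `[0%R, r]) `|(tr M (f x) - g_ n x)%:E| < (e / (8 * M))%:E)%E.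
  have /fine_cvgP[[N1 _ fin] /cvgrPdist_lt /(_ _ dM) [N2 _ c]] := lim.
  exists (maxn N1 N2); have := fin (maxn N1 N2); rewrite /= leq_maxl => /(_ isT) fn.
  rewrite -(fineK fn) lte_fin; apply: le_lt_trans (ler_norm _) _.
  rewrite -normrN -[- _]sub0r; apply: c; exact: leq_maxr.
exists (fun x => tr M (g_ n x)), M; split.
- move=> x; apply/cvgrPdist_le => d d0.
  have /cvgrPdist_le /(_ d d0) := cg n x; apply: filterS => u; apply: le_trans.
  exact: tr_lip (ltW M0).
- by move=> x; exact: tr_bound (ltW M0).
have mg : measurable_fun `[0, r] (g_ n).
  by apply: measurable_funTS; exact: continuous_measurable_fun.
have mtg := mtr M mg.
have m1 : measurable_fun `[0, r] (fun x => ((f x - tr M (f x)) ^+ 2)%:E).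
  by apply/measurable_EFinP; apply: measurable_funX; exact: measurable_funB.
have m2 : measurable_fun `[0, r] (fun x => `|(tr M (f x) - g_ n x)%:E|%E).
  apply/measurable_EFinP; apply: measurableT_comp => //; exact: measurable_funB.
apply: (@le_trans _ _ (\int[leb]_(x in `[0%R, r]) (2%:E * ((f x - tr M (f x)) ^+ 2)%:E +
    (4 * M)%:E * `|(tr M (f x) - g_ n x)%:E|))%E).
  apply: ge0_le_integral_sup => x _; first by rewrite lee_fin sqr_ge0.
  rewrite /= lee_fin; set a := f x - tr M (f x); set b := tr M (f x) - g_ n x.
  have -> : f x - tr M (g_ n x) = a + (tr M (f x) - tr M (g_ n x)) by rewrite /a; ring.
  set c := tr M (f x) - tr M (g_ n x).
  have c1 : `|c| <= `|b|.
    rewrite /c -[X in `|X - _|](@tr_id M); last exact: tr_bound (ltW M0).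
    exact: tr_lip (ltW M0).
  have c2 : `|c| <= 2 * M.
    apply: le_trans (ler_normB _ _) _.
    by rewrite mulr_natl mulr2n lerD // tr_bound // ltW.
  have c3 : c ^+ 2 <= 2 * M * `|b|.
    rewrite -(real_normK (num_real c)) expr2.
    by apply: ler_pM.
  by have := sqr_ge0 (a - c); nra.
rewrite ge0_integralD //; last 4 first.
- by move=> x _; rewrite mule_ge0 ?lee_fin ?sqr_ge0.
- exact: emeasurable_funM.
- by move=> x _; rewrite mule_ge0 // lee_fin mulr_ge0 // ltW.
- exact: emeasurable_funM.
rewrite ge0_integralZl_EFin //; last by move=> x _; rewrite lee_fin sqr_ge0.
rewrite ge0_integralZl_EFin //; last by rewrite mulr_ge0 // ltW.
have -> : e = 2 * (e / 4) + 4 * M * (e / (8 * M)) by field; rewrite gt_eqF.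
rewrite [leRHS]EFinD; apply: leeD; rewrite [leRHS]EFinM lee_wpmul2l ?lee_fin //.
  by rewrite mulr_ge0 // ltW.
exact: ltW.
Qed.

Definition grid r (N k : nat) : R := r * (k%:R / N%:R).

Definition grid_step (V : lmodType R) r N (c : nat -> V) u : V :=
  \sum_(k < N) (\1_(`]grid r N k, grid r N k.+1]) u : R) *: c k.

Lemma grid_ge0 r N k : 0 <= r -> 0 <= grid r N k.
Proof. by move=> r0; rewrite /grid mulr_ge0 // divr_ge0. Qed.

Lemma grid_le r N k l : 0 <= r -> (k <= l)%N -> grid r N k <= grid r N l.
Proof. by move=> r0 kl; rewrite ler_wpM2l // ler_wpM2r ?invr_ge0 // ler_nat. Qed.

Lemma grid_stepE (V : lmodType R) r N (c : nat -> V) u : 0 < u <= r -> (0 < N)%N ->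
  exists k, [/\ (k < N)%N, grid_step r N c u = c k & `|u - grid r N k| <= r / N%:R].
Proof.
move=> /andP[u0 ur] N0; have r0 : 0 <= r by exact: le_trans (ltW u0) ur.
have N0' : 0 < N%:R :> R by rewrite ltr0n.
have exm : exists m, u <= grid r N m.
  by exists N; rewrite /grid divff ?mulr1 // gt_eqF.
(* The first grid point at or after [u] is the right end of the cell containing [u]. *)
have := ex_minnP exm; case=> -[|k] hk mk.
  by move: hk; rewrite /grid mul0r mulr0 leNgt u0.
have kN : (k < N)%N.
  by apply: mk; rewrite /grid divff ?mulr1 // gt_eqF.
have ku : grid r N k < u.
  by rewrite ltNge; apply/negP => /mk; rewrite ltnn.
exists k; split => //.
  rewrite /grid_step (bigD1 (Ordinal kN)) //= big1 ?addr0; last first.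
    move=> l lk; rewrite indicE memNset ?scale0r //= in_itv /= => /andP[h1 h2].
    have [lk'|kl'|e] := ltngtP l k.
    - have := le_lt_trans (le_trans h2 (grid_le _ r0 lk')) ku.
      by rewrite ltxx.
    - have := le_lt_trans (le_trans hk (grid_le N r0 kl')) h1.
      by rewrite ltxx.
    - by move/eqP: lk; apply; apply: val_inj.
  by rewrite indicE mem_set ?scale1r //= in_itv /= ku.
rewrite ger0_norm ?subr_ge0 ?(ltW ku) // lerBlDl.
apply: le_trans hk _; rewrite /grid -natr1.
by rewrite mulrDl mulrDr mul1r.
Qed.

Lemma l2_step_approx (m n : nat) r (h : R -> 'M[R]_(m, n)) e : 0 <= r -> l2 r h -> 0 < e ->
  exists (N : nat) (c : nat -> 'M[R]_(m, n)), (0 < N)%N /\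
    (\int[leb]_(u in `[0%R, r]) (enorm (grid_step r N c u - h u) ^+ 2)%:E <= e%:E)%E.
Proof.
move=> r0 [mh h2] e0.
have mhij i j : measurable_fun `[0, r] (fun u => h u i j) by have /measurable_mxP := mh; apply.
(* The errors of the m n entries then add up to at most e / 4; the successor avoids a division by 0
   for an empty matrix. *)
pose e' := e / 4 / (m * n).+1%:R.
have e'0 : 0 < e' by rewrite !divr_gt0.
have app i j : exists gM : (R -> R) * R, [/\ continuous gM.1, forall x, `|gM.1 x| <= gM.2 &
    (\int[leb]_(x in `[0%R, r]) ((h x i j - gM.1 x) ^+ 2)%:E <= e'%:E)%E].
  have [g [M [h1 h3 h4]]] : exists (g : R -> R) (M : R), [/\ continuous g, forall x, `|g x| <= M &
      (\int[leb]_(x in `[0%R, r]) ((h x i j - g x) ^+ 2)%:E <= e'%:E)%E].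
    apply: L2_continuous_approx => //; apply: le_lt_trans h2.
    apply: ge0_le_integral_sup => x _; rewrite lee_fin ?sqr_ge0 //.
    rewrite -(real_normK (num_real (h x i j))) lerXn2r ?nnegrE ?enorm_ge0 //.
    exact: le_entry_enorm.
  by exists (g, M).
pose gM i j := projT1 (cid (app i j)); have hgM i j := projT2 (cid (app i j)).
pose g i j := (gM i j).1; pose M i j := (gM i j).2.
have cg i j : continuous (g i j) by have [] := hgM i j.
have gb i j x : `|g i j x| <= M i j by have [_ h' _] := hgM i j; exact: h'.
have gapp i j : (\int[leb]_(x in `[0%R, r]) ((h x i j - g i j x) ^+ 2)%:E <= e'%:E)%E.
  by have [] := hgM i j.
pose gm u : 'M[R]_(m, n) := \matrix_(i, j) g i j u.
have mgij i j : measurable_fun `[0, r] (g i j).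
  by apply: measurable_funTS; exact: continuous_measurable_fun.
pose c N k : 'M[R]_(m, n) := gm (grid r N k).
pose S N u := grid_step r N.+1 (c N.+1) u.
have mS N : measurable_fun setT (S N : R -> borel_mx R m n).
  apply/measurable_mxP => // i j.
  have -> : (fun u => S N u i j) = (fun u => \sum_(k < N.+1)
      (\1_(`]grid r N.+1 k, grid r N.+1 k.+1]) u : R) * c N.+1 k i j).
    by apply/funext => u; rewrite summxE; apply: eq_bigr => k _; rewrite mxE.
  by apply: measurable_sum => k; apply: measurable_funM => //; exact: measurable_indic.
have mgm : measurable_fun `[0, r] (gm : R -> borel_mx R m n).
  apply/measurable_mxP => // i j.
  by have -> : (fun u => gm u i j) = g i j by apply/funext => u; rewrite mxE.
have mSg N : measurable_fun `[0, r] (fun u => (enorm (S N u - gm u) ^+ 2)%:E).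
  apply/measurable_EFinP; apply: measurable_funX; apply: measurable_enorm => //.
  by apply: measurable_mxB => //; exact: measurable_funTS.
pose K : R := \sum_i \sum_j (2 * M i j) ^+ 2.
have K0 : 0 <= K by apply: sumr_ge0 => i _; apply: sumr_ge0 => j _; exact: sqr_ge0.
(* The left-open cells miss 0, so pointwise convergence holds on ]0, r]. The sampled and the
   continuous entries are both bounded by [M i j], whence the dominating constant [K]. *)
have lim : (\int[leb]_(u in `]0%R, r]) (enorm (S N u - gm u) ^+ 2)%:E)%E @[N --> \oo] --> 0%E.
  have mI : (measurable : set (set (measurableTypeR R))) `]0, r]%classic by exact: measurable_itv.
  have sub : `]0, r]%classic `<=` `[0, r]%classic by apply: subset_itvr; rewrite bnd_simp.
  have [] := @dominated_convergence _ _ _ leb `]0, r]%classic mI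
    (fun N u => (enorm (S N u - gm u) ^+ 2)%:E) (cst 0%E) (fun=> K%:E).
  - by move=> N; apply: measurable_funS (mSg N).
  - exact: measurable_cst.
  - apply: aeW => u /=; rewrite in_itv /= => u0r.
    apply: cvg_EFin; first exact: nearW.
    have -> : fine \o (fun N => (enorm (S N u - gm u) ^+ 2)%:E) =
        (fun N => \sum_i \sum_j ((S N u - gm u) i j) ^+ 2).
      by apply/funext => N /=; rewrite enorm_sqr.
    rewrite -[X in _ --> X](_ : \sum_(i < m) \sum_(j < n) (0 : R) = 0); last first.
      by rewrite big1 // => i _; rewrite big1.
    apply: cvg_big => [|i _]; first exact: add_continuous.
    apply: cvg_big => [|j _]; first exact: add_continuous.
    rewrite -[X in _ --> X](mulr0 0); under eq_fun do rewrite expr2.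
    have : (S N u - gm u) i j @[N --> \oo] --> (0 : R).
      apply/cvgrPdist_le => d d0.
      have /cvgrPdist_le /(_ d d0) /nbhs_ballP[dd /= dd0 hdd] := cg i j u.
      have : r / N.+1%:R @[N --> \oo] --> (0 : R).
        rewrite -[X in _ --> X](mulr0 r); apply: cvgMr; exact: cvg_harmonic.
      move=> /cvgrPdist_lt /(_ dd dd0); apply: filterS => N.
      rewrite sub0r normrN => hN.
      have [k [_ Sk uk]] := grid_stepE (c N.+1) u0r (ltn0Sn N).
      rewrite sub0r normrN /S Sk !mxE distrC; apply: hdd.
      by rewrite /ball /=; apply: le_lt_trans uk _; apply: le_lt_trans (ler_norm _) hN.
    by move=> h0; exact: (cvgM h0 h0).
  - apply/integrableP; split; first exact: measurable_cst.
    under eq_integral do rewrite /= ger0_norm //.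
    rewrite integral_cst // (_ : _ (`]0%R, r]%classic) = leb `]0, r]%classic) // lebesgue_measure_itv /=.
    by case: ifP => _; rewrite ?mule0 -?EFinM ?ltry.
  - apply: aeW => u N /=; rewrite in_itv /= => u0r.
    rewrite lee_fin ger0_norm ?sqr_ge0 // enorm_sqr.
    have [k [_ Sk _]] := grid_stepE (c N.+1) u0r (ltn0Sn N).
    apply: ler_sum => i _; apply: ler_sum => j _.
    rewrite /S Sk !mxE -(real_normK (num_real (_ - _))).
    rewrite lerXn2r ?nnegrE //; first by rewrite mulr_ge0 // (le_trans _ (gb i j 0)).
    by apply: le_trans (ler_normB _ _) _; rewrite mulr_natl mulr2n lerD.
  by move=> _ _; rewrite integral0.
have e40 : 0 < e / 4 by rewrite divr_gt0.
have [N hN] : exists N, (\int[leb]_(u in `]0%R, r]) (enorm (S N u - gm u) ^+ 2)%:E <= (e / 4)%:E)%E.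
  have /fine_cvgP[[N1 _ fin] /cvgrPdist_le /(_ _ e40) [N2 _ hc]] := lim.
  exists (maxn N1 N2); have := fin (maxn N1 N2); rewrite /= leq_maxl => /(_ isT) fn.
  rewrite -(fineK fn) lee_fin; apply: le_trans (ler_norm _) _.
  rewrite -normrN -[- _]sub0r; apply: hc; exact: leq_maxr.
exists N.+1, (c N.+1); split => //.
have mgh : measurable_fun `[0, r] (fun u => (enorm (gm u - h u) ^+ 2)%:E).
  apply/measurable_EFinP; apply: measurable_funX; apply: measurable_enorm => //.
  exact: measurable_mxB.
have mghij i j : measurable_fun `[0, r] (fun u => (gm u - h u) i j).
  have -> : (fun u => (gm u - h u) i j) = (fun u => g i j u - h u i j).
    by apply/funext => u; rewrite !mxE.
  exact: measurable_funB.
apply: (@le_trans _ _ (\int[leb]_(u in `[0%R, r]) (2%:E * (enorm (S N u - gm u) ^+ 2)%:E +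
    2%:E * (enorm (gm u - h u) ^+ 2)%:E))%E).
  apply: ge0_le_integral_sup => u _; first by rewrite lee_fin sqr_ge0.
  rewrite -!EFinM -EFinD lee_fin.
  rewrite [X in enorm X](_ : _ = (S N u - gm u) + (gm u - h u)); last first.
    by rewrite addrA subrK.
  exact: enormD_sqr.
rewrite ge0_integralD //; last 4 first.
- by move=> u _; rewrite mule_ge0 ?lee_fin ?sqr_ge0.
- by apply: emeasurable_funM => //; exact: mSg.
- by move=> u _; rewrite mule_ge0 ?lee_fin ?sqr_ge0.
- by apply: emeasurable_funM => //; exact: mgh.
rewrite !ge0_integralZl_EFin //; try by move=> u _; rewrite lee_fin sqr_ge0.
have -> : e = 2 * (e / 4) + 2 * (e / 4) by field.
rewrite [leRHS]EFinD; apply: leeD; rewrite [leRHS]EFinM; apply: lee_wpmul2l;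
  try by rewrite lee_fin.
  rewrite -integral_itv_obnd_cbnd; first exact: hN.
  apply: measurable_funS (mSg N) => //.
  by apply: subset_itvr; rewrite bnd_simp.
under eq_integral do rewrite enorm_sqr -sumEFin.
rewrite ge0_integral_sum //; last 2 first.
- move=> i; apply/measurable_EFinP; apply: measurable_sum => j; apply: measurable_funX.
  exact: mghij.
- by move=> i u _; rewrite lee_fin; apply: sumr_ge0 => j _; exact: sqr_ge0.
apply: (@le_trans _ _ (\sum_(i < m) \sum_(j < n) e'%:E)%E).
  apply: lee_sum => i _; under eq_integral do rewrite -sumEFin.
  rewrite ge0_integral_sum //; last 2 first.
  - move=> j; apply/measurable_EFinP; apply: measurable_funX.
    exact: mghij.
  - by move=> j u _; rewrite lee_fin sqr_ge0.
  apply: lee_sum => j _; apply: le_trans (gapp i j).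
  by rewrite le_eqVlt; apply/orP; left; apply/eqP; apply: eq_integral => u _; rewrite !mxE -sqrrN opprB.
under eq_bigr do rewrite sumEFin sumr_const card_ord.
rewrite sumEFin sumr_const card_ord lee_fin -mulrnA /e'.
rewrite -[_ *+ _]mulr_natr mulrAC ler_pdivrMr ?ltr0Sn // ler_pM2l ?ler_nat 1?mulnC //.
exact: mSg.
Qed.

End StepApproximation.

(** * The integral of a deterministic function *)

(** The Gram matrix [m] of the indicators is a parameter, to be matched with the covariance matrix
    of Brownian motion. *)
Lemma integral_sqr_indic_sum d (T : measurableType d) (R : realType)
  (mu : {measure set T -> \bar R}) (D : set T) (K : finType) (A : K -> set T)
  (c : K -> R) (m : K -> K -> R) : measurable D -> (forall k, measurable (A k)) ->
  (forall k, A k `<=` D) -> (forall k l, mu (A k `&` A l) = (m k l)%:E) ->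
  (\int[mu]_(u in D) ((\sum_k (\1_(A k) u : R) * c k) ^+ 2)%:E =
   (\sum_k \sum_l c k * c l * m k l)%:E)%E.
Proof.
move=> mD mA sub mE.
have mAA k l : measurable (A k `&` A l) by exact: measurableI.
have ii k l : mu.-integrable D (fun u => ((c k * c l)%:E * (\1_(A k `&` A l) u)%:E)%E).
  apply: integrableZl => //; apply/integrableP; split.
    by apply/measurable_EFinP; exact: measurable_indic.
  under eq_integral do rewrite /= ger0_norm //.
  rewrite integral_indic //; apply: le_lt_trans (ltry (m k l)).
  rewrite -mE; apply: le_measure; rewrite ?inE //; first exact: measurableI.
transitivity (\int[mu]_(u in D) \sum_k \sum_l ((c k * c l)%:E * (\1_(A k `&` A l) u)%:E))%E.
  apply: eq_integral => u _; rewrite expr2 mulr_suml -sumEFin.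
  apply: eq_bigr => k _; rewrite mulr_sumr -sumEFin.
  by apply: eq_bigr => l _; rewrite indicI -EFinM /=; congr EFin; ring.
rewrite integral_sum //; last by move=> k; apply: integrable_sum => // l _; exact: ii.
rewrite -sumEFin; apply: eq_bigr => k _.
rewrite integral_sum // -sumEFin; apply: eq_bigr => l _.
rewrite integralZl //; last first.
  apply/integrableP; split.
    by apply/measurable_EFinP; exact: measurable_indic.
  under eq_integral do rewrite /= ger0_norm //.
  rewrite integral_indic //; apply: le_lt_trans (ltry (m k l)).
  rewrite -mE; apply: le_measure; rewrite ?inE //; first exact: measurableI.
rewrite integral_indic // [RHS]EFinM; congr (_ * _)%E.
rewrite (_ : _ `&` D = A k `&` A l) ?mE //.
by apply/setIidl => x [Ax _]; exact: (sub k).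
Qed.

Lemma within_continuous_comp_in {R : realType} (A D : set R) (U : topologicalType)
  (f : R -> U) (g : R -> R) : continuous g -> (forall x, A x -> D (g x)) ->
  {within D, continuous f} -> {within A, continuous (fun x => f (g x))}.
Proof.
move=> cg gAD /subspace_continuousP cf; apply/subspace_continuousP => x Ax W.
move=> /(cf _ (gAD _ Ax)) h.
have h2 : nbhs (g x) [set y | D y -> W (f y)] by exact: h.
have h3 : nbhs x [set s | A s -> W (f (g s))].
  have h4 : \forall s \near x, D (g s) -> W (f (g s)) := cg x _ h2.
  by apply: (filterS _ h4) => s hs As; exact: hs (gAD _ As).
exact: h3.
Qed.

Section WienerSums.
Context {R : realType} {dd : measure_display} {Omega : measurableType dd}.
Variables (P : probability Omega R) (d n : nat) (B : R -> Omega -> 'cV[R]_d).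
Hypothesis P_complete : measure_is_complete P.
Hypothesis BM : brownian_motion P B.
Variable r : R.
Hypothesis r0 : 0 <= r.
Notation leb := (@lebesgue_measure R).

(** X is the integral of the step function f. All intervals start at 0 and may overlap, so
    differences are formed without a common refinement of two partitions. *)
Definition wiener_sum (X : R -> Omega -> 'cV[R]_n) (f : R -> 'M[R]_(n, d)) :=
  exists (K : finType) (c : K -> 'M[R]_(n, d)) (b : K -> R),
    [/\ forall k, 0 <= b k <= r,
        forall s w, X s w = \sum_k c k *m (B (Num.min (b k) s) w - B 0 w) &
        forall u, f u = \sum_k (\1_(`]0, b k]) u : R) *: c k].

Lemma wiener_sumB X1 f1 X2 f2 : wiener_sum X1 f1 -> wiener_sum X2 f2 ->
  wiener_sum (fun s w => X1 s w - X2 s w) (fun u => f1 u - f2 u).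
Proof.
move=> [K1 [c1 [b1 [h1 e1 g1]]]] [K2 [c2 [b2 [h2 e2 g2]]]].
exists (K1 + K2)%type, (fun k => match k with inl k => c1 k | inr k => - c2 k end),
  (fun k => match k with inl k => b1 k | inr k => b2 k end); split.
- by case.
- move=> s w; rewrite big_sumType /= e1 e2 -sumrN; congr (_ + _).
  by apply: eq_bigr => k _; rewrite mulNmx.
- move=> u; rewrite big_sumType /= g1 g2 -sumrN; congr (_ + _).
  by apply: eq_bigr => k _; rewrite scalerN.
Qed.

Let entryE (K : finType) (c : K -> 'M[R]_(n, d)) (b : K -> R) i s w :
  (\sum_k c k *m (B (Num.min (b k) s) w - B 0 w)) i 0 =
  \sum_k \sum_j c k i j * incr B 0 (Num.min (b k) s) j w.
Proof. by rewrite summxE; apply: eq_bigr => k _; rewrite mxE. Qed.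

Lemma wiener_sum_mart X f i : wiener_sum X f -> mart P B (fun s w => X s w i 0).
Proof.
move=> [K [c [b [hb e _]]]].
have -> : (fun s w => X s w i 0) =
    (fun s w => \sum_k \sum_j c k i j * incr B 0 (Num.min (b k) s) j w).
  by apply/funext => s; apply/funext => w; rewrite e entryE.
apply: mart_sum => // k; apply: mart_sum => // j; apply: martZ => //.
by apply: mart_incr => //; have /andP[] := hb k.
Qed.

Let ip_incr0 a b i j : 0 <= a -> 0 <= b ->
  ip P (incr B 0 a i) (incr B 0 b j) = (i == j)%:R * Num.min a b.
Proof.
wlog ab : a b i j / a <= b => [H a0 b0|a0 b0].
  case: (leP a b) => ab; first by rewrite H // (min_idPl ab).
  by rewrite ipC H ?(ltW ab) // eq_sym (min_idPl (ltW ab)).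
have s0a : sqint P (incr B 0 a i) by apply: sqint_incr => //; rewrite lexx.
have -> : incr B 0 b j = (fun w => incr B 0 a j w + incr B a b j w).
  by apply/funext => w; rewrite /incr !mxE; ring.
rewrite ipDr //; last 2 first.
- by apply: sqint_incr => //; rewrite lexx.
- by apply: sqint_incr => //; rewrite a0.
rewrite ip_incr ?lexx //= (@ip_past_incr _ _ _ P d B) ?a0 ?(min_idPl ab) ?subr0 ?addr0 //.
by apply: incr_Fmeas; rewrite ?lexx ?a0.
Qed.

(** Both sides are the same quadratic form in the coefficients: min(b_k, b_l) is the covariance of
    Brownian motion at times b_k and b_l, and the length of ]0, b_k] intersected with ]0, b_l]. *)
Lemma wiener_sum_isometry X f : wiener_sum X f ->
  (\int[leb]_(u in `[0%R, r]) (enorm (f u) ^+ 2)%:E =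
   (\sum_i ip P (fun w => X r w i 0) (fun w => X r w i 0))%:E)%E.
Proof.
move=> [K [c [b [hb e g]]]].
have b0 k : 0 <= b k by have /andP[] := hb k.
have br k : b k <= r by have /andP[] := hb k.
have sc k i j : sqint P (fun w => c k i j * incr B 0 (b k) j w).
  by apply: sqintZ; apply: sqint_incr => //; rewrite lexx b0.
have ipE i : ip P (fun w => X r w i 0) (fun w => X r w i 0) =
    \sum_j \sum_k \sum_l c k i j * c l i j * Num.min (b k) (b l).
  have -> : (fun w => X r w i 0) =
      (fun w => \sum_k \sum_j c k i j * incr B 0 (b k) j w).
    apply/funext => w; rewrite e entryE; apply: eq_bigr => k _.
    by rewrite (min_idPl (br k)).
  have ss : sqint P (fun w => \sum_k \sum_j c k i j * incr B 0 (b k) j w).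
    by apply: sqint_sum => k _; apply: sqint_sum.
  rewrite exchange_big /= ip_suml //; last by move=> k _; apply: sqint_sum.
  apply: eq_bigr => k _.
  rewrite ip_suml //; apply: eq_bigr => j _.
  rewrite ip_sumr //; last by move=> l _; apply: sqint_sum.
  apply: eq_bigr => l _.
  have si a j' : 0 <= a -> sqint P (incr B 0 a j').
    by move=> a0; apply: sqint_incr => //; rewrite lexx.
  rewrite ip_sumr // (bigD1 j) //= big1 ?addr0 => [|j' jj'].
    by rewrite ipZl ?ipZr ?ip_incr0 ?eqxx ?mul1r ?mulrA //; apply: si.
  rewrite ipZl ?ipZr ?ip_incr0 // ?(eq_sym j) ?(negbTE jj') ?mul0r ?mulr0 //; exact: si.
under eq_bigr do rewrite ipE.
under eq_integral => u _.
  rewrite enorm_sqr -sumEFin; under eq_bigr => i _.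
    rewrite -sumEFin; under eq_bigr => j _.
      rewrite g summxE; under eq_bigr do rewrite mxE.
      over.
    over.
  over.
have mI a b' : (measurable : set (set (measurableTypeR R))) `]a, b']%classic.
  exact: measurable_itv.
have mJ a b' : (measurable : set (set (measurableTypeR R))) `[a, b']%classic.
  exact: measurable_itv.
have ms i j : measurable_fun `[0, r]
    (fun u => ((\sum_k (\1_(`]0, b k]) u : R) * c k i j) ^+ 2)%:E).
  apply/measurable_EFinP; apply: measurable_funX; apply: measurable_sum => k.
  by apply: measurable_funM => //; apply: measurable_indic; exact: mI.
rewrite ge0_integral_sum //=; last 2 first.
- by move=> i; apply: emeasurable_sum => j; exact: ms.
- by move=> i u _; apply: sume_ge0 => j _; rewrite lee_fin sqr_ge0.
rewrite -sumEFin; apply: eq_bigr => i _.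
rewrite ge0_integral_sum //=; last 2 first.
- by move=> j; exact: ms.
- by move=> j u _; rewrite lee_fin sqr_ge0.
rewrite -sumEFin; apply: eq_bigr => j _.
rewrite (@integral_sqr_indic_sum _ _ _ leb `[0%R, r]%classic K
  (fun k => `]0%R, b k]%classic) (fun k => c k i j) (fun k l => Num.min (b k) (b l))) //.
- by move=> k u /=; rewrite !in_itv /= => /andP[/ltW -> /le_trans]; apply.
- move=> k l.
  have -> : `]0, b k]%classic `&` `]0, b l]%classic = `]0, Num.min (b k) (b l)]%classic.
    apply/seteqP; split=> u /=; rewrite !in_itv /= le_min.
      by move=> [/andP[-> ->] /andP[_ ->]].
    by move=> /andP[-> /andP[-> ->]].
  have lebE x : 0 <= x -> leb `]0, x]%classic = x%:E.
    move=> x0; rewrite lebesgue_measure_itv /= lte_fin; case: ltP => h.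
      by rewrite oppr0 adde0.
    by congr EFin; apply/eqP; rewrite eq_le h x0.
  by apply: lebE; rewrite le_min !b0.
Qed.

Lemma wiener_sum_continuous X f : wiener_sum X f ->
  {ae P, forall w, forall i, {within `[0, r], continuous (fun s => X s w i 0)}}.
Proof.
move=> [K [c [b [hb e _]]]].
case: BM => _ _ cB _ _; move: cB; apply: filterS => w cw i.
have -> : (fun s => X s w i 0) =
    (fun s => \sum_k \sum_j c k i j * incr B 0 (Num.min (b k) s) j w).
  by apply/funext => s; rewrite e entryE.
have cmin (a : R) : continuous (Num.min a).
  move=> x; have -> : Num.min a = (fun s => (a + s - `|a - s|) / 2).
    by apply/funext => s; rewrite minr_absE distrC.
  apply: cvgMl; apply: cvgB; first by apply: cvgD; [exact: cvg_cst|exact: cvg_id].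
  by apply: cvg_norm; apply: cvgB; [exact: cvg_cst|exact: cvg_id].
have cin k j : {within `[0, r], continuous (fun s => incr B 0 (Num.min (b k) s) j w)}.
  have ce : {within `[0, +oo[, continuous (fun s => B s w j 0)}.
    exact: within_continuous_entry.
  have cc : {within `[0, r], continuous (fun s => B (Num.min (b k) s) w j 0)}.
    apply: (within_continuous_comp_in (cmin (b k)) _ ce) => s /=.
    by rewrite !in_itv /= andbT le_min => /andP[-> _]; rewrite andbT; have /andP[] := hb k.
  have -> : (fun s => incr B 0 (Num.min (b k) s) j w) =
      (fun s => B (Num.min (b k) s) w j 0 - B 0 w j 0).
    by apply/funext => s; rewrite /incr !mxE.
  by move=> x; apply: cvgB; [exact: cc|exact: cvg_cst].
move=> x; apply: cvg_big => [|k _]; first exact: add_continuous.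
apply: cvg_big => [|j _]; first exact: add_continuous.
by apply: cvgMr; exact: cin.
Qed.

(** Each cell is the difference of two intervals starting at 0; the boolean selects the endpoint and
    the sign. *)
Lemma wiener_sum_grid (N : nat) (c : nat -> 'M[R]_(n, d)) X : (0 < N)%N ->
  (forall s w, X s w = \sum_(k < N) c k *m
    (B (Num.min (grid r N k.+1) s) w - B (Num.min (grid r N k) s) w)) ->
  wiener_sum X (grid_step r N c).
Proof.
move=> N0 e.
exists ('I_N * bool)%type, (fun p : 'I_N * bool => if p.2 then c p.1 else - c p.1),
  (fun p : 'I_N * bool => if p.2 then grid r N p.1.+1 else grid r N p.1); split.
- have gr k : (k <= N)%N -> 0 <= grid r N k <= r.
    move=> kN; rewrite grid_ge0 //=; apply: le_trans (grid_le N r0 kN) _.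
    by rewrite /grid divff ?mulr1 // pnatr_eq0 -lt0n.
  by move=> [k []] /=; apply: gr => //; exact: ltnW.
- move=> s w; rewrite e -(pair_bigA _ (fun (k : 'I_N) (t : bool) =>
    (if t then c k else - c k) *m
    (B (Num.min (if t then grid r N k.+1 else grid r N k) s) w - B 0 w))) /=.
  apply: eq_bigr => k _; rewrite big_bool /= mulNmx -mulmxBr; congr (_ *m _).
  by rewrite opprB addrA subrK.
- move=> u; rewrite -(pair_bigA _ (fun (k : 'I_N) (t : bool) =>
    (\1_(`]0, if t then grid r N k.+1 else grid r N k]) u : R) *:
    (if t then c k else - c k))) /=.
  apply: eq_bigr => k _; rewrite big_bool /= scalerN -scalerBl; congr (_ *: _).
  have g0 := @grid_ge0 R r N k r0; have gS := grid_le N r0 (leqnSn k).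
  rewrite !indicE !mem_setE !in_itv /=.
  case: (ltP 0 u) => u0; case: (leP u (grid r N k)) => uk;
    case: (leP u (grid r N k.+1)) => uk1 //=; rewrite ?subrr ?subr0 //; lra.
Qed.

End WienerSums.

(** * Geometric and uniform limits, Borel-Cantelli *)

Section Limits.
Context {R : realType}.

Lemma geometric_cvg_from (u : nat -> R) K :
  (forall k, (K <= k)%N -> `|u k.+1 - u k| <= (2 ^+ k)^-1) ->
  cvgn u /\ forall k, (K <= k)%N -> `|limn u - u k| <= 2 / 2 ^+ k.
Proof.
move=> h; have [k|] := @geometric_cvg R (fun k => u (k + K)%N) ((2 ^+ K)^-1).
  by rewrite addSn -invfM -exprD addnC; apply: h; exact: leq_addr.
move=> c b; have cu : u @ \oo --> limn (fun k => u (k + K)%N).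
  by rewrite -(@cvg_shiftn K _ u).
split; first by apply/cvg_ex; eexists; exact: cu.
move=> k Kk; rewrite (cvg_lim _ cu) //.
have := b (k - K)%N; rewrite subnK // => /le_trans; apply.
by rewrite -mulrA -invfM -exprD subnKC.
Qed.

Lemma within_continuous_uniform_limit (A : set R) (F : R -> R) (f : nat -> R -> R) :
  (forall k, {within A, continuous (f k)}) ->
  (forall e, 0 < e -> exists k, forall s, A s -> `|F s - f k s| <= e) ->
  {within A, continuous F}.
Proof.
move=> cf unif; apply/subspace_continuousP => x Ax.
apply/cvgrPdist_le => e e0; have e3 : 0 < e / 3 by rewrite divr_gt0.
have [k hk] := unif _ e3.
have /subspace_continuousP /(_ x Ax) /cvgrPdist_le /(_ _ e3) h := cf k.
have h2 : nbhs x [set s | A s -> `|f k x - f k s| <= e / 3] by exact: h.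
have h3 : nbhs x [set s | A s -> `|F x - F s| <= e].
  apply: (filterS _ h2) => s hs As.
  have -> : F x - F s = (F x - f k x) + (f k x - f k s) + (f k s - F s) by ring.
  have -> : e = e / 3 + e / 3 + e / 3 by field.
  apply: le_trans (ler_normD _ _) _; apply: lerD; last by rewrite distrC; exact: hk.
  by apply: le_trans (ler_normD _ _) _; apply: lerD; [exact: hk|exact: hs].
exact: h3.
Qed.

Lemma limn_einf_le (u : (\bar R)^nat) k (C : \bar R) :
  (forall l, (k <= l)%N -> u l <= C)%E -> (limn_einf u <= C)%E.
Proof.
move=> h; rewrite limn_einf_lim; apply: lime_le; first exact: is_cvg_einfs.
apply: nearW => l; apply: le_trans (h (maxn k l) (leq_maxl _ _)).
by apply: ereal_inf_lbound; exists (maxn k l) => //=; exact: leq_maxr.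
Qed.

End Limits.

Lemma borel_cantelli_eventually d (T : measurableType d) (R : realType)
  (P : probability T R) (A : nat -> set T) : (forall k, measurable (A k)) ->
  (forall k, P (A k) <= ((2 ^+ k)^-1)%:E)%E ->
  {ae P, forall w, exists K, forall k, (K <= k)%N -> ~ A k w}.
Proof.
move=> mA PA.
have : P (lim_sup_set A) = 0%E.
  apply: lim_sup_set_cvg0 => //.
  apply: (@le_lt_trans _ _ (2 : R)%:E); last exact: ltry.
  have h : (\big[+%E/0%E]_(0 <= k <oo) (2 / (2 ^ (k + 1))%:R : R)%:E = (2 : R)%:E)%E.
    have := @cvg_geometric_eseries_half R 2 0; rewrite expr0 divr1.
    by move=> /cvg_lim <-.
  rewrite -h; apply: lee_nneseries => [//|k _].
  apply: le_trans (PA k) _; rewrite lee_fin addn1 natrX exprS invfM mulrA divff ?mul1r //.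
move=> h0; have : P.-negligible (lim_sup_set A).
  apply/negligibleP => //; apply: bigcapT_measurable => k.
  exact: bigcup_measurable.
apply: negligibleS => w /= hw k _ /=; apply: contrapT => h; apply: hw.
by exists k => l kl Al; apply: h; exists l.
Qed.

(** * Construction of the integral of [h] *)

Section WienerIntegral.
Context {R : realType} {dd : measure_display} {Omega : measurableType dd}.
Variables (P : probability Omega R) (d n : nat) (B : R -> Omega -> 'cV[R]_d).
Hypothesis P_complete : measure_is_complete P.
Hypothesis BM : brownian_motion P B.
Variables (r : R) (h : R -> 'M[R]_(n, d)).
Hypothesis r0 : 0 <= r.
Hypothesis hl2 : l2 r h.
Notation leb := (@lebesgue_measure R).

Let mitv (a b : R) : (measurable : set (set (measurableTypeR R))) `[a, b]%classic.
Proof. exact: measurable_itv. Qed.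

Lemma deterministic_progressive : progressive P B r (fun s _ => h s).
Proof.
move=> s /andP[s0 sr]; have [mh _] := hl2.
have mD : measurable (`[0, s]%classic `*` setT : set (R * augmented_past P B s)).
  by apply: measurableX => //; exact: mitv.
apply/measurable_mxP => // i j.
have mh' : measurable_fun `[0, r] (fun u => h u i j) by have /measurable_mxP := mh; apply.
apply: (@measurable_comp _ _ _ _ _ _ (`[0, r]%classic) (fun u => h u i j) _ fst) => //.
- move=> _ [[u w] [/= + _] <-] /=; rewrite !in_itv /= => /andP[-> us] /=.
  exact: le_trans us sr.
- exact: measurable_funTS measurable_fst.
Qed.

Lemma deterministic_square_integrable : square_integrable P r (fun s _ => h s).
Proof.
by rewrite /square_integrable integral_cst //= probability_setT mule1; case: hl2.
Qed.

(** [sp_coef_bounded] asks for one bound over all indices, including those past the last cell, where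
    the coefficient is set to 0. *)
Definition grid_coef N (c : nat -> 'M[R]_(n, d)) k : 'M[R]_(n, d) :=
  if (k < N)%N then c k else 0.

Lemma grid_process_mono N k : 0 <= grid r N k <= grid r N k.+1.
Proof. by rewrite grid_ge0 // grid_le. Qed.

Lemma grid_coef_adapted N c k : measurable_fun setT
  ((fun=> grid_coef N c k) : augmented_past P B (grid r N k) -> borel_mx R n d).
Proof. exact: measurable_cst. Qed.

Lemma grid_coef_bounded N c :
  exists K, forall k (w : Omega), enorm (grid_coef N c k) <= K.
Proof.
exists (\sum_(k < N) enorm (c k)) => k _; rewrite /grid_coef.
case: ltnP => kN; last by rewrite enorm0; apply: sumr_ge0 => i _; exact: enorm_ge0.
rewrite (bigD1 (Ordinal kN)) //= lerDl; apply: sumr_ge0 => i _; exact: enorm_ge0.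
Qed.

Definition grid_process N c : simple_process P B n :=
  @SimpleProcess _ _ _ P d B n N (grid r N) (fun k _ => grid_coef N c k)
    (@grid_process_mono N) (@grid_coef_adapted N c) (@grid_coef_bounded N c).

Lemma grid_process_eval N c u w : sp_eval (grid_process N c) u w = grid_step r N c u.
Proof. by apply: eq_bigr => k _ /=; rewrite /grid_coef ltn_ord. Qed.

Lemma grid_process_wiener N c : (0 < N)%N ->
  wiener_sum B r (sp_integral (grid_process N c)) (grid_step r N c).
Proof.
move=> N0; apply: wiener_sum_grid => // s w.
by apply: eq_bigr => k _ /=; rewrite /grid_coef ltn_ord.
Qed.

Lemma measurable_grid_step N c (D : set R) : measurable D ->
  measurable_fun (D : set (measurableTypeR R)) (grid_step r N c : R -> borel_mx R n d).
Proof.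
move=> mD; apply/measurable_mxP => // i j.
have -> : (fun u => (grid_step r N c u : 'M[R]_(n, d)) i j) =
    (fun u => \sum_(k < N) (\1_(`]grid r N k, grid r N k.+1]) u : R) * c k i j).
  by apply/funext => u; rewrite summxE; apply: eq_bigr => k _; rewrite mxE.
by apply: measurable_sum => k; apply: measurable_funM.
Qed.

(* With this rate successive approximations differ in square mean by at most
   8^-k, so by Kolmogorov's inequality they differ by more than 2^-k somewhere on
   [0, r] with probability at most 2^-k, which is summable. *)
Let eps (k : nat) : R := (8 ^+ k)^-1 / 4.

Let eps_gt0 k : 0 < eps k.
Proof. by rewrite divr_gt0 // invr_gt0 exprn_gt0. Qed.

Let approx : exists (N : nat -> nat) (c : nat -> nat -> 'M[R]_(n, d)), forall k,
  (0 < N k)%N /\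
  (\int[leb]_(u in `[0%R, r]) (enorm (grid_step r (N k) (c k) u - h u) ^+ 2)%:E
   <= (eps k)%:E)%E.
Proof.
have ex k := cid (l2_step_approx r0 hl2 (eps_gt0 k)).
have ex2 k := cid (projT2 (ex k)).
by exists (fun k => projT1 (ex k)), (fun k => projT1 (ex2 k)) => k; exact: projT2 (ex2 k).
Qed.

(** The mean square of the martingale X1 - X2 is nondecreasing in time, and at time [r] the isometry
    identifies it with the squared L^2 distance of f1 and f2, which is compared with [h]. *)
Let wiener_sum_dist_le X1 f1 X2 f2 (e1 e2 : R) s :
  wiener_sum B r X1 f1 -> wiener_sum B r X2 f2 ->
  measurable_fun `[0, r] (f1 : R -> borel_mx R n d) ->
  measurable_fun `[0, r] (f2 : R -> borel_mx R n d) ->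
  (\int[leb]_(u in `[0%R, r]) (enorm (f1 u - h u) ^+ 2)%:E <= e1%:E)%E ->
  (\int[leb]_(u in `[0%R, r]) (enorm (f2 u - h u) ^+ 2)%:E <= e2%:E)%E ->
  0 <= s <= r ->
  \sum_i ip P (fun w => (X1 s w - X2 s w) i 0) (fun w => (X1 s w - X2 s w) i 0)
  <= 2 * e1 + 2 * e2.
Proof.
move=> W1 W2 m1 m2 h1 h2 /andP[s0 sr].
have W := wiener_sumB W1 W2.
have ms f : measurable_fun `[0, r] (f : R -> borel_mx R n d) ->
    measurable_fun `[0, r] (fun u => (enorm (f u - h u) ^+ 2)%:E).
  move=> mf; apply/measurable_EFinP; apply: measurable_funX.
  apply: measurable_enorm; first exact: mitv.
  by apply: measurable_mxB => //; case: hl2.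
apply: (@le_trans _ _ (\sum_i ip P (fun w => (X1 r w - X2 r w) i 0)
    (fun w => (X1 r w - X2 r w) i 0))).
  apply: ler_sum => i _.
  have mi := wiener_sum_mart P_complete BM i W.
  have := mart_sq_le P_complete BM mi (_ : 0 <= s <= r) measurableT.
  rewrite s0 => /(_ sr); rewrite /ip.
  by under eq_Rintegral do rewrite indicT mul1r;
    under [X in _ <= X -> _]eq_Rintegral do rewrite indicT mul1r.
rewrite -lee_fin -(wiener_sum_isometry P_complete BM W).
apply: (@le_trans _ _ (\int[leb]_(u in `[0%R, r]) (2%:E * (enorm (f1 u - h u) ^+ 2)%:E +
    2%:E * (enorm (f2 u - h u) ^+ 2)%:E))%E).
  apply: ge0_le_integral_sup => u _; first by rewrite lee_fin sqr_ge0.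
  rewrite -!EFinM -EFinD lee_fin.
  have -> : f1 u - f2 u = (f1 u - h u) - (f2 u - h u) by rewrite opprB addrA subrK.
  by apply: le_trans (enormD_sqr _ _) _; rewrite enormN.
rewrite ge0_integralD //; last 4 first.
- by move=> u _; rewrite mule_ge0 ?lee_fin ?sqr_ge0.
- by apply: emeasurable_funM => //; exact: ms.
- by move=> u _; rewrite mule_ge0 ?lee_fin ?sqr_ge0.
- by apply: emeasurable_funM => //; exact: ms.
rewrite !ge0_integralZl_EFin //; try exact: mitv; try exact: ms;
  try by move=> u _; rewrite lee_fin sqr_ge0.
by rewrite [leRHS]EFinD; apply: leeD; rewrite [leRHS]EFinM; apply: lee_wpmul2l; rewrite ?lee_fin.
Qed.

Section Construction.
Variables (N : nat -> nat) (c : nat -> nat -> 'M[R]_(n, d)).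
Hypothesis Nc : forall k, (0 < N k)%N /\
  (\int[leb]_(u in `[0%R, r]) (enorm (grid_step r (N k) (c k) u - h u) ^+ 2)%:E
   <= (eps k)%:E)%E.

Let S k := grid_process (N k) (c k).
Let M k := sp_integral (S k).

Let MW k : wiener_sum B r (M k) (grid_step r (N k) (c k)).
Proof. by apply: grid_process_wiener; case: (Nc k). Qed.

Let dist_le k l s : 0 <= s <= r ->
  \sum_i ip P (fun w => (M k s w - M l s w) i 0) (fun w => (M k s w - M l s w) i 0)
  <= 2 * eps k + 2 * eps l.
Proof.
move=> sr; apply: (wiener_sum_dist_le (MW k) (MW l)) => //.
- by apply: measurable_grid_step; exact: mitv.
- by apply: measurable_grid_step; exact: mitv.
- by case: (Nc k).
- by case: (Nc l).
Qed.

Let eps_le k l : (k <= l)%N -> eps l <= eps k.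
Proof.
move=> kl; rewrite ler_pM2r ?invr_gt0 // lef_pV2 ?posrE ?exprn_gt0 //.
by rewrite ler_weXn2l // ler1n.
Qed.

Let M_continuous k : {ae P, forall w, forall i, {within `[0, r], continuous (fun s => M k s w i 0)}}.
Proof. exact: wiener_sum_continuous (MW k). Qed.

Let increments_summable i : {ae P, forall w, exists K, forall k, (K <= k)%N ->
  forall s, 0 <= s <= r -> `|M k.+1 s w i 0 - M k s w i 0| <= (2 ^+ k)^-1}.
Proof.
have bad k : exists A : set Omega, [/\ measurable A, (P A <= ((2 ^+ k)^-1)%:E)%E &
    {ae P, forall w, ~ A w -> forall s, 0 <= s <= r ->
      `|M k.+1 s w i 0 - M k s w i 0| <= (2 ^+ k)^-1}].
  have W := wiener_sumB (MW k.+1) (MW k).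
  have l0 : 0 < (2 ^+ k)^-1 :> R by rewrite invr_gt0 exprn_gt0.
  have [|A [mA PA hA]] := sup_ineq P_complete BM (wiener_sum_mart P_complete BM i W) l0 r0.
    by have := wiener_sum_continuous BM W; apply: filterS => w; apply.
  exists A; split=> //; last first.
    by move: hA; apply: filterS => w hw Aw s sr; have := hw Aw s sr; rewrite !mxE.
  apply: le_trans PA _; rewrite lee_fin ler_pdivrMr ?exprn_gt0 //.
  have rr : 0 <= r <= r by rewrite r0 lexx.
  have := dist_le k.+1 k rr; rewrite (bigD1 i) //= => le1.
  (* The factor 1/4 in [eps] absorbs the 2 + 2 of [dist_le]. *)
  have : 2 * eps k.+1 + 2 * eps k <= (8 ^+ k)^-1.
    by have := eps_le (leqnSn k); have : eps k = (8 ^+ k)^-1 / 4 by []; lra.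
  have -> : (8 ^+ k)^-1 = (2 ^+ k)^-1 * (2 ^+ k)^-1 ^+ 2 :> R.
    have -> : 8 = 2 * (2 * 2) :> R by ring.
    by rewrite !exprMn !invfM expr2.
  move=> le2; apply: le_trans (le_trans le1 le2).
  by rewrite lerDl; apply: sumr_ge0 => j _; exact: ip_ge0.
have ex k := cid (bad k).
have bc : {ae P, forall w, exists K, forall k, (K <= k)%N -> ~ projT1 (ex k) w}.
  by apply: borel_cantelli_eventually => k; have [] := projT2 (ex k).
have hA : {ae P, forall w, forall k, ~ projT1 (ex k) w ->
    forall s, 0 <= s <= r -> `|M k.+1 s w i 0 - M k s w i 0| <= (2 ^+ k)^-1}.
  by apply: ae_foralln => k; have [] := projT2 (ex k).
move: bc hA; apply: filterS2 => w [K hK] hw; exists K => k Kk; apply: hw; exact: hK.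
Qed.

(** Membership depends on the paths up to time [r], but the complement is null, so [good] lies in
    every augmented F_s. Setting the integral to 0 off [good] therefore keeps it adapted and makes
    all its paths continuous. *)
Let good : set Omega := [set w |
  (forall i, exists K, forall k, (K <= k)%N -> forall s, 0 <= s <= r ->
     `|M k.+1 s w i 0 - M k s w i 0| <= (2 ^+ k)^-1) /\
  forall k i, {within `[0, r], continuous (fun s => M k s w i 0)}].

Let good_ae : {ae P, forall w, good w}.
Proof.
have h1 : {ae P, forall w, forall i, exists K, forall k, (K <= k)%N ->
    forall s, 0 <= s <= r -> `|M k.+1 s w i 0 - M k s w i 0| <= (2 ^+ k)^-1}.
  by apply: filter_forall => i; exact: increments_summable.
have h2 := ae_foralln M_continuous.
by move: h1 h2; apply: filterS2 => w.
Qed.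

Let I s w : 'cV[R]_n :=
  if `[< good w >] then \col_i limn (fun k => M k s w i 0) else 0.

Let I_cvg s w i : good w -> 0 <= s <= r -> M k s w i 0 @[k --> \oo] --> I s w i 0.
Proof.
move=> gw sr; rewrite /I asboolT // mxE.
have [/(_ i)[K hK] _] := gw.
have [cu _] := @geometric_cvg_from R (fun k => M k s w i 0) K (fun k Kk => hK k Kk s sr).
exact: cu.
Qed.

Let M_Fmeas k s i : 0 <= s -> Fmeas P B s (fun w => M k s w i 0) /\ sqint P (fun w => M k s w i 0).
Proof. by move=> s0; have [+ _] := wiener_sum_mart P_complete BM i (MW k); apply. Qed.

Let good_Fmeas s : measurable (good : set (augmented_past P B s)).
Proof. by rewrite -(setCK good); apply: measurableC; exact: aug_negligible. Qed.

Let I_Fmeas s i : 0 <= s <= r -> Fmeas P B s (fun w => I s w i 0).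
Proof.
move=> sr; have /andP[s0 _] := sr.
apply: (@measurable_fun_cvg _ (augmented_past P B s) R setT (fun k w => \1_good w * M k s w i 0)).
  move=> k; apply: measurable_funM; last by have [] := M_Fmeas k i s0.
  by apply: measurable_indic; exact: good_Fmeas.
move=> w _; have [gw|gw] := pselect (good w).
  rewrite indicE mem_set //; under eq_fun do rewrite mul1r.
  exact: I_cvg.
rewrite indicE memNset //; under eq_fun do rewrite mul0r.
rewrite /I asboolF // mxE; exact: cvg_cst.
Qed.

Let I_continuous w i : {within `[0, r], continuous (fun s => I s w i 0)}.
Proof.
have [gw|gw] := pselect (good w); last first.
  have -> : (fun s => I s w i 0) = (fun=> 0).
    by apply/funext => s; rewrite /I asboolF // mxE.
  by move=> x; exact: cvg_cst.
apply: (@within_continuous_uniform_limit R _ _ (fun k s => M k s w i 0)).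
  by move=> k; case: gw => _; apply.
move=> e e0; have [/(_ i)[K hK] _] := gw.
have : (2^-1 : R) ^+ k @[k --> \oo] --> (0 : R).
  by apply: cvg_expr; rewrite ger0_norm // invf_lt1 // ltr1n.
move=> /cvgrPdist_le /(_ (e / 2)) [|N0 _ hN]; first by rewrite divr_gt0.
exists (maxn K N0) => s; rewrite /= in_itv /= => sr.
have [_ bd] := @geometric_cvg_from R (fun k => M k s w i 0) K (fun k Kk => hK k Kk s sr).
rewrite /I asboolT // mxE; apply: le_trans (bd _ (leq_maxl _ _)) _.
have := hN (maxn K N0) (leq_maxr _ _); rewrite /= sub0r normrN.
by move=> /(le_trans (ler_norm _)); rewrite exprVn => h1; lra.
Qed.

(** Fatou's lemma: the mean square of M_k - I is at most the lower limit in l of that of M_k - M_l,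
    which is at most 2 eps k + 2 eps l <= 4 eps k for l >= k. *)
Let I_dist_le k s : 0 <= s <= r ->
  (\int[P]_w (enorm (M k s w - I s w) ^+ 2)%:E <= (4 * eps k)%:E)%E.
Proof.
move=> sr; have /andP[s0 _] := sr.
have mMl l i : measurable_fun setT (fun w => M l s w i 0) by have [_ []] := M_Fmeas l i s0.
have mI i : measurable_fun setT (fun w => I s w i 0) by exact: Fmeas_measurable (I_Fmeas i sr).
have mg : measurable_fun setT (\1_good : Omega -> R).
  have mgood : measurable good by exact: (@aug_measurable _ _ _ P d B P_complete BM 0).
  exact: measurable_indic.
have mE (X Y : Omega -> 'cV[R]_n) : (forall i, measurable_fun setT (fun w => X w i 0)) ->
    (forall i, measurable_fun setT (fun w => Y w i 0)) ->
    measurable_fun setT (fun w => enorm (X w - Y w) ^+ 2).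
  move=> mX mY; apply: measurable_funX; apply: measurable_enorm => //.
  apply: measurable_mxB => //; apply/measurable_mxP => // i j; rewrite (ord1 j) //.
(* The factor makes these functions converge at every w, since I is the limit of the M_l only on
   [good]. *)
pose f l w : \bar R := (\1_good w * enorm (M k s w - M l s w) ^+ 2)%:E.
have fE : (\int[P]_w (enorm (M k s w - I s w) ^+ 2)%:E = \int[P]_w limn_einf (f^~ w))%E.
  have lf w : limn_einf (f^~ w) = (\1_good w * enorm (M k s w - I s w) ^+ 2)%:E.
    have cf : f^~ w @ \oo --> (\1_good w * enorm (M k s w - I s w) ^+ 2)%:E.
      apply: cvg_EFin; first exact: nearW.
      have [gw|gw] := pselect (good w); last first.
        by rewrite /f /comp /= indicE memNset // mul0r; under eq_fun do rewrite mul0r; exact: cvg_cst.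
      rewrite /f /comp /=; apply: cvgMr; under eq_fun do rewrite enorm_sqr.
      rewrite enorm_sqr; apply: cvg_big => [|i _]; first exact: add_continuous.
      apply: cvg_big => [|j _]; first exact: add_continuous.
      have ce : (M k s w - M l s w) i j @[l --> \oo] --> (M k s w - I s w) i j.
        rewrite (ord1 j) [X in _ --> X]mxE [X in _ --> _ + X]mxE.
        under eq_fun do rewrite mxE [X in _ + X]mxE.
        by apply: cvgB; [exact: cvg_cst|exact: I_cvg].
      by under eq_fun do rewrite expr2; rewrite expr2; exact: (cvgM ce ce).
    by rewrite is_cvg_limn_einfE; [exact: cvg_lim|apply/cvg_ex; eexists; exact: cf].
  under [RHS]eq_integral do rewrite lf.
  apply: ge0_ae_eq_integral => //.
  - by apply/measurable_EFinP; apply: mE.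
  - by apply/measurable_EFinP; apply: measurable_funM => //; apply: mE.
  - by move=> w _; rewrite lee_fin sqr_ge0.
  - by move=> w _; rewrite lee_fin mulr_ge0 ?sqr_ge0 // indicE.
  - by move: good_ae; apply: filterS => w gw _; rewrite indicE mem_set // mul1r.
rewrite fE; apply: (@le_trans _ _ (limn_einf (fun l => \int[P]_w f l w)%E)).
  apply: fatou => //.
    by move=> l; apply/measurable_EFinP; apply: measurable_funM => //; exact: mE.
  by move=> l w _; rewrite lee_fin mulr_ge0 ?sqr_ge0 // indicE.
apply: (@limn_einf_le _ _ k) => l kl.
apply: (@le_trans _ _ (\int[P]_w (enorm (M k s w - M l s w) ^+ 2)%:E)%E).
  apply: ge0_le_integral_sup => w _; first by rewrite lee_fin mulr_ge0 ?sqr_ge0 // indicE.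
  by rewrite lee_fin ler_piMl ?sqr_ge0 // indicE lern1; case: (_ \in _).
rewrite integral_enorm_sqr; last first.
  move=> i j; rewrite (ord1 j); have W := wiener_sumB (MW k) (MW l).
  by have [+ _] := wiener_sum_mart P_complete BM i W; move=> /(_ s s0)[].
rewrite lee_fin; apply: le_trans (_ : 2 * eps k + 2 * eps l <= _); last first.
  by have := eps_le kl; lra.
apply: le_trans (dist_le k l sr); apply: ler_sum => i _.
by rewrite big_ord1.
Qed.

Let four_eps_cvg : (4 * eps k)%:E @[k --> \oo] --> (0 : \bar R).
Proof.
apply: cvg_EFin; first exact: nearW.
have -> : fine \o (fun k => (4 * eps k)%:E) = (fun k => (8^-1 : R) ^+ k).
  by apply/funext => k /=; rewrite /eps exprVn; field; rewrite expf_neq0.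
by apply: cvg_expr; rewrite ger0_norm // invf_lt1 // ltr1n.
Qed.

Lemma wiener_integral_of_grids : exists hB, ito_integral P B r (fun s _ => h s) hB.
Proof.
exists I; split.
- exact: deterministic_progressive.
- exact: deterministic_square_integrable.
- move=> s sr; apply/measurable_mxP => // i j; rewrite (ord1 j); exact: I_Fmeas.
- apply: aeW => w; apply: within_continuous_mx => i j; rewrite (ord1 j); exact: I_continuous.
- exists S; split.
    apply: (@squeeze_cvge _ _ _ _ (cst 0%E) _ (fun k => (4 * eps k)%:E)) => //; last first.
      exact: cvg_cst.
    apply: nearW => k; apply/andP; split.
      by apply: integral_ge0 => w _; apply: integral_ge0 => u _; rewrite lee_fin sqr_ge0.
    under eq_integral do under eq_integral do rewrite grid_process_eval.
    rewrite integral_cst //= probability_setT mule1; apply: le_trans (proj2 (Nc k)) _.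
    by rewrite lee_fin; have := eps_gt0 k; lra.
  move=> s sr.
  apply: (@squeeze_cvge _ _ _ _ (cst 0%E) _ (fun k => (4 * eps k)%:E)) => //; last first.
    exact: cvg_cst.
  apply: nearW => k; apply/andP; split; last exact: I_dist_le.
  by apply: integral_ge0 => w _; rewrite lee_fin sqr_ge0.
Qed.

End Construction.

Lemma wiener_integral_exists : exists hB, ito_integral P B r (fun s _ => h s) hB.
Proof. by have [N [c Nc]] := approx; exact: wiener_integral_of_grids Nc. Qed.

End WienerIntegral.

(** * The mean-field equation *)

Section MeanFieldBSDE.
Context {R : realType} {dd : measure_display} {Omega : measurableType dd}.
Variables (P : probability Omega R) (d n : nat) (B : R -> Omega -> 'cV[R]_d).
Hypothesis P_complete : measure_is_complete P.
Hypothesis BM : brownian_motion P B.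
Variables (T mu : R) (g : R -> 'cV[R]_n -> 'M[R]_(n, d) -> 'cV[R]_n).
Hypothesis gG : Ghat T mu g.
Variables (h : R -> 'M[R]_(n, d)) (r : R).
Hypothesis r0 : 0 <= r.
Hypothesis rT : r <= T.
Hypothesis hl2 : l2 r h.
Variables (y : 'cV[R]_n) (phi : R -> 'cV[R]_n) (hB : R -> Omega -> 'cV[R]_n).
Hypothesis phi_sol : backward_ode_solution g y h r phi.
Hypothesis hB_ito : ito_integral P B r (fun s _ => h s) hB.

Let phi_continuous : {within `[0, r], continuous phi}.
Proof.
have [[mphi _] gphi phiE] := phi_sol; have [mh _] := hl2.
have [ci _] := integral_curve_regular gG r0 rT mh y mphi gphi.
have : {within `[0, r], continuous (fun s => y + vec_int s r (fun u => g u (phi u) (h u)))}.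
  by apply: within_continuous_mx => i j; rewrite (ord1 j); exact: ci.
apply: subspace_eq_continuous => s; rewrite inE /= in_itv /= => sr.
by rewrite /from_subspace /=; apply/esym; exact: phiE.
Qed.

Let sqint_entry s i : 0 <= s <= r -> sqint P (fun w => phi s i 0 + hB s w i 0).
Proof.
by move=> sr; apply: sqintD; [exact: sqint_cst|exact: (sqint_ito P_complete BM hB_ito sr i)].
Qed.

Let mean s : 0 <= s <= r -> vec_expectation P (fun w => phi s + hB s w) = phi s.
Proof.
move=> sr; apply/matrixP => i j; rewrite (ord1 j) mxE unlock.
have -> : fine (\int[P]_w (((phi s + hB s w) i 0)%:E))%E =
    ip P (fun w => phi s i 0 + hB s w i 0) (fun=> 1).
  by rewrite /ip; congr fine; apply: eq_integral => w _; rewrite mxE mulr1.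
rewrite ipDl; [|exact: sqint_cst|exact: (sqint_ito P_complete BM hB_ito sr i)|exact: sqint_cst].
rewrite (mean_ito P_complete BM hB_ito sr) addr0 /ip.
by under eq_Rintegral do rewrite mulr1; rewrite Rintegral_cst //= probability_setT mulr1.
Qed.

Lemma mfbsde_of_backward_ode :
  mfbsde_solution P B g r (fun w => y + hB r w) (fun s w => phi s + hB s w) (fun s _ => h s).
Proof.
have [_ _ _ cB _] := hB_ito; have [_ gphi phiE] := phi_sol.
split.
- split.
    move=> s sr; apply/measurable_mxP => // i j; rewrite (ord1 j).
    have -> : (fun w => (phi s + hB s w) i 0) = (fun w => phi s i 0 + hB s w i 0).
      by apply/funext => w; rewrite mxE.
    apply: measurable_funD; first exact: measurable_cst.
    exact: (ito_Fmeas hB_ito sr i).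
  move: cB; apply: filterS => w cw; apply: within_continuous_mx => i j x.
  have -> : (fun s => (phi s + hB s w) i j) = (fun s => phi s i j + hB s w i j).
    by apply/funext => s; rewrite mxE.
  apply: cvgD; first exact: (within_continuous_entry phi_continuous).
  exact: (within_continuous_entry cw).
- move=> s sr; rewrite integral_enorm_sqr ?ltry // => i j; rewrite (ord1 j).
  have -> : (fun w => (phi s + hB s w) i 0) = (fun w => phi s i 0 + hB s w i 0).
    by apply/funext => w; rewrite mxE.
  exact: sqint_entry.
- by split; [exact: deterministic_progressive|exact: deterministic_square_integrable].
- apply: aeW => w; apply: le_lt_trans gphi.
  rewrite le_eqVlt; apply/orP; left; apply/eqP.
  by apply: eq_integral => u; rewrite inE /= in_itv /= => ur; rewrite mean.
- exists hB; split=> //; apply: aeW => w s sr.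
  have -> : vec_int s r (fun u => g u (vec_expectation P (fun w0 => phi u + hB u w0)) (h u)) =
      vec_int s r (fun u => g u (phi u) (h u)).
    apply/matrixP => i j; rewrite !mxE; apply: eq_Rintegral => u.
    rewrite inE /= in_itv /= => /andP[su ur]; rewrite mean //.
    by have /andP[s0 _] := sr; rewrite (le_trans s0 su).
  by rewrite (phiE s sr); apply/matrixP => i j; rewrite !mxE; ring.
Qed.

End MeanFieldBSDE.

(** * Recovering the generator *)

Section RightAverage.
Context {R : realType}.
Notation leb := (@lebesgue_measure R).

Let mitv (a b : R) : (measurable : set (set (measurableTypeR R))) `[a, b]%classic.
Proof. exact: measurable_itv. Qed.

(** Almost everywhere differentiability of the primitive of f extended by 0 to the line, restricted
    to increments on the right; for small eps the interval [t, t + eps] stays in [0, T]. *)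
Lemma ae_right_average (f : R -> R) T : leb.-integrable `[0, T] (EFin \o f) ->
  {ae leb, forall t, 0 <= t < T ->
     eps^-1 * (\int[leb]_(u in `[t, t + eps]) f u) @[eps --> (0 : R)^'+] --> f t}.
Proof.
move=> intf.
pose F := f \_ `[0, T].
have intF : leb.-integrable setT (EFin \o F).
  rewrite /F -restrict_EFin; apply/(integrable_mkcond _ (mitv 0 T)).1; exact: intf.
have intFS (A : set (measurableTypeR R)) : measurable A -> leb.-integrable A (EFin \o F).
  by move=> mA; apply: integrableS intF.
have locF : locally_integrable setT F.
  by apply: open_integrable_locally => //; exact: openT.
have := FTC1Ny (fun y => intFS _ (measurable_itv _)) locF.
apply: filterS; first exact: (ae_filter_ringOfSetsType leb).
move=> t [dF F'] /andP[t0 tT].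
pose G x := \int[leb]_(u in [set` `]-oo, x]]) F u.
have Ft : F t = f t by rewrite /F patchE mem_set //= in_itv /= t0 ltW.
have c : h^-1 *: (G (h + t) - G t) @[h --> 0^'] --> f t.
  rewrite -Ft -F'; have dc : cvg ((fun h : R => h^-1 *: (G (h *: (1 : R) + t) - G t)) @ 0^') := dF.
  have e : (fun h : R => h^-1 *: (G (h *: (1 : R) + t) - G t)) =
      (fun h => h^-1 *: (G (h + t) - G t)).
    by apply/funext => h; rewrite /GRing.scale /= mulr1.
  by rewrite e in dc; exact: dc.
apply/cvgrPdist_le => e e0; move: c => /cvgrPdist_le /(_ e e0) h.
have h2 : nbhs (0 : R) [set x | x != 0 -> `|f t - x^-1 *: (G (x + t) - G t)| <= e] by exact: h.
have h3 : \forall x \near (0 : R), `|x| < T - t by apply: nbhs0_lt; rewrite subr_gt0.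
have h4 : nbhs (0 : R) [set x | 0 < x -> `|f t - x^-1 * \int[leb]_(u in `[t, t + x]) f u| <= e].
  move: h2 h3; apply: filterS2 => x hx /(le_lt_trans (ler_norm _)) xT x0.
  move: hx; rewrite /= gt_eqF // => /(_ isT).
  suff -> : G (x + t) - G t = \int[leb]_(u in `[t, t + x]) f u by [].
  rewrite /G (addrC x) (@Rintegral_itvB R F -oo%O (BRight (t + x)) t).
  - rewrite Rintegral_itv_obnd_cbnd; last exact: intFS.
    apply: eq_Rintegral => u; rewrite inE /= in_itv /= => /andP[tu ux].
    rewrite /F patchE mem_set //= in_itv /= (le_trans t0 tu) /=.
    by apply: le_trans ux _; rewrite -lerBrDl ltW.
  - exact: intFS.
  - by rewrite bnd_simp.
  - by rewrite bnd_simp lerDl ltW.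
exact: h4.
Qed.

(** The integral is eps times its average, and the average converges. *)
Lemma cvg_shrinking_integral (f : R -> R) (t l : R) :
  eps^-1 * (\int[leb]_(u in `[t, t + eps]) f u) @[eps --> (0 : R)^'+] --> l ->
  \int[leb]_(u in `[t, t + eps]) f u @[eps --> (0 : R)^'+] --> (0 : R).
Proof.
move=> c; have c0 : eps @[eps --> (0 : R)^'+] --> (0 : R).
  by apply: cvg_at_right_filter; exact: cvg_id.
have := cvgM c0 c; rewrite mul0r => /(_ _) h.
apply: cvg_trans h; apply: near_eq_cvg.
near=> eps; rewrite /= mulrA divff ?mul1r // gt_eqF //.
Unshelve. all: by end_near. Qed.

End RightAverage.

(** * The backward equation over a short horizon *)

Section SmallHorizon.
Context {R : realType} {n d : nat}.
Variables (T mu : R) (g : R -> 'cV[R]_n -> 'M[R]_(n, d) -> 'cV[R]_n).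
Hypothesis mu_gt0 : 0 < mu.
Hypothesis gG : Ghat T mu g.
Variables (y : 'cV[R]_n) (z : 'M[R]_(n, d)).
Notation leb := (@lebesgue_measure R).

Let mitv (a b : R) : (measurable : set (set (measurableTypeR R))) `[a, b]%classic.
Proof. exact: measurable_itv. Qed.

Let f i u := g u y z i 0.

Lemma driver_entry_integrable i : 0 <= T -> leb.-integrable `[0, T] (EFin \o f i).
Proof.
move=> T0; have [_ _ gz] := gG.
have mz : measurable_fun `[0, T] ((fun=> z) : R -> borel_mx R n d) by exact: measurable_cst.
have my : measurable_fun `[0, T] ((fun=> y) : R -> borel_mx R n 1) by exact: measurable_cst.
apply: (entry_integrable i (lexx 0) (lexx T) (F := fun u => g u y z)).
  exact: (driver_measurable gG (lexx T) mz my).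
by apply: (driver_integral_lty mu_gt0 gG T0 (lexx T) mz (K := enorm y) (gz z) my).
Qed.

Variables (t eps : R) (phi : R -> 'cV[R]_n).
Hypothesis t0 : 0 <= t.
Hypothesis e0 : 0 < eps.
Hypothesis eT : t + eps <= T.
Let h s := (\1_(`[t, t + eps]) s : R) *: z.
Hypothesis phi_sol : backward_ode_solution g y h (t + eps) phi.
Hypothesis eps_small : n%:R * mu * eps <= 2^-1.

Let r := t + eps.
Let r0 : 0 <= r. Proof. by rewrite addr_ge0 // ltW. Qed.
Let tr : t <= r. Proof. by rewrite lerDl ltW. Qed.
Let A := \sum_i \int[leb]_(u in `[t, r]) `|f i u|.

Let mh : measurable_fun `[0, r] (h : R -> borel_mx R n d).
Proof.
apply/measurable_mxP; first exact: mitv.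
move=> i j; have -> : (fun u => h u i j) = (fun u => (\1_(`[t, t + eps]) u : R) * z i j).
  by apply/funext => u; rewrite /h mxE.
by apply: measurable_funM => //; apply: measurable_indic; exact: mitv.
Qed.

Let hE u : t <= u <= r -> h u = z.
Proof. by move=> ur; rewrite /h indicE mem_set ?scale1r //= in_itv /= ur. Qed.

Let my : measurable_fun `[0, r] ((fun=> y) : R -> borel_mx R n 1).
Proof. exact: measurable_cst. Qed.

(** [h] takes only the values 0 and [z], so the integrand is dominated by the sum of the two
    integrands that [Ghat] makes integrable. *)
Let g0_lty : (\int[leb]_(s in `[0%R, r]) (enorm (g s 0 (h s)))%:E < +oo)%E.
Proof.
have [_ _ gz] := gG.
have m0 w : measurable_fun `[0, r] (fun s => (enorm (g s 0 w))%:E).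
  apply/measurable_EFinP; apply: measurable_enorm; first exact: mitv.
  have mw : measurable_fun `[0, r] ((fun=> w) : R -> borel_mx R n d) by exact: measurable_cst.
  have m1 : measurable_fun `[0, r] ((fun=> 0) : R -> borel_mx R n 1) by exact: measurable_cst.
  exact: (driver_measurable gG eT mw m1).
apply: (@le_lt_trans _ _ (\int[leb]_(s in `[0%R, r]) ((enorm (g s 0 0))%:E + (enorm (g s 0 z))%:E))%E).
  apply: ge0_le_integral_sup => u _; first by rewrite lee_fin enorm_ge0.
  rewrite -EFinD lee_fin /h indicE; case: (_ \in _); first by rewrite scale1r lerDr enorm_ge0.
  by rewrite scale0r lerDl enorm_ge0.
rewrite ge0_integralD //; try exact: mitv; try exact: m0;
  try by move=> u _; rewrite lee_fin enorm_ge0.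
have lt w : (\int[leb]_(s in `[0%R, r]) (enorm (g s 0 w))%:E < +oo)%E.
  apply: le_lt_trans (gz w); apply: ge0_subset_integral => //; try exact: mitv.
  - apply/measurable_EFinP; apply: measurable_enorm; first exact: mitv.
    have mw : measurable_fun `[0, T] ((fun=> w) : R -> borel_mx R n d) by exact: measurable_cst.
    have m1 : measurable_fun `[0, T] ((fun=> 0) : R -> borel_mx R n 1) by exact: measurable_cst.
    exact: (driver_measurable gG (lexx T) mw m1).
  - by move=> u _; rewrite lee_fin enorm_ge0.
  - by apply: subset_itvl; rewrite bnd_simp.
by apply: lte_add_pinfty; exact: lt.
Qed.

Let phiE s i : t <= s <= r ->
  phi s i 0 - y i 0 = \int[leb]_(u in `[s, r]) g u (phi u) (h u) i 0.
Proof.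
move=> /andP[ts sr]; have [_ _ e] := phi_sol.
by rewrite e ?(le_trans t0 ts) // !mxE addrAC subrr add0r.
Qed.

(** Freezing the solution at its terminal value [y] changes the driver by at most mu K, on an
    interval of length r - s. *)
Let driver_gap s i K : t <= s <= r -> (forall u, t <= u <= r -> enorm (phi u - y) <= K) ->
  `|phi s i 0 - y i 0 - \int[leb]_(u in `[s, r]) f i u| <= mu * (K * (r - s)).
Proof.
move=> sr bK; have /andP[ts sr'] := sr; have [[mphi _] gphi _] := phi_sol.
have -> : \int[leb]_(u in `[s, r]) f i u = \int[leb]_(u in `[s, r]) g u y (h u) i 0.
  apply: eq_Rintegral => u; rewrite inE /= in_itv /= => /andP[su ur].
  by rewrite hE // ur (le_trans ts su).
rewrite phiE //.
have gy : (\int[leb]_(s in `[0%R, r]) (enorm (g s y (h s)))%:E < +oo)%E.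
  by apply: (driver_integral_lty mu_gt0 gG r0 eT mh (K := enorm y) g0_lty my).
have leK : leb `[s, r]%classic = (r - s)%:E.
  by rewrite lebesgue_measure_itv /= lte_fin; case: ltP => rs; [by rewrite EFinB|congr EFin; lra].
have iK : leb.-integrable `[s, r] (EFin \o (fun=> K)).
  apply/integrableP; split; first exact: measurable_cst.
  rewrite integral_cst; last exact: mitv.
  by rewrite (_ : _ `[s, r]%classic = (r - s)%:E) // -EFinM ltry.
have KE : \int[leb]_(u in `[s, r]) K = K * (r - s).
  rewrite Rintegral_cst; last exact: mitv.
  by rewrite (_ : _ `[s, r]%classic = (r - s)%:E).
rewrite -KE; apply: (driver_lipschitz mu_gt0 gG eT mh i _ mphi my gphi gy iK).
  by rewrite (le_trans t0 ts).
by move=> u /andP[su ur]; apply: bK; rewrite ur (le_trans ts su).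
Qed.

Let fi i : leb.-integrable `[t, r] (EFin \o f i).
Proof.
have T0 : 0 <= T by exact: le_trans r0 eT.
apply: integrableS (driver_entry_integrable i T0); try exact: mitv.
move=> u /=; rewrite !in_itv /= => /andP[tu ur].
by rewrite (le_trans t0 tu) (le_trans ur eT).
Qed.

Let int_f_le s i : t <= s <= r -> `|\int[leb]_(u in `[s, r]) f i u| <= A.
Proof.
move=> /andP[ts sr].
have sub : `[s, r]%classic `<=` `[t, r]%classic by apply: subset_itvr; rewrite bnd_simp.
have fs : leb.-integrable `[s, r] (EFin \o f i) by apply: integrableS (fi i); try exact: mitv.
apply: le_trans (le_normr_Rintegral _ fs) _; first exact: mitv.
apply: (@le_trans _ _ (\int[leb]_(u in `[t, r]) `|f i u|)).
  rewrite (@Rintegral_itv_bounds R (fun u => `|f i u|) t s r) //; last exact: integrable_norm.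
  by rewrite lerBlDr lerDl; apply: Rintegral_ge0.
rewrite /A (bigD1 i) //= lerDl; apply: sumr_ge0 => j _.
by apply: Rintegral_ge0.
Qed.

(* The bound is self-improving: a bound K on [t, r] yields n (A + mu K eps), which
   is at most n A + K / 2. *)
Lemma ode_deviation_le u : t <= u <= r -> enorm (phi u - y) <= 2 * n%:R * A.
Proof.
pose E := [set enorm (phi u - y) | u in [set u | t <= u <= r]].
have [[mphi _] gphi pE] := phi_sol.
have [_ [_ [K hK]]] := integral_curve_regular gG r0 eT mh y mphi gphi.
(* A finite supremum is what allows the term sup E / 2 to be moved to the other side; it comes from
   the boundedness of the solution. *)
have Ebdd : has_ubound E.
  exists (2 * (K + enorm (- y))) => _ [v /= /andP[tv vr] <-].
  apply: le_trans (enormD _ _) _; rewrite ler_pM2l // lerD2r.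
  have v0r : 0 <= v <= r by rewrite (le_trans t0 tv).
  by rewrite (pE v v0r); exact: hK.
have E0 : E !=set0 by exists (enorm (phi t - y)), t => //=; rewrite lexx tr.
have ub v : t <= v <= r -> enorm (phi v - y) <= sup E.
  by move=> hv; apply: ub_le_sup => //; exists v.
suff supE : sup E <= 2 * n%:R * A by move=> hu; exact: le_trans (ub u hu) supE.
have S0 : 0 <= sup E by apply: le_trans (enorm_ge0 _) (ub t _); rewrite lexx tr.
have : sup E <= n%:R * (A + mu * (sup E * eps)).
  apply: ge_sup => // _ [s /= sr <-]; apply: enorm_cV_le => i.
  have /andP[ts sr'] := sr.
  have -> : (phi s - y) i 0 = (phi s i 0 - y i 0 - \int[leb]_(u in `[s, r]) f i u) +
      \int[leb]_(u in `[s, r]) f i u by rewrite !mxE subrK.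
  apply: le_trans (ler_normD _ _) _; rewrite addrC; apply: lerD; first exact: int_f_le.
  apply: le_trans (driver_gap i sr ub) _; rewrite ler_pM2l //; apply: ler_wpM2l => //.
  by rewrite /r; lra.
have := ler_wpM2r S0 eps_small; lra.
Qed.

(** [driver_gap] at s = t with the bound of [ode_deviation_le]: dividing by eps cancels the length
    of the interval and leaves [A], which vanishes with eps at almost every t. *)
Lemma ode_increment_quotient i :
  `|(eps^-1 *: (phi t - y)) i 0 - eps^-1 * \int[leb]_(u in `[t, t + eps]) f i u|
   <= 2 * n%:R * mu * A.
Proof.
have tt : t <= t <= r by rewrite lexx tr.
have := driver_gap i tt ode_deviation_le; rewrite !mxE -mulrBr normrM.
rewrite gtr0_norm ?invr_gt0 // -/r ler_pdivrMl // => /le_trans; apply.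
by rewrite /r; lra.
Qed.

End SmallHorizon.

(** [f] need not be measurable, as [Y] is arbitrary on null events: it is dominated everywhere by
    the measurable function equal to +oo on a null event and to [c] elsewhere. *)
Lemma ge0_integral_ae_le_cst d (S : measurableType d) (R : realType)
  (P : probability S R) (f : S -> \bar R) (c : R) : (forall w, 0 <= f w)%E -> 0 <= c ->
  {ae P, forall w, (f w <= c%:E)%E} -> (\int[P]_w f w <= c%:E)%E.
Proof.
move=> f0 c0 [N [mN PN0 fN]].
pose k w : \bar R := if w \in N then +oo%E else c%:E.
apply: (@le_trans _ _ (\int[P]_w k w)%E).
  apply: ge0_le_integral_sup => w _; first exact: f0.
  rewrite /k; case: ifPn => wN; first exact: leey.
  by apply: contrapT => fc; move: wN; rewrite notin_setE; apply; exact: fN.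
rewrite (@ge0_ae_eq_integral _ _ _ P setT k (cst c%:E)) //.
- by rewrite integral_cst //= probability_setT mule1.
- apply: measurable_fun_ifT => //.
  apply: (@measurable_fun_bool _ _ _ _ true); rewrite setTI.
  rewrite [X in measurable X](_ : _ = N) //.
  by apply/seteqP; split => w /=; [move/set_mem|move/mem_set].
- by move=> w _; rewrite /k; case: ifP => _; rewrite ?leey ?lee_fin.
- exists N; split=> // w /= hw; apply: contrapT => wN; apply: hw => _.
  by rewrite /k memNset.
Qed.

(** * Representation of the generator *)

Section GeneratorRepresentation.
Context {R : realType} {n d : nat}.
Variables (T mu : R) (g : R -> 'cV[R]_n -> 'M[R]_(n, d) -> 'cV[R]_n).
Hypothesis n_gt0 : (0 < n)%N.
Hypothesis T_gt0 : 0 < T.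
Hypothesis mu_gt0 : 0 < mu.
Hypothesis gG : Ghat T mu g.
Variables (y : 'cV[R]_n) (z : 'M[R]_(n, d)).
Notation leb := (@lebesgue_measure R).

(** [del] is fixed before [phi], so one null set of times serves all solutions. It adds the errors
    of the averages of the entries of g(., y, z) at [t] to the bound of [ode_increment_quotient];
    hence [t] is a point where the averages of these entries and of their absolute values
    converge. *)
Lemma ae_ode_difference_quotient : {ae leb, forall t, 0 <= t < T ->
  exists del : R -> R, del eps @[eps --> (0 : R)^'+] --> (0 : R) /\
    forall eps phi, 0 < eps -> t + eps <= T -> n%:R * mu * eps <= 2^-1 ->
      backward_ode_solution g y (fun s => (\1_(`[t, t + eps]) s : R) *: z) (t + eps) phi ->
      forall i, `|(eps^-1 *: (phi t - y) - g t y z) i 0| <= del eps}.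
Proof.
pose f i u := g u y z i 0.
have fi i : leb.-integrable `[0, T] (EFin \o f i).
  exact: (driver_entry_integrable mu_gt0 gG y z i (ltW T_gt0)).
have h1 : {ae leb, forall t, forall i, 0 <= t < T ->
    eps^-1 * (\int[leb]_(u in `[t, t + eps]) f i u) @[eps --> (0 : R)^'+] --> f i t}.
  apply: (@filter_forall _ _ _ _ (ae_filter_ringOfSetsType leb)) => i.
  exact: ae_right_average (fi i).
have h2 : {ae leb, forall t, forall i, 0 <= t < T ->
    eps^-1 * (\int[leb]_(u in `[t, t + eps]) `|f i u|) @[eps --> (0 : R)^'+] --> `|f i t|}.
  apply: (@filter_forall _ _ _ _ (ae_filter_ringOfSetsType leb)) => i.
  apply: (@ae_right_average R (fun u => `|f i u|)).
  apply: integrable_norm; exact: fi.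
move: h1 h2; apply: filterS2; first exact: (ae_filter_ringOfSetsType leb).
move=> t c1 c2 tT.
pose A i eps := \int[leb]_(u in `[t, t + eps]) `|f i u|.
exists (fun eps => \sum_i `|eps^-1 * (\int[leb]_(u in `[t, t + eps]) f i u) - f i t| +
  2 * n%:R * mu * \sum_i A i eps); split.
  rewrite -[X in _ --> X](addr0 (0 : R)); apply: cvgD.
    rewrite -[X in _ --> X](_ : \sum_(i < n) (0 : R) = 0); last by rewrite big1.
    apply: cvg_big => [|i _]; first exact: add_continuous.
    rewrite -[X in _ --> X](_ : `|f i t - f i t| = 0); last by rewrite subrr normr0.
    apply: cvg_norm; apply: cvgB; last exact: cvg_cst.
    exact: c1 i tT.
  rewrite -[X in _ --> X](mulr0 (2 * n%:R * mu)); apply: cvgMr.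
  rewrite -[X in _ --> X](_ : \sum_(i < n) (0 : R) = 0); last by rewrite big1.
  apply: cvg_big => [|i _]; first exact: add_continuous.
  exact: cvg_shrinking_integral (c2 i tT).
move=> eps phi e0 eT es sol i; have /andP[t0 _] := tT.
have := ode_increment_quotient mu_gt0 gG t0 e0 eT sol es i => q.
have -> : (eps^-1 *: (phi t - y) - g t y z) i 0 =
    ((eps^-1 * \int[leb]_(u in `[t, t + eps]) f i u) - f i t) +
    ((eps^-1 *: (phi t - y)) i 0 - eps^-1 * \int[leb]_(u in `[t, t + eps]) f i u).
  by rewrite !mxE /f; ring.
apply: le_trans (ler_normD _ _) _; apply: lerD; last exact: q.
by rewrite (bigD1 i) //= lerDl; apply: sumr_ge0.
Qed.

Context {dd : measure_display} {Omega : measurableType dd}.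
Variables (P : probability Omega R) (B : R -> Omega -> 'cV[R]_d).
Hypothesis P_complete : measure_is_complete P.
Hypothesis BM : brownian_motion P B.

(** For each eps the variable [Y eps t] equals phi(t) almost surely, so the deterministic bound
    [del] holds off a null event depending on eps. It controls the mean square for all small eps,
    and a countable union of null events settles each sequence. *)
Lemma generator_representation :
    {ae leb, forall t, 0 <= t < T ->
        forall Y : R -> R -> Omega -> 'cV[R]_n,
        (forall eps, 0 < eps <= T - t ->
           let h := fun s => (\1_(`[t, t + eps]) s : R) *: z in
           exists phi hB,
             [/\ backward_ode_solution g y h (t + eps) phi,
                 ito_integral P B (t + eps) (fun s _ => h s) hB &
                 {ae P, forall w, forall s, 0 <= s <= t + eps ->
                    Y eps s w = phi s + hB s w}]) ->
        (\int[P]_w (enorm (eps^-1 *: (Y eps t w - y) - g t y z) ^+ 2)%:E)%E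
          @[eps --> 0^'+] --> 0%E /\
        (forall e : nat -> R, (forall k, 0 < e k <= T - t) ->
           e k @[k --> \oo] --> 0 ->
           {ae P, forall w,
              (e k)^-1 *: (Y (e k) t w - y) @[k --> \oo] --> g t y z})}.
Proof.
have := ae_ode_difference_quotient.
apply: filterS; first exact: (ae_filter_ringOfSetsType leb).
move=> t q tT Y hY; have [del [dc db]] := q tT; have /andP[t0 tlT] := tT.
have bnd eps : 0 < eps <= T - t -> n%:R * mu * eps <= 2^-1 ->
    {ae P, forall w, forall i, `|(eps^-1 *: (Y eps t w - y) - g t y z) i 0| <= del eps}.
  move=> /andP[e0 eT] es; have [|phi [hB [sol ito YE]]] := hY eps; first by rewrite e0.
  have tr : 0 <= t <= t + eps by rewrite t0 lerDl ltW.
  have hB0 : {ae P, forall w, hB t w = 0}.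
    (* At time [t] itself the integrand is [z]; [ito_eq0] only looks strictly before [t]. *)
    apply: (ito_eq0 P_complete BM ito tr) => u w /andP[_ ut].
    by rewrite indicE memNset ?scale0r //= in_itv /= leNgt ut.
  move: hB0 YE; apply: filterS2 => w hB0 YE i; rewrite YE // hB0 addr0.
  by apply: db => //; rewrite -lerBrDl.
(* The second condition is the smallness under which [ode_deviation_le] absorbs its own bound. *)
have small : \forall eps \near (0 : R)^'+, [/\ 0 < eps <= T - t & n%:R * mu * eps <= 2^-1].
  have c0 : 0 < 2 * n%:R * mu by rewrite !mulr_gt0 // ltr0n.
  near=> eps.
  have e0 : 0 < eps by near: eps; exact: nbhs_right_gt.
  have e1 : eps < T - t by near: eps; apply: nbhs_right_lt; rewrite subr_gt0.
  have e2 : eps < (2 * n%:R * mu)^-1 by near: eps; apply: nbhs_right_lt; rewrite invr_gt0.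
  split; first by rewrite e0 ltW.
  move: e2; rewrite -(ltr_pM2l c0) divff ?gt_eqF // => e2; lra.
split.
  apply: (@squeeze_cvge _ _ _ _ (cst 0%E) _ (fun eps => (n%:R * (del eps * del eps))%:E)).
  - move: small; apply: filterS => eps [eT es]; apply/andP; split.
      by apply: integral_ge0 => w _; rewrite lee_fin sqr_ge0.
    apply: ge0_integral_ae_le_cst.
    + by move=> w; rewrite lee_fin sqr_ge0.
    + by rewrite mulr_ge0 // -expr2 sqr_ge0.
    have := bnd eps eT es; apply: filterS => w hw; rewrite lee_fin enorm_sqr.
    rewrite mulr_natl -[n in X in _ <= X]card_ord -sumr_const; apply: ler_sum => i _.
    rewrite big_ord1 -expr2 -real_normK ?num_real // lerXn2r ?nnegrE //.
    exact: le_trans (hw i).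
  - exact: cvg_cst.
  - apply: cvg_EFin; first exact: nearW.
    rewrite -[X in _ --> X](mulr0 n%:R); apply: cvgMr.
    by rewrite -[X in _ --> X](mulr0 (0 : R)); exact: (cvgM dc dc).
move=> e eT ec.
have ce : e k @[k --> \oo] --> (0 : R)^'+.
  move=> W hW; have hW2 : nbhs (0 : R) [set x | 0 < x -> W x] by exact: hW.
  have h3 : \forall k \near \oo, 0 < e k -> W (e k) := ec _ hW2.
  by apply: (filterS _ h3) => k; apply; have /andP[] := eT k.
have dce : del (e k) @[k --> \oo] --> (0 : R) := cvg_comp _ _ ce dc.
have se : \forall k \near \oo, [/\ 0 < e k <= T - t & n%:R * mu * e k <= 2^-1] := ce _ small.
have : {ae P, forall w, forall k, n%:R * mu * e k <= 2^-1 ->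
    forall i, `|((e k)^-1 *: (Y (e k) t w - y) - g t y z) i 0| <= del (e k)}.
  apply: ae_foralln => k; have [es|es] := boolP (n%:R * mu * e k <= 2^-1).
    by have := bnd (e k) (eT k) es; apply: filterS.
  exact: aeW.
apply: filterS => w hw; apply: cvg_mx => i j; rewrite (ord1 j).
apply/cvgrPdist_le => c c0; move: dce => /cvgrPdist_le /(_ c c0) dce.
move: dce se; apply: filterS2 => k dk [_ es].
rewrite distrC; have := hw k es i; rewrite !mxE => /le_trans; apply.
by apply: le_trans dk; rewrite sub0r normrN ler_norm.
Unshelve. all: by end_near.
Qed.

End GeneratorRepresentation.

Theorem proposition2p8 (R : realType) (dd : measure_display)
  (Omega : measurableType dd) (P : probability Omega R)
  (P_complete : measure_is_complete P)
  (n d : nat) (n_gt0 : (0 < n)%N) (d_gt0 : (0 < d)%N)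
  (T mu : R) (T_gt0 : 0 < T) (mu_gt0 : 0 < mu)
  (B : R -> Omega -> 'cV[R]_d) (BM : brownian_motion P B) :
  (forall (t : R) (y : 'cV[R]_n) (eps : R)
     (g : R -> 'cV[R]_n -> 'M[R]_(n, d) -> 'cV[R]_n) (h : R -> 'M[R]_(n, d)),
     0 <= t < T -> 0 <= eps <= T - t ->
     Ghat T mu g -> l2 (t + eps) h ->
     (\int[lebesgue_measure]_(s in `[0%R, (t + eps)%R])
        (enorm (g s 0%R (h s)))%:E < +oo)%E ->
     [/\ exists phi, backward_ode_solution g y h (t + eps) phi,
         exists hB, ito_integral P B (t + eps) (fun s _ => h s) hB &
         forall phi hB,
           backward_ode_solution g y h (t + eps) phi ->
           ito_integral P B (t + eps) (fun s _ => h s) hB ->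
           mfbsde_solution P B g (t + eps)
             (fun w => y + hB (t + eps) w)
             (fun s w => phi s + hB s w) (fun s _ => h s)]) /\
  (forall (y : 'cV[R]_n) (z : 'M[R]_(n, d))
     (g : R -> 'cV[R]_n -> 'M[R]_(n, d) -> 'cV[R]_n),
     Ghat T mu g ->
     {ae (@lebesgue_measure R), forall t, 0 <= t < T ->
        forall Y : R -> R -> Omega -> 'cV[R]_n,
        (forall eps, 0 < eps <= T - t ->
           let h := fun s => (\1_(`[t, t + eps]) s : R) *: z in
           exists phi hB,
             [/\ backward_ode_solution g y h (t + eps) phi,
                 ito_integral P B (t + eps) (fun s _ => h s) hB &
                 {ae P, forall w, forall s, 0 <= s <= t + eps ->
                    Y eps s w = phi s + hB s w}]) ->
        (\int[P]_w (enorm (eps^-1 *: (Y eps t w - y) - g t y z) ^+ 2)%:E)%E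
          @[eps --> 0^'+] --> 0%E /\
        (forall e : nat -> R, (forall k, 0 < e k <= T - t) ->
           e k @[k --> \oo] --> 0 ->
           {ae P, forall w,
              (e k)^-1 *: (Y (e k) t w - y) @[k --> \oo] --> g t y z})}).
Proof.
split=> [t y eps g h /andP[t0 tT] /andP[e0 eT] gG hl2 g0 | y z g gG].
  have r0 : 0 <= t + eps by exact: addr_ge0.
  have rT : t + eps <= T by rewrite addrC -lerBrDr.
  split.
  - by have [mh _] := hl2; exact: (backward_ode_exists mu_gt0 gG r0 rT mh n_gt0 g0 y).
  - exact: wiener_integral_exists.
  - by move=> phi hB sol ito; exact: (mfbsde_of_backward_ode P_complete BM gG r0 rT hl2 sol ito).
exact: (generator_representation n_gt0 T_gt0 mu_gt0 gG y z P_complete BM).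
Qed.
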